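(* Let $n\ge1$, let $Q,B\in M_n(\mathbb{R})$ with $Q$ symmetric positive semi-definite, and let $P=\frac12\mathrm{Tr}(Q\nabla_x^2)+\langle Bx,\nabla_x\rangle$, $x\in\mathbb{R}^n$, be a hypoelliptic Ornstein-Uhlenbeck operator which admits an invariant measure $d\mu(x)=\rho(x)\,dx$. Let $k_0$ be the smallest integer $0\le k_0\le n-1$ satisfying $\mathrm{Rank}[Q^{1/2},BQ^{1/2},\dots,B^{k_0}Q^{1/2}]=n$. Then there exists a positive constant $C>0$ such that $$\forall v\in D(P),\qquad \|v\|_{H^{\frac{2}{2k_0+1}}(\mathbb{R}^n,d\mu)}\le C\big(\|Pv\|_{L^2_\mu}+\|v\|_{L^2_\mu}\big).$$
   Context: Notation: $\mathrm{Tr}(Q\nabla_x^2)=\sum_{i,j}q_{i,j}\partial^2_{x_i,x_j}$ and $\langle Bx,\nabla_x\rangle=\sum_{i,j}b_{i,j}x_j\partial_{x_i}$. Hypoellipticity of $P$ is known to be equivalent to the Kalman rank condition $\mathrm{Rank}[Q^{1/2},BQ^{1/2},\dots,B^{n-1}Q^{1/2}]=n$ (the $n\times n^2$ matrix obtained by juxtaposing these blocks), and also to $\det Q_t>0$ for some (equivalently all) $t>0$, where $Q_t=\int_0^te^{sB}Qe^{sB^T}ds$. Invariant measure: when hypoelliptic, $P$ generates the Markov semigroup $(T(t)f)(x)=\frac{1}{(2\pi)^{n/2}\sqrt{\det Q_t}}\int_{\mathbb{R}^n}e^{-\frac12\langle Q_t^{-1}y,y\rangle}f(e^{tB}x-y)\,dy$,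 $t>0$; an invariant measure is a probability measure $\mu$ with $\int T(t)f\,d\mu=\int f\,d\mu$ for all $t\ge0$ and all bounded continuous $f$. It is known that existence of an invariant measure is equivalent to $\sigma(B)\subset\{z\in\mathbb{C}:\mathrm{Re}\,z<0\}$, and then it is unique and given by $d\mu=\rho\,dx$ with $\rho(x)=\frac{1}{(2\pi)^{n/2}\sqrt{\det Q_\infty}}e^{-\frac12\langle Q_\infty^{-1}x,x\rangle}$, $Q_\infty=\int_0^{+\infty}e^{sB}Qe^{sB^T}ds$. $L^2_\mu=L^2(\mathbb{R}^n,d\mu)$ and $D(P)=\{u\in L^2_\mu:Pu\in L^2_\mu\}$. Sobolev space: let $A=\frac12\mathrm{Tr}(Q_\infty\nabla_x^2)-\frac12\langle x,\nabla_x\rangle$, the selfadjoint non-positive Ornstein-Uhlenbeck operator on $L^2_\mu$; it has an orthonormal basis of $L^2_\mu$ of (Hermite) polynomial eigenfunctions $(H_\beta)_{\beta\in\mathbb{N}^n}$ with $AH_\beta=-\frac{|\beta|}{2}H_\beta$, $|\beta|=\beta_1+\dots+\beta_n$. For $s>0$, $H^s(\mathbb{R}^n,d\mu)$ is the domain of $(\sqrt{I-A})^s$, i.e. the set of $u\in L^2_\mu$ with $\|u\|^2_{H^s(\mathbb{R}^n,d\mu)}=\|(\sqrt{I-A})^su\|^2_{L^2_\mu}=\sum_{\beta\in\mathbb{N}^n}\big(1+\frac{|\beta|}{2}\big)^s|(u,H_\beta)_{L^2_\mu}|^2<+\infty$. *)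

(* Defs.v *)
From HB Require Import structures.
From mathcomp Require Import all_boot all_order all_algebra.
From mathcomp Require Import all_classical all_reals all_analysis.
From mathcomp Require Import complex ring.

Set Implicit Arguments.
Unset Strict Implicit.
Unset Printing Implicit Defensive.

Import Order.TTheory GRing.Theory Num.Theory.
Import numFieldNormedType.Exports.

Local Open Scope classical_set_scope.
Local Open Scope ring_scope.

(* Matrices carry the product sigma-algebra, generated by the coordinates; on
   'cV[R]_n this is the Borel sigma-algebra. *)
Definition matrix_display : measure_display -> measure_display.
Proof. exact. Qed.

Section matrix_measurable.
Context {d : measure_display} {T : measurableType d} (m n : nat).

Definition g_sigma_matrix : set (set 'M[T]_(m, n)) :=
  <<s \bigcup_(ij in [set: 'I_m * 'I_n])
        preimage_set_system setT (fun M : 'M[T]_(m, n) => M ij.1 ij.2) measurable >>.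

Let g_sigma_matrix0 : g_sigma_matrix set0.
Proof. exact: sigma_algebra0. Qed.

Let g_sigma_matrixC A : g_sigma_matrix A -> g_sigma_matrix (~` A).
Proof. exact: sigma_algebraC. Qed.

Let g_sigma_matrix_bigcup (F : (set 'M[T]_(m, n))^nat) :
  (forall i, g_sigma_matrix (F i)) -> g_sigma_matrix (\bigcup_i (F i)).
Proof. exact: sigma_algebra_bigcup. Qed.

HB.instance Definition _ := @isMeasurable.Build (matrix_display d)
  'M[T]_(m, n) g_sigma_matrix
  g_sigma_matrix0 g_sigma_matrixC g_sigma_matrix_bigcup.

Lemma measurable_fun_coord i j :
  measurable_fun [set: 'M[T]_(m, n)] (fun M : 'M[T]_(m, n) => M i j).
Proof.
move=> _ Y mY; rewrite setTI.
by apply: sub_sigma_algebra; exists (i, j) => //; exists Y => //; rewrite setTI.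
Qed.

Lemma measurable_fun_matrix d' (U : measurableType d') (f : U -> 'M[T]_(m, n)) :
  (forall i j, measurable_fun [set: U] (fun x => f x i j)) ->
  measurable_fun [set: U] f.
Proof.
move=> mf; apply: (@measurability _ _ _ _ _ _
  (\bigcup_(ij in [set: 'I_m * 'I_n])
    preimage_set_system setT (fun M : 'M[T]_(m, n) => M ij.1 ij.2) measurable)) => //.
move=> _ [_ [[i j] _ [Y mY <-]] <-].
rewrite setTI; have := mf i j measurableT Y mY.
by rewrite !setTI.
Qed.

End matrix_measurable.

Section lebesgue_cV.
Context {R : realType}.
Local Open Scope ereal_scope.

Definition cons_cV n (x : R * 'cV[R]_n) : 'cV[R]_n.+1 :=
  \col_i oapp (fun j => x.2 j ord0) x.1 (unlift ord0 i).

Definition uncons_cV n (x : 'cV[R]_n.+1) : R * 'cV[R]_n :=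
  (x ord0 ord0, \col_j x (lift ord0 j) ord0).

Lemma cons_cVK n : cancel (@cons_cV n) (@uncons_cV n).
Proof.
move=> [a v]; rewrite /uncons_cV /cons_cV !mxE unlift_none /=; congr pair.
by apply/colP => j; rewrite !mxE liftK.
Qed.

Lemma measurable_cons_cV n : measurable_fun [set: R * 'cV[R]_n] (@cons_cV n).
Proof.
apply: measurable_fun_matrix => i j; under eq_fun do rewrite mxE.
case: (unlift ord0 i) => [k|] /=; last exact: measurable_fst.
exact: (measurableT_comp (measurable_fun_coord _ _) measurable_snd).
Qed.

Lemma measurable_uncons_cV n :
  measurable_fun [set: 'cV[R]_n.+1] (@uncons_cV n).
Proof.
apply: measurable_fun_pair; first exact: measurable_fun_coord.
apply: measurable_fun_matrix => i j; under eq_fun do rewrite mxE.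
exact: measurable_fun_coord.
Qed.

Section lebesgue_cV_step.
Context {n : nat} (mu : {sigma_finite_measure set 'cV[R]_n -> \bar R}).

Definition lebesgue_cV_step : set 'cV[R]_n.+1 -> \bar R :=
  pushforward (lebesgue_measure \x mu) (@cons_cV n).

Let step0 : lebesgue_cV_step set0 = 0.
Proof. by rewrite /lebesgue_cV_step /pushforward preimage_set0 measure0. Qed.

Let measurable_preim A : measurable A -> measurable (@cons_cV n @^-1` A).
Proof. by move=> mA; rewrite -[X in measurable X]setTI; exact: measurable_cons_cV. Qed.

Let step_ge0 A : 0 <= lebesgue_cV_step A.
Proof. by rewrite /lebesgue_cV_step /pushforward; exact: measure_ge0. Qed.

Let step_sigma_additive : semi_sigma_additive lebesgue_cV_step.
Proof.
move=> F mF tF mUF; rewrite /lebesgue_cV_step /pushforward preimage_bigcup.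
apply: measure_semi_sigma_additive.
- by move=> k; exact: measurable_preim.
- apply/trivIsetP => /= i j _ _ ij; rewrite -preimage_setI.
  by move/trivIsetP : tF => /(_ _ _ _ _ ij) ->//; rewrite preimage_set0.
- by rewrite -preimage_bigcup; exact: measurable_preim.
Qed.

HB.instance Definition _ := isMeasure.Build _ _ _ lebesgue_cV_step
  step0 step_ge0 step_sigma_additive.

Let step_sigma_finite : sigma_finite setT lebesgue_cV_step.
Proof.
have /sigma_finiteP[F [TF ndF Foo]] :=
  sigma_finiteT (@lebesgue_measure R : {sigma_finite_measure set _ -> \bar R}).
have /sigma_finiteP[G [TG ndG Goo]] := sigma_finiteT mu.
exists (fun k => @uncons_cV n @^-1` (F k `*` G k)).
  rewrite -preimage_bigcup -(preimage_setT (@uncons_cV n)); congr (_ @^-1` _).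
  rewrite -setXTT TF TG predeqE => -[x y]; split.
    move=> [/= [k _ Fkx] [l _ Gly]]; exists (maxn k l) => //; split.
    - by move: x Fkx; exact/subsetPset/ndF/leq_maxl.
    - by move: y Gly; exact/subsetPset/ndG/leq_maxr.
  by move=> [k _ []/= ? ?]; split; exists k.
move=> k; have [mFk Fkoo] := Foo k; have [mGk Gkoo] := Goo k; split.
  rewrite -[X in measurable X]setTI; apply: measurable_uncons_cV => //.
  exact: measurableX.
rewrite /lebesgue_cV_step /pushforward -comp_preimage.
rewrite (_ : @uncons_cV n \o @cons_cV n = id); last first.
  by apply/funext => x; exact: cons_cVK.
by rewrite product_measure1E// lte_mul_pinfty// ge0_fin_numE.
Qed.

HB.instance Definition _ := Measure_isSigmaFinite.Build _ _ _ lebesgue_cV_step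
  step_sigma_finite.

End lebesgue_cV_step.

(* The Lebesgue measure of R^n, as an iterated product; see lebesgue_cV_box. *)
Fixpoint lebesgue_cV n : {sigma_finite_measure set 'cV[R]_n -> \bar R} :=
  if n is k.+1 return {sigma_finite_measure set 'cV[R]_n -> \bar R}
  then lebesgue_cV_step (lebesgue_cV k) else dirac (0%R : 'cV[R]_0).


Lemma lebesgue_cV_box n (a b : 'cV[R]_n) :
  (forall i, (a i ord0 <= b i ord0)%R) ->
  lebesgue_cV n [set x | forall i, (a i ord0 <= x i ord0 <= b i ord0)%R] =
  (\prod_i (b i ord0 - a i ord0))%:E.
Proof.
elim: n a b => [|n IHn] a b ab.
  rewrite /= big_ord0 diracE mem_set//; last by case.
have mbox : measurable [set x : 'cV[R]_n |
    forall i, (a (lift ord0 i) ord0 <= x i ord0 <= b (lift ord0 i) ord0)%R].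
  rewrite (_ : mkset _ = \bigcap_(i in [set: 'I_n])
    ((fun x : 'cV[R]_n => x i ord0) @^-1`
      `[a (lift ord0 i) ord0, b (lift ord0 i) ord0]%classic)); last first.
    by apply/seteqP; split => x /= H i; [move=> _|];
      have := H i; rewrite /= in_itv/=; [|exact].
  apply: fin_bigcap_measurable => // i _.
  rewrite -[X in measurable X]setTI.
  exact: measurable_fun_coord.
have -> : lebesgue_cV n.+1
    [set x | forall i, (a i ord0 <= x i ord0 <= b i ord0)%R] =
  (lebesgue_measure \x lebesgue_cV n) (`[a ord0 ord0, b ord0 ord0]%classic
    `*` [set x : 'cV[R]_n | forall i : 'I_n,
      (a (lift ord0 i) ord0 <= x i ord0 <= b (lift ord0 i) ord0)%R]).
  rewrite /= /lebesgue_cV_step /pushforward; congr (_ _).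
  apply/seteqP; split => [[t x]/= H|[t x]/= [ht H] i].
    split => [|i]; first by have := H ord0; rewrite mxE unlift_none in_itv.
    by have := H (lift ord0 i); rewrite mxE liftK.
  rewrite mxE; case: unliftP => [j ->|->] /=; first exact: H.
  by move: ht; rewrite in_itv.
rewrite product_measure1E//=. 
rewrite lebesgue_measure_itv/= lte_fin.
have -> : lebesgue_cV n [set x : 'cV[R]_n | forall i : 'I_n,
    (a (lift ord0 i) ord0 <= x i ord0 <= b (lift ord0 i) ord0)%R] =
    (\prod_(i < n) (b (lift ord0 i) ord0 - a (lift ord0 i) ord0))%:E.
  have := IHn (\col_i a (lift ord0 i) ord0) (\col_i b (lift ord0 i) ord0).
  under eq_bigr do rewrite !mxE.
  move=> <-; last by move=> i; rewrite !mxE.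
  by congr (_ _); apply/seteqP; split => x /= H i; have := H i; rewrite !mxE.
rewrite big_ord_recl EFinM; congr (_ * _).
case: ltP => [_|ba]; first by rewrite EFinB.
by rewrite (@le_anti _ _ (a ord0 ord0) (b ord0 ord0)) ?subrr// ab ba.
Qed.

End lebesgue_cV.

Section matrices.
Context {R : realType} {n : nat}.
Implicit Types Q B S : 'M[R]_n.

Definition dotv (u v : 'cV[R]_n) : R := \sum_i u i ord0 * v i ord0.

Definition psdmx S := S^T = S /\ forall x : 'cV[R]_n, 0 <= dotv (S *m x) x.

(* The positive semi-definite square root, unique for psdmx Q. *)
Definition sqrtmx Q : 'M[R]_n := get [set S | psdmx S /\ S *m S = Q].

Definition expmx B : 'M[R]_n :=
  limn (series (fun k => (k`!%:R : R)^-1 *: B ^+ k)).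

(* The juxtaposition [Q^{1/2}, B Q^{1/2}, ..., B^k Q^{1/2}]. *)
Definition kalmanmx Q B (k : nat) := \mxrow_(j < k.+1) (B ^+ j *m sqrtmx Q).

Definition covmx Q B (I : set R) : 'M[R]_n :=
  \matrix_(i, j) \int[lebesgue_measure]_(s in I)
    (expmx (s *: B) *m Q *m expmx (s *: B^T)) i j.

Definition Qt Q B (t : R) := covmx Q B `[0, t].

Definition Qoo Q B := covmx Q B `[0, +oo[.

Definition gauss_density S (x : 'cV[R]_n) : R :=
  ((2 * pi) `^ (n%:R / 2) * Num.sqrt (\det S))^-1 *
  expR (- (2^-1 * dotv (invmx S *m x) x)).

(* T(t) for t > 0; T(0) is the identity, so invariance is only required for
   t > 0. *)
Definition ou_semigroup Q B (t : R) (f : 'cV[R]_n -> R) (x : 'cV[R]_n) : R :=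
  \int[lebesgue_cV n]_y
    (gauss_density (Qt Q B t) y * f (expmx (t *: B) *m x - y)).

Definition invariant_measure Q B (mu : probability 'cV[R]_n R) :=
  forall (t : R) (f : 'cV[R]_n -> R), 0 < t ->
    continuous f -> (exists M, forall x, `|f x| <= M) ->
    \int[mu]_x ou_semigroup Q B t f x = \int[mu]_x f x.

Definition has_density (mu : probability 'cV[R]_n R) (rho : 'cV[R]_n -> R) :=
  forall A : set 'cV[R]_n, measurable A ->
    mu A = (\int[lebesgue_cV n]_(x in A) (rho x)%:E)%E.

End matrices.

Section operator.
Context {R : realType} {n : nat}.
Implicit Types (Q B S : 'M[R]_n) (f g : 'cV[R]_n -> R) (U : set 'cV[R]_n).

Definition partial (i : 'I_n) f : 'cV[R]_n -> R :=
  fun x => 'D_(delta_mx i ord0 : 'cV[R]_n) f x.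

Definition partials (s : seq 'I_n) f := foldr partial f s.

(* If all iterated partial derivatives are differentiable, they are continuous,
   so that f is C^oo on the open set U. *)
Definition smooth_on U f :=
  forall s x, U x -> differentiable (partials s f) x.

(* P = 1/2 Tr(Q D^2) + <Bx, D>. *)
Definition ou_op Q B f (x : 'cV[R]_n) : R :=
  2^-1 * (\sum_i \sum_j Q i j * partial i (partial j f) x)
  + \sum_i \sum_j B i j * x j ord0 * partial i f x.

(* The formal transpose of P for the Lebesgue measure, through which P acts on
   distributions: <Pu, f> = <u, tP f>. *)
Definition ou_transpose Q B f (x : 'cV[R]_n) : R :=
  2^-1 * (\sum_i \sum_j Q i j * partial i (partial j f) x)
  - \sum_i \sum_j B i j * partial i (fun y => y j ord0 * f y) x.

Definition smooth_supported (K : set 'cV[R]_n) f :=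
  smooth_on setT f /\ forall x, ~ K x -> f x = 0.

Definition test_function U f :=
  exists K, [/\ compact K, K `<=` U & smooth_supported K f].

(* Real distributions on U; P has real coefficients, so the complex ones give
   the same notion of hypoellipticity. *)
Definition distribution_on U (u : ('cV[R]_n -> R) -> R) :=
  (forall (a : R) f g, test_function U f -> test_function U g ->
     u (fun x => a * f x + g x) = a * u f + u g) /\
  (forall K, compact K -> K `<=` U -> exists C (N : nat),
     forall f (M : R), smooth_supported K f ->
       (forall s x, (size s <= N)%N -> `|partials s f x| <= M) ->
       `|u f| <= C * M).

Definition represents U g (u : ('cV[R]_n -> R) -> R) :=
  forall f, test_function U f -> u f = \int[lebesgue_cV n]_x (g x * f x).

Definition hypoelliptic Q B :=
  forall U (u : ('cV[R]_n -> R) -> R), open U -> distribution_on U u ->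
    (exists2 g, smooth_on U g & represents U g (u \o ou_transpose Q B)) ->
    exists2 g, smooth_on U g & represents U g u.

End operator.

Section function_spaces.
Context {R : realType} {n : nat}.
Implicit Types (Q B S : 'M[R]_n) (v w : 'cV[R]_n -> R[i]).
Implicit Type mu : probability 'cV[R]_n R.

Definition L2norm mu v : \bar R :=
  Lnorm mu 2%:E (fun x => (Normc.normc (v x))%:E).

Definition L2 mu v :=
  [/\ measurable_fun setT (fun x => complex.Re (v x)),
      measurable_fun setT (fun x => complex.Im (v x)) &
      (L2norm mu v < +oo)%E].

(* w = Pv in the sense of distributions, for complex-valued v and w; the domain
   of P is the set of the v in L2 mu such that w = Pv for some w in L2 mu. *)
Definition ou_weak Q B v w :=
  forall f, test_function setT f ->
    \int[lebesgue_cV n]_x (complex.Re (v x) * ou_transpose Q B f x) =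
    \int[lebesgue_cV n]_x (complex.Re (w x) * f x) /\
    \int[lebesgue_cV n]_x (complex.Im (v x) * ou_transpose Q B f x) =
    \int[lebesgue_cV n]_x (complex.Im (w x) * f x).

(* Probabilists' Hermite polynomials. *)
Fixpoint hermite_poly (k : nat) : {poly R} :=
  if k is k'.+1 then 'X * hermite_poly k' - (hermite_poly k')^`() else 1.

(* The selfadjoint operator A = 1/2 Tr(S D^2) - 1/2 <x, D>, with S = Qoo. *)
Definition hermite_op S := ou_op S (- 2^-1)%:M.

(* H_b(x) = prod_j He_{b_j}((S^{-1/2} x)_j) / sqrt(b_j!): for the centered
   Gaussian measure mu with covariance S, these form an orthonormal basis of
   L^2(mu), with A H_b = - |b|/2 H_b (hermite_opE). *)
Definition hermite S (b : {ffun 'I_n -> nat}) (x : 'cV[R]_n) : R :=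
  \prod_j ((hermite_poly (b j)).[(invmx (sqrtmx S) *m x) j ord0]
           / Num.sqrt (b j)`!%:R).

(* The norm of (1 - A)^{s/2} v, that is
   sqrt(sum_b (1 + |b|/2)^s |(v, H_b)|^2), which is +oo outside the domain; H_b
   is real-valued. *)
Definition sobolev_norm mu S (s : R) v : \bar R :=
  ((\esum_(b in [set: {ffun 'I_n -> nat}])
     ((1 + (\sum_j b j)%:R / 2) `^ s *
      ((\int[mu]_x (complex.Re (v x) * hermite S b x)) ^+ 2 +
       (\int[mu]_x (complex.Im (v x) * hermite S b x)) ^+ 2))%:E) `^ 2^-1)%E.

End function_spaces.

Section hermite_eigen.
Context {R : realType} {n : nat}.
Implicit Types (p : 'I_n -> {poly R}) (M S : 'M[R]_n) (x : 'cV[R]_n).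

Lemma hermite_polyS k :
  @hermite_poly R k.+1 = 'X * hermite_poly k - (hermite_poly k)^`().
Proof. by []. Qed.

Lemma deriv_hermite_poly k :
  (@hermite_poly R k.+1)^`() = hermite_poly k *+ k.+1.
Proof.
elim: k => [|k IHk]; first by rewrite /= mulr1 -polyC1 derivC subr0 derivX polyC1.
rewrite hermite_polyS derivB derivM derivX mul1r IHk derivMn.
by rewrite -addrA mulrnAr -mulrnBl -hermite_polyS -mulrS.
Qed.

Lemma hermite_poly_ode k :
  (@hermite_poly R k)^`()^`() - 'X * (hermite_poly k)^`() =
  - (hermite_poly k *+ k).
Proof.
case: k => [|k]; first by rewrite /= -polyC1 !derivC mulr0 subrr mulr0n oppr0.
by rewrite deriv_hermite_poly derivMn mulrnAr -mulrnBl -mulNrn opprB.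
Qed.

Lemma deriv_prod m (G : 'I_m -> {poly R}) :
  (\prod_j G j)^`() = \sum_k \prod_j (if j == k then (G j)^`() else G j).
Proof.
elim: m G => [|m IHm] G; first by rewrite !big_ord0 -polyC1 derivC.
rewrite !big_ord_recl derivM IHm big_distrr/=; congr (_ + _).
apply: eq_bigr => k _; rewrite big_ord_recl/=; congr (_ * _).
Qed.

Definition prodpoly M p x : R := \prod_j (p j).[(M *m x) j ord0].

Definition dprod p k : 'I_n -> {poly R} :=
  fun j => if j == k then (p j)^`() else p j.

Lemma prodpoly_line M p x i :
  let G := \prod_j (p j \Po (((M *m x) j ord0)%:P + (M j i) *: 'X)) in
  forall h : R, prodpoly M p (h *: (delta_mx i ord0) + x) = G.[h].
Proof.
move=> G h; rewrite /G horner_prod; apply: eq_bigr => j _.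
rewrite horner_comp !hornerE mulmxDr -scalemxAr -colE !mxE addrC mulrC.
by [].
Qed.

Lemma prodpoly_derive M p x i :
  derivable (prodpoly M p) x (delta_mx i ord0) /\
  partial i (prodpoly M p) x = \sum_k M k i * prodpoly M (dprod p k) x.
Proof.
pose G := \prod_j (p j \Po (((M *m x) j ord0)%:P + (M j i) *: 'X)).
have E : (fun h : R => h^-1 *: ((prodpoly M p \o shift x)
    (h *: delta_mx i ord0) - prodpoly M p x)) =
  (fun h : R => h^-1 *: ((horner G \o shift 0) (h *: 1) - horner G 0)).
  apply/funext => h /=; rewrite /shift/= addr0 -[h *: 1]/(h * 1) mulr1.
  by rewrite -!prodpoly_line scale0r add0r.
split.
  rewrite /derivable E; exact: derivable_horner.
rewrite /partial /derive E -[LHS]/('D_1 (horner G) 0) -derive1E -derive.derivE.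
rewrite /G deriv_prod horner_sum; apply: eq_bigr => k _.
rewrite horner_prod (bigD1 k)//= eqxx /prodpoly [in RHS](bigD1 k)//= /dprod eqxx.
rewrite deriv_comp derivD derivC derivZ derivX add0r !hornerE horner_comp !hornerE.
rewrite /= mulr1 [X in X * _ = _]mulrC; congr (_ * _).
by apply: eq_bigr => j /negbTE jk; rewrite jk horner_comp !hornerE.
Qed.

Lemma partial_prodpoly M p i : partial i (prodpoly M p) =
  \sum_k M k i \*: prodpoly M (dprod p k).
Proof.
apply/funext => x; rewrite (prodpoly_derive M p x i).2 fct_sumE.
by apply: eq_bigr.
Qed.

Lemma partial2_prodpoly M p i j x : partial i (partial j (prodpoly M p)) x =
  \sum_k \sum_l M k j * M l i * prodpoly M (dprod (dprod p k) l) x.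
Proof.
rewrite partial_prodpoly /partial derive_sum; last first.
  by move=> k; apply: derivableZ; exact: (prodpoly_derive _ _ _ _).1.
apply: eq_bigr => k _; rewrite deriveZ; last exact: (prodpoly_derive _ _ _ _).1.
rewrite -/(partial i _ x) (prodpoly_derive _ _ _ _).2 scaler_sumr.
by apply: eq_bigr => l _; rewrite -mulrA.
Qed.

Lemma ou_op_prodpoly M S p x : M *m S *m M^T = 1%:M ->
  ou_op S (- 2^-1)%:M (prodpoly M p) x =
  2^-1 * \sum_k (prodpoly M (dprod (dprod p k) k) x
                 - (M *m x) k ord0 * prodpoly M (dprod p k) x).
Proof.
move=> MSM; rewrite /ou_op sumrB mulrBr; congr (_ + _).
  congr (_ * _).
  under eq_bigr => i _ do under eq_bigr => j _ do rewrite partial2_prodpoly.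
  have E k l : \sum_i \sum_j S i j * (M k j * M l i) = (l == k)%:R.
    have := congr1 (fun A : 'M[R]_n => A l k) MSM; rewrite !mxE => <-.
    rewrite exchange_big/=; apply: eq_bigr => j _; rewrite !mxE big_distrl/=.
    by apply: eq_bigr => i _; ring.
  transitivity (\sum_k \sum_l (\sum_i \sum_j S i j * (M k j * M l i)) *
      prodpoly M (dprod (dprod p k) l) x).
    under eq_bigr => i _ do under eq_bigr => j _ do rewrite big_distrr/=.
    under eq_bigr => i _ do rewrite exchange_big/=.
    rewrite exchange_big/=; apply: eq_bigr => k _.
    under eq_bigr => i _ do under eq_bigr => j _ do rewrite big_distrr/=.
    under eq_bigr => i _ do rewrite exchange_big/=.
    rewrite exchange_big/=; apply: eq_bigr => l _.
    rewrite big_distrl/=; apply: eq_bigr => i _.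
    rewrite big_distrl/=; apply: eq_bigr => j _.
    by rewrite !mulrA.
  apply: eq_bigr => k _; rewrite (bigD1 k)//= E eqxx mul1r big1 ?addr0//.
  by move=> l /negbTE lk; rewrite E lk mul0r.
transitivity (\sum_i - 2^-1 * x i ord0 * partial i (prodpoly M p) x).
  apply: eq_bigr => i _; rewrite (bigD1 i)//= mxE eqxx mulr1n big1 ?addr0//.
  by move=> j /negbTE ji; rewrite mxE eq_sym ji mulr0n !mul0r.
under eq_bigr => i _ do rewrite (prodpoly_derive _ _ _ _).2 big_distrr/=.
rewrite exchange_big/= -mulrN -sumrN big_distrr/=; apply: eq_bigr => k _.
rewrite mxE big_distrl/= -sumrN big_distrr/=; apply: eq_bigr => i _; ring.
Qed.

Lemma hermite_opE S b x : sqrtmx S \in unitmx ->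
  (sqrtmx S)^T = sqrtmx S -> sqrtmx S *m sqrtmx S = S ->
  hermite_op S (hermite S b) x = - ((\sum_j b j)%:R / 2) * hermite S b x.
Proof.
move=> Su St SS.
pose p (j : 'I_n) : {poly R} := (Num.sqrt ((b j)`!)%:R)^-1 *: hermite_poly (b j).
have -> : hermite S b = prodpoly (invmx (sqrtmx S)) p.
  apply/funext => y; apply: eq_bigr => j _.
  by rewrite /p hornerZ mulrC.
rewrite /hermite_op ou_op_prodpoly; last first.
  by rewrite trmx_inv St -[X in _ *m X *m _]SS mulmxA mulVmx// mul1mx mulmxV.
have E k : prodpoly (invmx (sqrtmx S)) (dprod (dprod p k) k) x -
    (invmx (sqrtmx S) *m x) k ord0 * prodpoly (invmx (sqrtmx S)) (dprod p k) x =
    - (b k)%:R * prodpoly (invmx (sqrtmx S)) p x.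
  set M := invmx _; set y := (M *m x) k ord0.
  have PD q : prodpoly M q x =
      (q k).[y] * \prod_(j < n | j != k) (q j).[(M *m x) j ord0].
    by rewrite /prodpoly (bigD1 k).
  rewrite !PD /dprod !eqxx.
  have H : ((p k)^`()^`()).[y] - y * ((p k)^`()).[y] = - (b k)%:R * (p k).[y].
    have := congr1 (fun q => (Num.sqrt ((b k)`!)%:R)^-1 * q.[y])
      (hermite_poly_ode (b k)).
    rewrite /p !derivZ !hornerZ hornerD !hornerN hornerM hornerX hornerMn.
    rewrite -mulr_natr => H.
    rewrite mulrCA -mulrBr H; ring.
  under eq_bigr => j /negbTE jk do rewrite !jk.
  under [in X in _ - _ * X]eq_bigr => j /negbTE jk do rewrite !jk.
  by rewrite !mulrA -mulrBl H.
rewrite (eq_bigr _ (fun k _ => E k)) -big_distrl/= sumrN natr_sum.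
by ring.
Qed.
End hermite_eigen.

(* Main.v *)
(* Let S = Qoo, which solves the Lyapunov equation B S + S B^T = -Q. In the
   coordinates y = S^{-1/2} x the measure mu is the standard Gaussian, and on the
   coefficients of v in the Hermite basis, grouped by degree m into symmetric
   tensors, P acts as the derivation extending A = (S^{-1/2} B S^{1/2})^T, where
   A + A^T = - K^T K with K = Q^{1/2} S^{-1/2}. The Kalman condition gives
   |e^{tA}|^2 <= 1 - c t^{2 k0 + 1} for small t > 0, so that e^{tA} tensored m
   times has norm at most (1 - c t^{2 k0 + 1})^{m/2}; by Duhamel's formula,
   (1 - (1 - c t^{2 k0 + 1})^{m/2}) |u| <= t |Pu| in degree m. For t of order
   m^{-1/(2 k0 + 1)} this reads m^{1/(2 k0 + 1)} |u| <= C |Pu|, and it remains to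
   sum over m. Testing the weak equation against rho times a Hermite polynomial
   times a cutoff identifies the coefficients of Pv, and only Bessel's inequality,
   not the completeness of the Hermite basis, is used. *)
Require Import Defs.
From mathcomp Require Import all_boot all_order all_algebra.
From mathcomp Require Import all_classical all_reals all_analysis.
From mathcomp Require Import measurable_realfun complex ring lra.

Set Implicit Arguments.
Unset Strict Implicit.
Unset Printing Implicit Defensive.

Import Order.TTheory GRing.Theory Num.Theory.
Import numFieldNormedType.Exports.

Local Open Scope classical_set_scope.
Local Open Scope ring_scope.

(** * Positive (semi-)definite matrices and their square roots *)

Section psd_matrices.
Context {R : realType} {n : nat}.
Implicit Types (Q S : 'M[R]_n) (x y : 'cV[R]_n).

(** [Qoo] and [gauss_density] are total functions: a divergent integral or an inverse of 0 yields 0,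
    so neither convergence nor positivity of S can be taken for granted. They are drawn from
    [mu_density]: total mass 1 makes S invertible, mass at most 1 on cubes makes it positive
    definite, its positive diagonal makes the defining integrals converge, and convergence gives the
    Lyapunov equation. The exponent 2 k0 + 1 is the order at 0 of the primitive of |K e^{sA} x|^2
    when the Taylor coefficients of index below k0 vanish. Uniformity in x comes from rescaling
    [0, t] to [0, 1], where the bound is positive definiteness of the Hilbert matrix. Tensors are
    indexed by words so that a tensor power of e^{tA} can be treated one letter at a time; returning
    to multi-indices costs the number m! / b! of words with letter counts b, and the b! is the
    normalization of the Hermite polynomials. Since Pv is only a distributional derivative, all
    differentiations fall on the test function; v and Pv are merely integrated against functions of
    polynomial growth times the density. *)

Lemma dotvE x y : dotv x y = (x^T *m y) ord0 ord0.
Proof. by rewrite mxE; apply: eq_bigr => i _; rewrite mxE. Qed.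

Lemma dotvC x y : dotv x y = dotv y x.
Proof. by apply: eq_bigr => i _; rewrite mulrC. Qed.

Lemma dotvDl x y z : dotv (x + y) z = dotv x z + dotv y z.
Proof. by rewrite !dotvE linearD mulmxDl mxE. Qed.

Lemma dotvDr x y z : dotv x (y + z) = dotv x y + dotv x z.
Proof. by rewrite dotvC dotvDl !(dotvC x). Qed.

Lemma dotvZl a x y : dotv (a *: x) y = a * dotv x y.
Proof. by rewrite !dotvE linearZ -scalemxAl mxE. Qed.

Lemma dotvZr a x y : dotv x (a *: y) = a * dotv x y.
Proof. by rewrite dotvC dotvZl dotvC. Qed.

Lemma dotvNl x y : dotv (- x) y = - dotv x y.
Proof. by rewrite -scaleN1r dotvZl mulN1r. Qed.

Lemma dotvNr x y : dotv x (- y) = - dotv x y.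
Proof. by rewrite dotvC dotvNl dotvC. Qed.

Lemma dotv0l y : dotv 0 y = 0.
Proof. by rewrite dotvE trmx0 mul0mx mxE. Qed.

Lemma dotv_trmx S x y : dotv (S *m x) y = dotv x (S^T *m y).
Proof. by rewrite !dotvE trmx_mul mulmxA. Qed.

Lemma dotvv_ge0 x : 0 <= dotv x x.
Proof. by apply: sumr_ge0 => i _; rewrite -expr2 sqr_ge0. Qed.

Lemma dotvv_eq0 x : (dotv x x == 0) = (x == 0).
Proof.
apply/idP/idP => [|/eqP->]; last by rewrite dotv0l.
rewrite psumr_eq0; last by move=> i _; rewrite -expr2 sqr_ge0.
move=> /allP H; apply/eqP/colP => i; rewrite mxE; apply/eqP.
by have := H i (mem_index_enum _); rewrite -expr2 sqrf_eq0.
Qed.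

Lemma dotvv_gt0 x : x != 0 -> 0 < dotv x x.
Proof. by rewrite lt0r dotvv_eq0 dotvv_ge0 andbT. Qed.

Lemma coord_sqr_le x i : x i ord0 ^+ 2 <= dotv x x.
Proof.
rewrite /dotv (bigD1 i)//= -expr2 lerDl.
by apply: sumr_ge0 => j _; rewrite -expr2 sqr_ge0.
Qed.

Lemma mulmx_real_complex m p q (A : 'M[R]_(m, p)) (B : 'M[R]_(p, q)) :
  map_mx (real_complex R) (A *m B) =
  map_mx (real_complex R) A *m map_mx (real_complex R) B.
Proof. exact: map_mxM. Qed.

(* A complex eigenvector has a real or imaginary part that is a real
   eigenvector, so positivity of the form on real vectors suffices. *)
Lemma psd_diagonalizable Q : psdmx Q -> exists (V : 'M[R]_n) (d : 'rV[R]_n),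
  [/\ V \in unitmx, V *m Q = diag_mx d *m V & forall i, 0 <= d ord0 i].
Proof.
move=> [Qsym Qpos].
pose QC := map_mx (real_complex R) Q.
have QCreal : QC \is a (mxOver Num.real).
  by apply/mxOverP => i j; rewrite mxE complex_real.
have QCherm : QC \is hermsymmx.
  apply: realsym_hermsym => //; apply/is_hermitianmxP.
  by rewrite expr0 scale1r map_mx_id// /QC map_trmx Qsym.
have /orthomx_spectralP/= Qdiag := hermitian_normalmx QCherm.
have dreal := hermitian_spectral_diag_real QCherm.
set P := spectralmx QC in Qdiag; set dC := spectral_diag QC in Qdiag dreal.
pose d : 'rV[R]_n := \row_i complex.Re (dC ord0 i).
have dE : dC = map_mx (real_complex R) d.
  apply/rowP => i; rewrite !mxE RRe_real//; exact: (mxOverP dreal).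
have Punit : P \in unitmx := spectral_unit _.
have PQ : P *m QC = diag_mx dC *m P by rewrite {1}Qdiag !mulmxA mulmxV// mul1mx.
have sim : similar_in unitmx QC (diag_mx dC).
  by exists P => //; apply/similarP.
have Dreal : diag_mx dC \is a (mxOver Num.real).
  by rewrite dE -map_diag_mx; apply/mxOverP => i j; rewrite mxE complex_real.
have [W /andP[/= Wreal Wunit]] := real_similar sim QCreal Dreal.
move=> /(similarP Wunit) WQ.
pose V : 'M[R]_n := map_mx (@complex.Re R) W.
have WE : W = map_mx (real_complex R) V.
  apply/matrixP => i j; rewrite !mxE RRe_real//; exact: (mxOverP Wreal).
have Vunit : V \in unitmx by rewrite -(map_unitmx (real_complex R)) -WE.
have VQ : V *m Q = diag_mx d *m V.
  apply: (@map_mx_inj _ _ (real_complex R)).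
  by rewrite !mulmx_real_complex map_diag_mx -WE -dE.
exists V, d; split => // i.
pose x := (row i V)^T.
have Qx : Q *m x = d ord0 i *: x.
  rewrite -{1}Qsym /x -trmx_mul -row_mul VQ row_mul -linearZ/=; congr (_^T).
  rewrite row_diag_mx -scalemxAl; congr (_ *: _).
  by apply/rowP => j; rewrite -rowE.
have x0 : x != 0.
  apply: contraTneq Vunit => x0; rewrite -row_free_unit; apply/negP => Vf.
  have : row i V = 0 by rewrite -[row i V]trmxK -/x x0 trmx0.
  rewrite rowE -[RHS](mul0mx _ V) => /(row_free_inj Vf)/rowP/(_ i).
  by rewrite !mxE !eqxx => /eqP; rewrite oner_eq0.
have := Qpos x; rewrite Qx dotvZl pmulr_lge0//; exact: dotvv_gt0.
Qed.

(* The root V^-1 D^{1/2} V is symmetric since V V^T commutes with D, hence with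
   D^{1/2}. *)
Lemma psd_symmetric_power Q (V : 'M[R]_n) d (f : R -> R) : Q^T = Q ->
  V \in unitmx -> V *m Q = diag_mx d *m V ->
  (invmx V *m diag_mx (map_mx f d) *m V)^T = invmx V *m diag_mx (map_mx f d) *m V.
Proof.
move=> Qsym Vu VQ.
pose G := V *m V^T.
have GD : G *m diag_mx d = diag_mx d *m G.
  apply: trmx_inj; rewrite !trmx_mul !tr_diag_mx trmxK.
  rewrite /G mulmxA -VQ -!mulmxA; congr (V *m _).
  by rewrite -[V^T *m diag_mx d]trmxK trmx_mul tr_diag_mx trmxK -VQ trmx_mul Qsym.
have GfD : G *m diag_mx (map_mx f d) = diag_mx (map_mx f d) *m G.
  apply/matrixP => i j; have := congr1 (fun A : 'M[R]_n => A i j) GD.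
  rewrite !mul_mx_diag !mul_diag_mx => GDij.
  have {}GDij : G i j * d ord0 j = d ord0 i * G i j.
    by move: GDij; rewrite [LHS]mxE [RHS]mxE.
  rewrite [LHS]mxE [RHS]mxE ![(map_mx _ _) _ _]mxE.
  move/eqP: GDij; rewrite [X in _ == X]mulrC [RHS]mulrC.
  rewrite -subr_eq0 -mulrBr mulf_eq0 => /orP[/eqP GE|].
    by rewrite GE !mul0r.
  by rewrite subr_eq0 => /eqP->.
rewrite !trmx_mul tr_diag_mx -{1}[V^T](mulKmx Vu) -/G -!mulmxA; congr (_ *m _).
by rewrite (mulmxA V) -/G (mulmxA G) GfD -mulmxA /G -(mulmxA V) -trmx_mul mulVmx// trmx1 mulmx1.
Qed.

Lemma sym_square_psd S : S^T = S -> psdmx (S *m S).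
Proof.
move=> Ss; split; first by rewrite trmx_mul Ss.
by move=> x; rewrite -mulmxA dotv_trmx Ss dotvv_ge0.
Qed.

Lemma psd_sqrt_exists Q : psdmx Q -> exists S, psdmx S /\ S *m S = Q.
Proof.
move=> Qpsd; have [V [d [Vu VQ d0]]] := psd_diagonalizable Qpsd.
have Qsym := Qpsd.1.
pose s f := invmx V *m diag_mx (map_mx f d) *m V.
have sM f g : s f *m s g = s (fun a => f a * g a).
  rewrite /s -!mulmxA (mulmxA V) mulmxV// mul1mx (mulmxA (diag_mx _)).
  congr (_ *m (_ *m _)); rewrite mulmx_diag; congr diag_mx.
  by apply/rowP => i; rewrite !mxE.
exists (s Num.sqrt); split.
  (* The root is positive because it is the square of the symmetric fourth root. *)
  have -> : s Num.sqrt = s (fun a => Num.sqrt (Num.sqrt a)) *m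
      s (fun a => Num.sqrt (Num.sqrt a)).
    rewrite sM; congr (_ *m diag_mx _ *m _); apply/rowP => i.
    by rewrite !mxE -expr2 sqr_sqrtr// sqrtr_ge0.
  exact/sym_square_psd/(psd_symmetric_power _ Qsym Vu VQ).
rewrite sM /s (_ : map_mx _ d = d) -?mulmxA -?VQ ?mulKmx//.
by apply/rowP => i; rewrite !mxE -expr2 sqr_sqrtr.
Qed.

(** [sqrtmx] is a choice, so its properties hold once the set chosen from is inhabited. *)
Lemma sqrtmxP Q : psdmx Q ->
  [/\ (sqrtmx Q)^T = sqrtmx Q & sqrtmx Q *m sqrtmx Q = Q].
Proof.
move=> /psd_sqrt_exists[S0 S0P].
have : [set S | psdmx S /\ S *m S = Q] (sqrtmx Q) by apply: getI; exact: S0P.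
by move=> [[]].
Qed.

Definition pdmx Q := Q^T = Q /\ forall x, x != 0 -> 0 < dotv (Q *m x) x.

Lemma pd_psd Q : pdmx Q -> psdmx Q.
Proof.
move=> [Qs Qp]; split => // x; have [->|/Qp/ltW//] := eqVneq x 0.
by rewrite mulmx0 dotv0l.
Qed.

Lemma pd_unit Q : pdmx Q -> Q \in unitmx.
Proof.
move=> [Qs Qp]; rewrite -row_free_unit -kermx_eq0; apply: contraT => /rowV0Pn[v].
rewrite sub_kermx => /eqP vQ v0.
have vT0 : v^T != 0 by rewrite -trmx0 (inj_eq trmx_inj).
by have := Qp _ vT0; rewrite -Qs -trmx_mul vQ trmx0 dotv0l ltxx.
Qed.

Lemma dotv_CauchySchwarz x y : dotv x y ^+ 2 <= dotv x x * dotv y y.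
Proof.
have [->|y0] := eqVneq y 0; first by rewrite dotvC !dotv0l expr0n mulr0.
have yy := dotvv_gt0 y0.
have := dotvv_ge0 (dotv y y *: x - dotv x y *: y).
rewrite !(dotvDl, dotvDr, dotvNl, dotvNr, dotvZl, dotvZr) (dotvC y x) => H.
rewrite -(ler_pM2l yy) -subr_ge0; by congr (0 <= _) : H; ring.
Qed.

Lemma psd_CauchySchwarz Q x y : psdmx Q ->
  dotv (Q *m x) y ^+ 2 <= dotv (Q *m x) x * dotv (Q *m y) y.
Proof.
move=> /sqrtmxP[Ss SS].
have E u v : dotv (Q *m u) v = dotv (sqrtmx Q *m u) (sqrtmx Q *m v).
  by rewrite -{1}SS -mulmxA dotv_trmx Ss.
rewrite !E; exact: dotv_CauchySchwarz.
Qed.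

Lemma mx_dotv_bound S : exists2 c : R, 0 < c &
  forall x, dotv (S *m x) (S *m x) <= c * dotv x x.
Proof.
(* The squared Frobenius norm, plus 1 to stay positive when S = 0. *)
exists (1 + \sum_i \sum_j S i j ^+ 2).
  rewrite ltr_pwDl//; apply: sumr_ge0 => i _; apply: sumr_ge0 => j _.
  exact: sqr_ge0.
move=> x; apply: (@le_trans _ _ ((\sum_i \sum_j S i j ^+ 2) * dotv x x)).
  rewrite /dotv mulr_suml; apply: ler_sum => i _; rewrite -expr2.
  have := dotv_CauchySchwarz (row i S)^T x.
  have -> : dotv (row i S)^T x = (S *m x) i ord0.
    by rewrite mxE; apply: eq_bigr => j _; rewrite !mxE.
  rewrite {1}/dotv; under [X in X * _]eq_bigr => j _ do rewrite !mxE -expr2.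
  exact.
by rewrite ler_wpM2r ?dotvv_ge0// lerDr.
Qed.

(** Without compactness: x is the image under [invmx (sqrtmx Q)] of a vector whose squared length is
    the form at x, so a bound on this inverse gives c. *)
Lemma pd_coercive Q : pdmx Q ->
  exists2 c : R, 0 < c & forall x, c * dotv x x <= dotv (Q *m x) x.
Proof.
move=> Qpd; have Qu := pd_unit Qpd; have [Qs Qp] := Qpd.
have [c c0 cP] := mx_dotv_bound (invmx (sqrtmx Q)).
have [Ss SS] := sqrtmxP (pd_psd Qpd).
have Su : sqrtmx Q \in unitmx.
  by move: Qu; rewrite -{1}SS unitmx_mul => /andP[].
exists c^-1; first by rewrite invr_gt0.
move=> x; rewrite mulrC ler_pdivrMr// mulrC.
have := cP (sqrtmx Q *m x); rewrite mulKmx// => H; apply: le_trans H _.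
by rewrite ler_pM2l// -[X in _ <= dotv (X *m _) _]SS -mulmxA [leRHS]dotv_trmx Ss.
Qed.

End psd_matrices.

(** * The matrix exponential, entry by entry *)

Section matrix_exponential.
Context {R : realType} {n : nat}.
Implicit Types (A B : 'M[R]_n) (t : R).

Lemma cvg_mx m p (f : nat -> 'M[R]_(m, p)) (L : 'M[R]_(m, p)) :
  (forall i j, f k i j @[k --> \oo] --> L i j) -> f @ \oo --> L.
Proof.
move=> fL W [P LP sPW].
have : \forall k \near \oo, forall ij : 'I_m * 'I_p, P ij.1 ij.2 (f k ij.1 ij.2).
  by apply: filter_forall => ij; apply: fL; exact: LP.
by apply: filterS => k Pk; apply: sPW => i j; exact: (Pk (i, j)).
Qed.

(** Each entry of e^{tA} is a scalar power series in t with these coefficients, which gives access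
    to termwise differentiation of real power series. *)
Definition expmx_coef A i j (k : nat) : R := (A ^+ k) i j / k`!%:R.

Lemma expmx_power_le A k i j : `|(A ^+ k) i j| <= (\sum_i \sum_j `|A i j|) ^+ k.
Proof.
elim: k i j => [|k IHk] i j.
  by rewrite !expr0 !mxE; case: eqVneq; rewrite ?normr1// normr0 ler01.
rewrite exprS [_ * _]/(A *m _) mxE; apply: le_trans (ler_norm_sum _ _ _) _.
rewrite exprS; apply: (@le_trans _ _
  ((\sum_j `|A i j|) * (\sum_i \sum_j `|A i j|) ^+ k)).
  rewrite mulr_suml; apply: ler_sum => l _; rewrite normrM.
  by rewrite ler_wpM2l.
rewrite ler_wpM2r//.
  by rewrite exprn_ge0// sumr_ge0// => ? _; rewrite sumr_ge0.
by rewrite [leRHS](bigD1 i)//= lerDl sumr_ge0// => ? _; rewrite sumr_ge0.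
Qed.

Lemma cvg_expmx_pseries A i j t : cvgn (pseries (expmx_coef A i j) t).
Proof.
set a := \sum_i \sum_j `|A i j|.
have a0 : 0 <= a by rewrite sumr_ge0// => ? _; rewrite sumr_ge0.
apply: normed_cvg; rewrite /pseries.
apply: (series_le_cvg _ _ _ (is_cvg_series_exp_coeff (a * `|t|))) => k.
- exact: normr_ge0.
- by rewrite exp_coeff_ge0// mulr_ge0.
rewrite /= /exp_coeff/= exprMn normrM normrX normrM mulrAC [`|_^-1|]ger0_norm//.
rewrite ler_wpM2r ?invr_ge0// ler_wpM2r ?exprn_ge0//.
exact: expmx_power_le.
Qed.

Lemma pseries_diffs_expmx A i j :
  pseries_diffs (expmx_coef A i j) =
  (fun k => \sum_l A i l * expmx_coef A l j k).
Proof.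
apply/funext => k; rewrite /pseries_diffs /expmx_coef exprS [_ * _ ^+ _]/(A *m _).
rewrite mxE factS natrM invfM mulrCA [X in _ * X]mulrA mulfV ?pnatr_eq0// mul1r.
by rewrite mulr_suml; apply: eq_bigr => l _; rewrite mulrA.
Qed.

Lemma pseries_sum (c : 'I_n -> nat -> R) (a : 'I_n -> R) t :
  pseries (fun k => \sum_l a l * c l k) t = fun N => \sum_l a l * pseries (c l) t N.
Proof.
apply/funext => N; rewrite /pseries /series/=.
under eq_bigr do rewrite mulr_suml.
rewrite exchange_big; apply: eq_bigr => l _; rewrite mulr_sumr.
by apply: eq_bigr => k _; rewrite mulrA.
Qed.

Lemma cvg_pseries_sum (c : 'I_n -> nat -> R) (a : 'I_n -> R) t :
  (forall l, cvgn (pseries (c l) t)) ->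
  pseries (fun k => \sum_l a l * c l k) t @ \oo -->
  \sum_l a l * limn (pseries (c l) t).
Proof.
move=> cc; rewrite pseries_sum.
apply: cvg_big => [|l _]; first exact: add_continuous.
by apply: cvgMl_tmp; exact: cc.
Qed.

Lemma expmxE A t i j : expmx (t *: A) i j = limn (pseries (expmx_coef A i j) t).
Proof.
suff -> : expmx (t *: A) = \matrix_(i, j) limn (pseries (expmx_coef A i j) t).
  by rewrite mxE.
apply: cvg_lim; first exact: norm_hausdorff.
apply: cvg_mx => {}i {}j; rewrite mxE.
have -> : (fun k => series (fun k => (k`!%:R : R)^-1 *: (t *: A) ^+ k) k i j) =
    pseries (expmx_coef A i j) t.
  apply/funext => N; rewrite /pseries /series/= summxE; apply: eq_bigr => k _.
  rewrite mxE /expmx_coef.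
  have -> : (t *: A) ^+ k = t ^+ k *: A ^+ k.
    elim: k => [|k IHk]; first by rewrite !expr0 scale1r.
    transitivity ((t *: A) *m (t *: A) ^+ k); first exact: exprS.
    rewrite IHk -scalemxAl -scalemxAr scalerA -exprS; congr (_ *: _).
    by rewrite [in RHS]exprS.
  by rewrite mxE; ring.
exact: cvg_expmx_pseries.
Qed.

Lemma is_derive_expmx A t i j :
  is_derive t (1 : R) (fun s => expmx (s *: A) i j) ((A *m expmx (t *: A)) i j).
Proof.
have -> : (fun s => expmx (s *: A) i j) =
    (fun s => limn (pseries (expmx_coef A i j) s)).
  by apply/funext => s; exact: expmxE.
have -> : (A *m expmx (t *: A)) i j =
    limn (pseries (pseries_diffs (expmx_coef A i j)) t).
  rewrite pseries_diffs_expmx; apply/esym/cvg_lim => //.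
  rewrite mxE; under eq_bigr do rewrite expmxE.
  by apply: cvg_pseries_sum => l; exact: cvg_expmx_pseries.
(* Termwise differentiation at t asks for convergence of the series and of its first two formal
   derivatives at a point beyond |t|. *)
apply: (@pseries_snd_diffs _ _ (`|t| + 1)).
- exact: cvg_expmx_pseries.
- rewrite pseries_diffs_expmx; apply/cvg_ex; eexists.
  by apply: cvg_pseries_sum => l; exact: cvg_expmx_pseries.
- rewrite pseries_diffs_expmx.
  have -> : pseries_diffs (fun k => \sum_l A i l * expmx_coef A l j k) =
      (fun k => \sum_l A i l * pseries_diffs (expmx_coef A l j) k).
    apply/funext => k; rewrite /pseries_diffs mulr_sumr.
    by apply: eq_bigr => l _; ring.
  apply/cvg_ex; eexists; apply: cvg_pseries_sum => l.
  rewrite pseries_diffs_expmx; apply/cvg_ex; eexists.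
  by apply: cvg_pseries_sum => l'; exact: cvg_expmx_pseries.
by rewrite [ltRHS]ger0_norm// addrC -subr_gt0 addrK.
Qed.

Lemma expmx_tr A : expmx A^T = (expmx A)^T.
Proof.
apply/matrixP => i j; rewrite mxE -[A^T]scale1r -[in RHS](scale1r A) !expmxE.
congr (limn (pseries _ _)); apply/funext => k; rewrite /expmx_coef; congr (_ / _).
have -> : A^T ^+ k = (A ^+ k)^T; last by rewrite mxE.
elim: k => [|k IHk]; first by rewrite !expr0; exact/esym/trmx1.
by rewrite exprS IHk exprSr ![_ * _]/(_ *m _) trmx_mul.
Qed.

Lemma expmx_comm A t : A *m expmx (t *: A) = expmx (t *: A) *m A.
Proof.
apply/matrixP => i j; rewrite !mxE.
under eq_bigr do rewrite expmxE; under [in RHS]eq_bigr do rewrite expmxE mulrC.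
have H1 := @cvg_pseries_sum (fun l => expmx_coef A l j) (A i) t.
have H2 := @cvg_pseries_sum (fun l => expmx_coef A i l) (A^~ j) t.
rewrite -(cvg_lim _ (H1 _))//; last by move=> l; exact: cvg_expmx_pseries.
rewrite -(cvg_lim _ (H2 _))//; last by move=> l; exact: cvg_expmx_pseries.
congr (limn (pseries _ _)); apply/funext => k.
transitivity ((A ^+ k.+1) i j / k`!%:R).
  rewrite exprS [_ * _ ^+ _]/(A *m _) mxE mulr_suml.
  by apply: eq_bigr => l _; rewrite mulrA.
rewrite exprSr [_ ^+ _ * _]/(_ *m A) mxE mulr_suml.
by apply: eq_bigr => l _; rewrite /expmx_coef; ring.
Qed.

Lemma expmx0 : expmx (0 : 'M[R]_n) = 1%:M.
Proof.
apply/matrixP => i j; rewrite -(scale0r 0) expmxE.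
(* The partial sum of index 0 is empty; from index 1 on the sequence is constant. *)
apply: cvg_lim => //; rewrite -(cvg_shiftn 1); apply: cvg_near_cst.
apply: nearW => N; rewrite /pseries /series/= addn1 big_nat_recl//= big1 ?addr0.
  by rewrite /expmx_coef !expr0 mulr1 fact0 divr1.
by move=> k _; rewrite expr0n mulr0.
Qed.

End matrix_exponential.

(** * Derivatives of functions of one real variable *)

Section real_derivatives.
Context {R : realType}.
Implicit Types (f g : R -> R) (t : R).

Lemma is_derive_sumf n (f df : 'I_n -> R -> R) t :
  (forall i, is_derive t (1 : R) (f i) (df i t)) ->
  is_derive t (1 : R) (fun s => \sum_i f i s) (\sum_i df i t).
Proof.
move=> fdf; have := @is_derive_sum _ _ _ n f t 1 (df^~ t) fdf.
by congr is_derive; apply/funext => s; rewrite fct_sumE.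
Qed.

Lemma is_derive_mulf f g df dg t :
  is_derive t (1 : R) f df -> is_derive t (1 : R) g dg ->
  is_derive t (1 : R) (fun s => f s * g s) (df * g t + f t * dg).
Proof.
move=> fdf gdg; apply: is_derive_eq (is_deriveM fdf gdg) _.
by rewrite addrC; congr (_ + _); rewrite mulrC.
Qed.

Lemma is_derive_scalef f df (a : R) t :
  is_derive t (1 : R) f df -> is_derive t (1 : R) (fun s => a * f s) (a * df).
Proof. by move=> fdf; exact: is_deriveZ. Qed.

Lemma is_derive_expn k t :
  is_derive t (1 : R) (fun s => s ^+ k) (k%:R * t ^+ k.-1).
Proof.
have := is_derive_poly ('X^k : {poly R}) t.
rewrite derivXn hornerMn hornerXn mulr_natl; congr is_derive.
by apply/funext => s; rewrite hornerXn.
Qed.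

Lemma is_derive_cont f df t : is_derive t (1 : R) f df -> {for t, continuous f}.
Proof. by move=> [fd _]; exact/differentiable_continuous/derivable1_diffP. Qed.

(** Takes the place of integration over [0, t] in the energy, Taylor and Duhamel estimates. *)
Lemma MVT_from0 f (df : R -> R) t :
  0 <= t -> (forall x, is_derive x (1 : R) f (df x)) ->
  exists2 c, 0 <= c <= t & f t - f 0 = df c * t.
Proof.
move=> t0 fdf.
have [|c] := @MVT_segment R f df 0 t t0 (fun x _ => fdf x).
  by apply: continuous_subspaceT => x; exact: is_derive_cont (fdf x).
by rewrite in_itv/= subr0 => ct ->; exists c.
Qed.

Lemma derive_ge0_le f (df : R -> R) t :
  0 <= t -> (forall x, is_derive x (1 : R) f (df x)) ->
  (forall x, 0 <= x <= t -> 0 <= df x) -> f 0 <= f t.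
Proof.
move=> t0 fdf dfge0; have [c ct E] := MVT_from0 t0 fdf.
by rewrite -subr_ge0 E mulr_ge0// dfge0.
Qed.

End real_derivatives.

(** * The Hilbert matrix; energy and Taylor expansion along the flow *)

Section contraction.
Context {R : realType}.

(** Gram matrix of the monomials 1, X, ..., X^{k-1} in L^2(0, 1). *)
Definition hilbertmx k : 'M[R]_k := \matrix_(i, j) ((i + j).+1%:R)^-1.

(** The primitive, vanishing at 0, of the square of the polynomial with coefficients z; being a
    polynomial, it spares an integral. *)
Definition square_primitive k (z : 'I_k -> R) : {poly R} :=
  \sum_i \sum_j (z i * z j / (i + j).+1%:R) *: 'X^((i + j).+1).

Lemma deriv_square_primitive k (z : 'I_k -> R) :
  (square_primitive z)^`() = (\sum_i z i *: 'X^i) ^+ 2.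
Proof.
rewrite /square_primitive raddf_sum expr2 big_distrl/=; apply: eq_bigr => i _.
rewrite raddf_sum big_distrr/=; apply: eq_bigr => j _.
rewrite derivZ derivXn/= -scalerMnr scalerMnl -[(_ / _) *+ _]mulr_natr mulfVK ?pnatr_eq0//.
by rewrite -scalerAl -scalerAr scalerA -exprD.
Qed.

Lemma square_primitive0 k (z : 'I_k -> R) : (square_primitive z).[0] = 0.
Proof.
rewrite horner_sum big1// => i _; rewrite horner_sum big1// => j _.
by rewrite hornerZ hornerXn expr0n mulr0.
Qed.

(** The substitution s = t u in the integral over [0, t] moves the powers of t into the
    coefficients. *)
Lemma square_primitiveE k (z : 'I_k -> R) t :
  (square_primitive z).[t] =
  t * dotv (hilbertmx k *m \col_i (t ^+ i * z i)) (\col_i (t ^+ i * z i)).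
Proof.
rewrite horner_sum /dotv mulr_sumr; apply: eq_bigr => i _.
rewrite horner_sum mxE mulr_suml mulr_sumr.
apply: eq_bigr => j _; rewrite hornerZ hornerXn !mxE exprS exprD; ring.
Qed.

Lemma horner_le (p : {poly R}) s t : s <= t ->
  (forall x, 0 <= p^`().[x]) -> p.[s] <= p.[t].
Proof.
move=> st p0; pose q := p \Po ('X + s%:P).
have qE x : q.[x] = p.[x + s] by rewrite horner_comp !hornerE.
have -> : p.[s] = q.[0] by rewrite qE add0r.
have -> : p.[t] = q.[t - s] by rewrite qE subrK.
apply: (@derive_ge0_le _ (horner q) (horner q^`())).
  by rewrite subr_ge0.
by move=> x _; rewrite deriv_comp derivD derivX derivC addr0 mulr1 horner_comp.
Qed.

(** If the form is not positive at x, the nondecreasing primitive of q^2 vanishes on all of [0, 1].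
    The roots 1, 1/2, 1/3, ... are then too many for a nonzero polynomial, so q = 0. *)
Lemma hilbertmx_pd k : pdmx (hilbertmx k).
Proof.
split; first by apply/matrixP => i j; rewrite !mxE addnC.
move=> x; apply: contra_neqT; rewrite -leNgt => H.
pose z (i : 'I_k) := x i ord0; pose p := square_primitive z.
pose q := \sum_i z i *: 'X^i.
have pq : p^`() = q ^+ 2 := deriv_square_primitive z.
have p0 y : 0 <= p^`().[y] by rewrite pq horner_exp sqr_ge0.
have p1 : p.[1] <= 0.
  rewrite /p square_primitiveE mul1r.
  have -> // : \col_i ((1 : R) ^+ i * z i) = x.
  by apply/colP => i; rewrite mxE expr1n mul1r.
have pz y : 0 <= y <= 1 -> p.[y] = 0.
  move=> /andP[y0 y1]; apply/eqP; rewrite eq_le.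
  rewrite (le_trans (horner_le y1 p0))//=.
  by rewrite -(square_primitive0 z) horner_le.
have pE : p = 0.
  apply/eqP; apply: contraT => pn0.
  pose rs : seq R := [seq (i.+1%:R)^-1 | i <- iota 0 (size p)].
  have := max_poly_roots pn0 (rs := rs); rewrite size_map size_iota ltnn.
  apply.
    by apply/allP => _ /mapP[i _ ->]; apply/eqP/pz; rewrite invr_ge0 ler0n invf_le1// ler1n.
  rewrite map_inj_uniq ?iota_uniq// => i j /invr_inj/eqP.
  by rewrite eqr_nat => /eqP[].
have : q ^+ 2 = 0 by rewrite -pq pE deriv0.
move=> /eqP; rewrite sqrf_eq0 => /eqP qE.
apply/colP => i; rewrite mxE -/(z i).
have : q`_i = 0 by rewrite qE coef0.
rewrite coef_sum (bigD1 i)//= coefZ coefXn eqxx mulr1 big1 ?addr0// => j ji.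
by rewrite coefZ coefXn (inj_eq val_inj) eq_sym (negbTE ji) mulr0.
Qed.

Lemma mxBE m p (M N : 'M[R]_(m, p)) i j : (M - N) i j = M i j - N i j.
Proof. by rewrite !mxE. Qed.

Section flow.
Context {n : nat}.
Implicit Types (A K : 'M[R]_n) (x : 'cV[R]_n) (s t : R).

Definition flow A t x := expmx (t *: A) *m x.

Lemma is_derive_flow A K x i t :
  is_derive t (1 : R) (fun s => (K *m flow A s x) i ord0)
    ((K *m A *m flow A t x) i ord0).
Proof.
have -> : (fun s => (K *m flow A s x) i ord0) =
    (fun s => \sum_k \sum_j K i k * x j ord0 * expmx (s *: A) k j).
  apply/funext => s; rewrite mxE; apply: eq_bigr => k _.
  by rewrite mxE mulr_sumr; apply: eq_bigr => j _; ring.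
have -> : (K *m A *m flow A t x) i ord0 =
    \sum_k \sum_j K i k * x j ord0 * (A *m expmx (t *: A)) k j.
  rewrite /flow -mulmxA mxE; apply: eq_bigr => k _.
  rewrite mulmxA mxE mulr_sumr; apply: eq_bigr => j _; ring.
apply: (@is_derive_sumf _ _ _ (fun k u => \sum_j K i k * x j ord0 * (A *m expmx (u *: A)) k j)) => k.
apply: (@is_derive_sumf _ _ _ (fun j u => K i k * x j ord0 * (A *m expmx (u *: A)) k j)) => j.
by apply: is_derive_scalef; exact: is_derive_expmx.
Qed.

Lemma flow0 A x : flow A 0 x = x.
Proof. by rewrite /flow scale0r expmx0 mul1mx. Qed.

Context (A K : 'M[R]_n).
Hypothesis AK : A + A^T = - (K^T *m K).

Lemma dissipation y : - 2 * dotv (A *m y) y = dotv (K *m y) (K *m y).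
Proof.
rewrite [RHS]dotv_trmx mulmxA -[K^T *m K]opprK -AK mulNmx dotvNr mulmxDl.
rewrite dotvDr (dotvC y (A *m y)) -dotv_trmx; ring.
Qed.

Lemma is_derive_energy x t :
  is_derive t (1 : R) (fun s => dotv x x - dotv (flow A s x) (flow A s x))
    (dotv (K *m flow A t x) (K *m flow A t x)).
Proof.
have D i : is_derive t (1 : R) (fun s => flow A s x i ord0)
    ((A *m flow A t x) i ord0).
  have := is_derive_flow A 1%:M x i t; rewrite mul1mx.
  by under [X in is_derive _ _ X _]funext do rewrite mul1mx.
rewrite -dissipation.
have -> : - 2 * dotv (A *m flow A t x) (flow A t x) =
    0 - \sum_i ((A *m flow A t x) i ord0 * flow A t x i ord0 +
            flow A t x i ord0 * (A *m flow A t x) i ord0).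
  by rewrite big_split/= -!/(dotv _ _) (dotvC (flow A t x)); ring.
apply: is_deriveB.
apply: (@is_derive_sumf _ _ _ (fun i u => (A *m flow A u x) i ord0 * flow A u x i ord0 +
            flow A u x i ord0 * (A *m flow A u x) i ord0)) => i.
exact: is_derive_mulf.
Qed.

Lemma flow_contraction x t : 0 <= t ->
  dotv (flow A t x) (flow A t x) <= dotv x x.
Proof.
move=> t0; rewrite -subr_ge0.
rewrite (_ : 0 = dotv x x - dotv (flow A 0 x) (flow A 0 x)); last first.
  by rewrite flow0 subrr.
apply: (derive_ge0_le t0 (is_derive_energy x)) => s _; exact: dotvv_ge0.
Qed.

Definition taylor_flow (L : 'M[R]_n) k t x :=
  \sum_(j < k) (t ^+ j / j`!%:R) *: (L *m A ^+ j *m x).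

(** Induction on the order with L arbitrary: the remainder of order k + 1 for L has as derivative
    the remainder of order k for [L *m A], and the mean value theorem turns this into a factor t. At
    order 0, contraction of the flow gives a constant valid for all t >= 0. *)
Lemma taylor_flow_remainder (L : 'M[R]_n) k : exists2 C : R, 0 <= C &
  forall x t i, 0 <= t ->
    `|(L *m flow A t x - taylor_flow L k t x) i ord0|
      <= C * t ^+ k * Num.sqrt (dotv x x).
Proof.
elim: k L => [|k IHk] L.
  have [c c0 cP] := mx_dotv_bound L.
  exists (Num.sqrt c); first exact: sqrtr_ge0.
  move=> x t i t0; rewrite /taylor_flow big_ord0 subr0 expr0 mulr1.
  rewrite -sqrtrM ?(ltW c0)// -sqrtr_sqr ler_wsqrtr//.
  apply: le_trans (coord_sqr_le _ _) _; apply: le_trans (cP _) _.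
  by rewrite ler_pM2l//; exact: flow_contraction.
have [C C0 CP] := IHk (L *m A); exists C => // x t i t0.
pose r s := (L *m flow A s x - taylor_flow L k.+1 s x) i ord0.
pose dr s := (L *m A *m flow A s x - taylor_flow (L *m A) k s x) i ord0.
have rdr s : is_derive s (1 : R) r (dr s).
  have -> : r = (fun s => (L *m flow A s x) i ord0 -
      \sum_(j < k.+1) (L *m A ^+ j *m x) i ord0 / j`!%:R * s ^+ j).
    apply/funext => u; rewrite /r mxBE /taylor_flow summxE; congr (_ - _).
    by apply: eq_bigr => j _; rewrite [LHS]mxE; ring.
  have -> : dr s = (L *m A *m flow A s x) i ord0 -
      \sum_(j < k.+1) (L *m A ^+ j *m x) i ord0 / j`!%:R * (j%:R * s ^+ j.-1).
    rewrite /dr mxBE; congr (_ - _).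
    rewrite big_ord_recl mul0r mulr0 add0r summxE; apply: eq_bigr => j _.
    rewrite [LHS]mxE /= /bump/= add1n exprS [A * _ ^+ _]/(A *m _) mulmxA factS natrM.
    have j0 : (j.+1%:R : R) != 0 by rewrite pnatr_eq0.
    rewrite add0n invfM; move: (j`!%:R^-1) (_ i ord0) (s ^+ j) => a b c.
    by field.
  apply: is_deriveB; first exact: is_derive_flow.
  apply: (@is_derive_sumf _ _ _ (fun j u => (L *m A ^+ j *m x) i ord0 / j`!%:R * (j%:R * u ^+ j.-1))) => j.
  apply: is_derive_scalef.
  exact: is_derive_expn.
have [c /andP[c0 ct]] := MVT_from0 t0 rdr.
have -> : r 0 = 0.
  rewrite /r flow0 mxBE /taylor_flow big_ord_recl big1.
    by rewrite expr0 fact0 divr1 scale1r expr0 addr0 mulmx1 subrr.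
  by move=> j _; rewrite expr0n mul0r scale0r.
rewrite subr0 -/(r t) => ->; rewrite normrM (ger0_norm t0) exprSr mulrA mulrAC.
rewrite ler_wpM2r//; apply: le_trans (CP _ _ _ c0) _.
by rewrite ler_wpM2r ?sqrtr_ge0// ler_wpM2l// lerXn2r ?nnegrE.
Qed.

End flow.
End contraction.

(** * Quantitative contraction from the Kalman condition *)

Section kalman_contraction.
Context {R : realType} {n : nat} (A K : 'M[R]_n) (k0 : nat).
Hypothesis AK : A + A^T = - (K^T *m K).
Hypothesis kalman : forall x : 'cV[R]_n,
  (forall j, (j <= k0)%N -> K *m A ^+ j *m x = 0) -> x = 0.
Implicit Types (x : 'cV[R]_n) (t : R).

(** The Gram sum W is positive definite by [kalman], and coercivity makes this quantitative. *)
Lemma kalman_coercive : exists2 c : R, 0 < c & forall x,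
  c * dotv x x <= \sum_(j < k0.+1) dotv (K *m A ^+ j *m x) (K *m A ^+ j *m x).
Proof.
pose W := \sum_(j < k0.+1) (K *m A ^+ j)^T *m (K *m A ^+ j).
have WE x : dotv (W *m x) x =
    \sum_(j < k0.+1) dotv (K *m A ^+ j *m x) (K *m A ^+ j *m x).
  rewrite dotvE mulmx_suml linear_sum mulmx_suml summxE/=; apply: eq_bigr => j _.
  by rewrite -dotvE -(mulmxA _^T) dotv_trmx trmxK.
have [|c c0 cP] := @pd_coercive _ _ W.
  split.
    by rewrite /W linear_sum/=; apply: eq_bigr => j _; rewrite trmx_mul trmxK.
  move=> x; apply: contra_neqT; rewrite -leNgt WE => H; apply: kalman => j jk.
  apply/eqP; rewrite -dotvv_eq0 eq_le dotvv_ge0 andbT.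
  apply: le_trans H; rewrite (bigD1 (Ordinal (jk : (j < k0.+1)%N)))//= lerDl.
  by apply: sumr_ge0 => i _; exact: dotvv_ge0.
by exists c => // x; rewrite -WE.
Qed.

(* With p the Taylor polynomial of degree k0 of K e^{tA} x and r the remainder,
   |K e^{tA} x|^2 >= |p|^2 / 2 - |r|^2, where the primitive of |p|^2 is at least
   of order t^{2 k0 + 1} |x|^2 by the Kalman condition, and that of |r|^2 is
   O(t^{2 k0 + 3}) |x|^2. *)
Lemma kalman_contraction : exists (c t0 : R), [/\ 0 < c, 0 < t0, t0 <= 1 &
  forall x t, 0 <= t <= t0 ->
    dotv (flow A t x) (flow A t x) <= (1 - c * t ^+ (2 * k0 + 1)) * dotv x x].
Proof.
have [g g0 gP] := kalman_coercive.
have [h h0 hP] := pd_coercive (@hilbertmx_pd R k0.+1).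
have [C C0 CP] := taylor_flow_remainder AK K k0.+1.
(* h comes from the Hilbert matrix, g from the Kalman condition, and the denominators j! of the
   Taylor coefficients are at most k0!. *)
pose b : R := h * g / k0`!%:R ^+ 2.
have b0 : 0 < b by rewrite !mulr_gt0// invr_gt0 exprn_gt0// ltr0n fact_gt0.
pose D : R := n%:R * C ^+ 2 + 1.
have D0 : 0 < D by rewrite ltr_wpDl// mulr_ge0// sqr_ge0.
(* Half of the primitive contributes b / 2; for t <= 1 and t <= b / (4 D) the remainder, of size D
   t^2 <= b / 4 relative to t^{2 k0 + 1}, leaves b / 4. *)
exists (b / 4), (Num.min 1 (b / (4 * D))).
have t0gt0 : 0 < Num.min 1 (b / (4 * D)).
  by rewrite lt_min ltr01 divr_gt0// mulr_gt0.
split => //; [by rewrite divr_gt0|by rewrite ge_min lexx|].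
move=> x t /andP[t0]; rewrite le_min => /andP[t1 tb].
pose z (a : 'I_n) (j : 'I_k0.+1) : R := (K *m A ^+ j *m x) a ord0 / j`!%:R.
pose P := \sum_(a < n) square_primitive (z a).
(* G vanishes at 0 and is shown to have a nonnegative derivative on [0, t]; [0 <= G t] bounds the
   energy loss from below. The derivative of the last term is at least D |x|^2 s^{2 k0 + 2}, which
   pays for the squared remainder. *)
pose G s := dotv x x - dotv (flow A s x) (flow A s x) - 2^-1 * P.[s]
  + D * dotv x x * s ^+ (2 * k0 + 3).
pose dG s := dotv (K *m flow A s x) (K *m flow A s x) - 2^-1 * P^`().[s]
  + D * dotv x x * ((2 * k0 + 3)%:R * s ^+ (2 * k0 + 2)).
have GdG s : is_derive s (1 : R) G (dG s).
  apply: is_deriveD.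
    by apply: is_deriveB; exact: is_derive_energy.
  apply: is_derive_scalef; have := is_derive_expn (2 * k0 + 3) s.
  by rewrite [X in _ ^+ X](_ : _ = (2 * k0 + 2)%N)// addnS.
have pE a s : taylor_flow A K k0.+1 s x a ord0 = (\sum_i z a i *: 'X^i).[s].
  rewrite summxE horner_sum; apply: eq_bigr => j _.
  by rewrite hornerZ hornerXn mxE /z; ring.
have dPE s : P^`().[s] = \sum_a (taylor_flow A K k0.+1 s x a ord0) ^+ 2.
  rewrite raddf_sum horner_sum /=; apply: eq_bigr => a _.
  by rewrite deriv_square_primitive horner_exp pE.
have dG0 s : 0 <= s <= t -> 0 <= dG s.
  move=> /andP[s0 st].
  have s1 : s <= 1 := le_trans st t1.
  have H : 0 <= dotv (K *m flow A s x) (K *m flow A s x) - 2^-1 * P^`().[s]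
      + n%:R * C ^+ 2 * dotv x x * s ^+ (2 * k0 + 2).
    rewrite dPE /dotv -/(dotv x x).
    have -> : n%:R * C ^+ 2 * dotv x x * s ^+ (2 * k0 + 2) =
        \sum_(a < n) (C * s ^+ k0.+1 * Num.sqrt (dotv x x)) ^+ 2.
      rewrite sumr_const card_ord -mulr_natl !exprMn sqr_sqrtr ?dotvv_ge0//.
      rewrite -(exprM s) (_ : k0.+1 * 2 = 2 * k0 + 2)%N; first ring.
      by rewrite mulSn mulnC addnC.
    rewrite mulr_sumr -sumrB -big_split/=; apply: sumr_ge0 => a _.
    have := CP x s a s0; rewrite mxBE.
    set p := taylor_flow _ _ _ _ _ _ _; set f := (_ *m _) _ _.
    set B := C * _ * _ => fpB.
    have : (f - p) ^+ 2 <= B ^+ 2.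
      by rewrite -[leLHS]real_normK ?num_real// lerXn2r ?nnegrE// (le_trans _ fpB).
    rewrite -(lerD2l (f * f - 2^-1 * p ^+ 2)); apply: le_trans.
    have -> : f * f - 2^-1 * p ^+ 2 + (f - p) ^+ 2 = 2^-1 * (2 * f - p) ^+ 2.
      by field.
    by rewrite mulr_ge0// sqr_ge0.
  apply: (le_trans H); rewrite /dG lerD2l.
  have -> : D * dotv x x * ((2 * k0 + 3)%:R * s ^+ (2 * k0 + 2)) =
    (2 * k0 + 3)%:R * (D * dotv x x * s ^+ (2 * k0 + 2)) by ring.
  have Ds : 0 <= D * dotv x x * s ^+ (2 * k0 + 2).
    by rewrite !mulr_ge0 ?exprn_ge0// ?dotvv_ge0// ltW.
  apply: (@le_trans _ _ (D * dotv x x * s ^+ (2 * k0 + 2))).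
    by rewrite ler_wpM2r ?exprn_ge0// ler_wpM2r ?dotvv_ge0// /D lerDl.
  by rewrite ler_peMl// ler1n addnS.
have := derive_ge0_le t0 GdG dG0.
have -> : G 0 = 0.
  rewrite /G flow0 subrr sub0r horner_sum big1; last first.
    by move=> a _; exact: square_primitive0.
  by rewrite mulr0 oppr0 add0r addnS expr0n mulr0.
rewrite /G => Gt.
have Pt : b * t ^+ (2 * k0 + 1) * dotv x x <= P.[t].
  rewrite horner_sum.
  apply: (@le_trans _ _ (\sum_(a < n) t ^+ (2 * k0 + 1) *
      (h * \sum_j (z a j) ^+ 2))); last first.
    apply: ler_sum => a _; rewrite square_primitiveE addn1 exprS -mulrA.
    rewrite ler_wpM2l//; apply: le_trans _ (hP _); rewrite mulrCA ler_wpM2l ?(ltW h0)//.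
    rewrite /dotv mulr_sumr; apply: ler_sum => j _; rewrite !mxE -expr2 [leRHS]exprMn.
    rewrite ler_wpM2r ?sqr_ge0// -exprM (mulnC j) ler_wiXn2l//.
    by rewrite leq_pmul2l// -ltnS.
  rewrite -mulr_sumr mulrAC mulrC ler_wpM2l ?exprn_ge0// -mulr_sumr /b.
  rewrite -!mulrA ler_wpM2l ?(ltW h0)// exchange_big/=.
  rewrite mulrCA mulrC ler_pdivrMr ?exprn_gt0 ?ltr0n ?fact_gt0//.
  apply: le_trans (gP x) _; rewrite mulr_suml; apply: ler_sum => j _.
  rewrite /dotv mulr_suml; apply: ler_sum => a _.
  rewrite /z -expr2 exprMn exprVn -mulrA ler_peMr ?sqr_ge0//.
  rewrite mulrC -exprVn -exprMn -[leLHS](expr1n _ 2) lerXn2r ?nnegrE//.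
  rewrite ler_pdivlMr ?ltr0n ?fact_gt0// mul1r ler_nat.
  by apply: leq_fact; rewrite -ltnS.
have tD : D * dotv x x * t ^+ (2 * k0 + 3) <= b / 4 * t ^+ (2 * k0 + 1) * dotv x x.
  have -> : t ^+ (2 * k0 + 3) = t ^+ (2 * k0 + 1) * (t * t).
    by rewrite -expr2 -exprD -addnA.
  have Dtt : D * (t * t) <= b / 4.
    apply: (@le_trans _ _ (D * t)); first by rewrite ler_pM2l// ler_piMr.
    by rewrite mulrC -ler_pdivlMr// -mulrA -invfM.
  have XU : 0 <= dotv x x * t ^+ (2 * k0 + 1).
    by rewrite mulr_ge0 ?dotvv_ge0 ?exprn_ge0.
  have := ler_wpM2l XU Dtt; congr (_ <= _); ring.
move: Gt Pt tD; move: (dotv x x) (dotv _ _) (P.[t]) (t ^+ _) (t ^+ _) => X Y Z U V.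
lra.
Qed.

End kalman_contraction.

(** * Tensors as functions of words, tensor powers and derivations *)

Section tensors.
Context {R : realType} {n : nat}.
Implicit Types (m : nat) (E A : 'M[R]_n) (u v f g : seq 'I_n -> R).

(** The sum over words of length m. Functions are defined on all words so that fixing the first
    letter is the precomposition [fun s => f (i :: s)]; values at other lengths do not enter. *)
Fixpoint wsum m f : R :=
  if m is m'.+1 then \sum_i wsum m' (fun s => f (i :: s)) else f [::].

(* The action of E^{(x) m} on tensors, seen as functions of words of length m. *)
Fixpoint tensor_pow m E u (s : seq 'I_n) {struct m} : R :=
  if m is m'.+1 then
    if s is i :: s' then \sum_j E i j * tensor_pow m' E (fun r => u (j :: r)) s'
    else 0
  else u s.

(* The derivation of the tensor algebra extending A. *)
Fixpoint tensor_der m A u (s : seq 'I_n) {struct m} : R :=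
  if m is m'.+1 then
    if s is i :: s' then
      \sum_j A i j * u (j :: s') + tensor_der m' A (fun r => u (i :: r)) s'
    else 0
  else 0.

Lemma eq_wsum m f g : f =1 g -> wsum m f = wsum m g.
Proof.
elim: m f g => [|m IHm] f g fg /=; first exact: fg.
by apply: eq_bigr => i _; apply: IHm => s; exact: fg.
Qed.

Lemma wsumD m f g : wsum m (fun s => f s + g s) = wsum m f + wsum m g.
Proof.
elim: m f g => [|m IHm] f g //=; rewrite -big_split/=.
by apply: eq_bigr => i _; exact: IHm.
Qed.

Lemma wsumZ m a f : wsum m (fun s => a * f s) = a * wsum m f.
Proof.
elim: m f => [|m IHm] f //=; rewrite mulr_sumr.
by apply: eq_bigr => i _; exact: IHm.
Qed.

Lemma wsum0 m f : (forall s, f s = 0) -> wsum m f = 0.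
Proof.
elim: m f => [|m IHm] f f0 /=; first exact: f0.
by rewrite big1// => i _; apply: IHm => s; exact: f0.
Qed.

Lemma wsum_sum m k (F : 'I_k -> seq 'I_n -> R) :
  wsum m (fun s => \sum_i F i s) = \sum_i wsum m (F i).
Proof.
elim: m F => [|m IHm] F //=; rewrite exchange_big/=.
by apply: eq_bigr => i _; exact: IHm.
Qed.

Lemma ler_wsum m f g : (forall s, f s <= g s) -> wsum m f <= wsum m g.
Proof.
elim: m f g => [|m IHm] f g fg /=; first exact: fg.
by apply: ler_sum => i _; apply: IHm => s; exact: fg.
Qed.

Lemma wsum_ge0 m f : (forall s, 0 <= f s) -> 0 <= wsum m f.
Proof.
elim: m f => [|m IHm] f f0 /=; first exact: f0.
by apply: sumr_ge0 => i _; exact: IHm.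
Qed.

Definition wnorm2 m u := wsum m (fun s => u s ^+ 2).

Lemma wnorm2_ge0 m u : 0 <= wnorm2 m u.
Proof. by apply: wsum_ge0 => s; exact: sqr_ge0. Qed.

Lemma wsum_CauchySchwarz m u v :
  `|wsum m (fun s => u s * v s)| <= Num.sqrt (wnorm2 m u) * Num.sqrt (wnorm2 m v).
Proof.
set p := wsum _ _.
have H a b : 0 <= a ^+ 2 * wnorm2 m u - 2 * (a * b) * p + b ^+ 2 * wnorm2 m v.
  have -> : a ^+ 2 * wnorm2 m u - 2 * (a * b) * p + b ^+ 2 * wnorm2 m v =
      wsum m (fun s => (a * u s - b * v s) ^+ 2).
    rewrite -mulNr -!wsumZ -!wsumD; apply: eq_wsum => s; ring.
  by apply: wsum_ge0 => s; exact: sqr_ge0.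
rewrite -sqrtrM ?wnorm2_ge0// -sqrtr_sqr ler_wsqrtr//.
have := wnorm2_ge0 m u; have := wnorm2_ge0 m v.
move: (wnorm2 m u) (wnorm2 m v) H => U V H V0 U0.
have [V1|V1] := eqVneq V 0.
  have [p1|p1] := eqVneq p 0; first by rewrite p1 expr0n mulr_ge0.
  (* For V = 0 the form is affine in its second argument, and this value makes it -1. *)
  have := H 1 ((U + 1) / (2 * p)).
  have -> : 1 ^+ 2 * U - 2 * (1 * ((U + 1) / (2 * p))) * p +
    ((U + 1) / (2 * p)) ^+ 2 * V = -1 by rewrite V1; field.
  by rewrite oppr_ge0 real_leNgt ?num_real// ltr01.
have Vp : 0 < V by rewrite lt0r V1.
have HVp := H V p; rewrite -(ler_pM2l Vp) -subr_ge0; apply: le_trans HVp _.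
by rewrite le_eqVlt; apply/orP; left; apply/eqP; ring.
Qed.

Lemma tensor_powD m E u v s :
  tensor_pow m E (fun r => u r + v r) s = tensor_pow m E u s + tensor_pow m E v s.
Proof.
elim: m u v s => [|m IHm] u v [|i s] //=; first by rewrite addr0.
by rewrite -big_split/=; apply: eq_bigr => j _; rewrite IHm mulrDr.
Qed.

Lemma tensor_powZ m E a u s :
  tensor_pow m E (fun r => a * u r) s = a * tensor_pow m E u s.
Proof.
elim: m u s => [|m IHm] u [|i s] //=; first by rewrite mulr0.
by rewrite mulr_sumr; apply: eq_bigr => j _; rewrite IHm mulrCA.
Qed.

Lemma tensor_pow_sum m E k (F : 'I_k -> seq 'I_n -> R) s :
  tensor_pow m E (fun r => \sum_l F l r) s = \sum_l tensor_pow m E (F l) s.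
Proof.
elim: m F s => [|m IHm] F [|i s] //=; first by rewrite big1.
rewrite exchange_big/=; apply: eq_bigr => j _.
by rewrite IHm mulr_sumr.
Qed.

Lemma tensor_pow1 m u s : size s = m -> tensor_pow m 1%:M u s = u s.
Proof.
elim: m u s => [|m IHm] u [|i s] //= [sm].
rewrite (bigD1 i)//= mxE eqxx mul1r IHm// big1 ?addr0// => j ji.
by rewrite mxE eq_sym (negbTE ji) mul0r.
Qed.

(** One factor at a time: for fixed remaining letters, E acts on the vector of the slices [g j],
    which are bounded by induction. *)
Lemma wnorm2_tensor_pow m E q u : 0 <= q ->
  (forall x : 'cV[R]_n, dotv (E *m x) (E *m x) <= q * dotv x x) ->
  wnorm2 m (tensor_pow m E u) <= q ^+ m * wnorm2 m u.
Proof.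
move=> q0 Eq; elim: m u => [|m IHm] u; first by rewrite expr0 mul1r.
rewrite /wnorm2 /=.
pose g j := tensor_pow m E (fun r => u (j :: r)).
have -> : \sum_i wsum m (fun s => (\sum_j E i j * g j s) ^+ 2) =
    wsum m (fun s => dotv (E *m \col_j g j s) (E *m \col_j g j s)).
  rewrite -wsum_sum; apply: eq_wsum => s; apply: eq_bigr => i _.
  by rewrite mxE -expr2; congr (_ ^+ 2); apply: eq_bigr => j _; rewrite mxE.
apply: le_trans (ler_wsum _ (fun s => Eq (\col_j g j s))) _.
rewrite wsumZ exprS -mulrA ler_wpM2l//.
have -> : wsum m (fun s => dotv (\col_j g j s) (\col_j g j s)) =
    \sum_j wnorm2 m (g j).
  rewrite -wsum_sum; apply: eq_wsum => s; apply: eq_bigr => j _.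
  by rewrite !mxE expr2.
by rewrite mulr_sumr; apply: ler_sum => j _; exact: IHm.
Qed.

Lemma is_derive_wsum m (F dF : R -> seq 'I_n -> R) t :
  (forall s, is_derive t (1 : R) (F ^~ s) (dF t s)) ->
  is_derive t (1 : R) (fun x => wsum m (F x)) (wsum m (dF t)).
Proof.
elim: m F dF => [|m IHm] F dF FdF /=; first exact: FdF.
apply: (@is_derive_sumf _ _ (fun i x => wsum m (fun s => F x (i :: s)))
  (fun i x => wsum m (fun s => dF x (i :: s)))) => i.
exact: (IHm (fun x s => F x (i :: s)) (fun x s => dF x (i :: s))).
Qed.

Lemma is_derive_tensor_pow m A u s t :
  is_derive t (1 : R) (fun x => tensor_pow m (expmx (x *: A)) u s)
    (tensor_pow m (expmx (t *: A)) (tensor_der m A u) s).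
Proof.
elim: m u s => [|m IHm] u [|i s] /=; try exact: is_derive_cst.
set E := expmx _.
have -> : \sum_j E i j * tensor_pow m E (fun r => \sum_l A j l * u (l :: r) +
      tensor_der m A (fun r0 => u (j :: r0)) r) s =
    \sum_j ((A *m E) i j * tensor_pow m E (fun r => u (j :: r)) s +
      E i j * tensor_pow m E (tensor_der m A (fun r => u (j :: r))) s).
  (* In the claimed derivative the derivation acts before the semigroup, so A must pass to the right
     of the exponential. *)
  rewrite big_split/= expmx_comm.
  under eq_bigr => j _ do rewrite tensor_powD mulrDr tensor_pow_sum.
  rewrite big_split/=; congr (_ + _).
  under eq_bigr => j _ do rewrite mulr_sumr.
  rewrite exchange_big/=; apply: eq_bigr => l _.
  rewrite mxE mulr_suml; apply: eq_bigr => j _.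
  by rewrite tensor_powZ mulrA.
pose df j x := (A *m expmx (x *: A)) i j *
    tensor_pow m (expmx (x *: A)) (fun r => u (j :: r)) s +
  expmx (x *: A) i j *
    tensor_pow m (expmx (x *: A)) (tensor_der m A (fun r => u (j :: r))) s.
apply: (@is_derive_sumf _ _ _ df) => j.
by apply: is_derive_mulf; exact: is_derive_expmx.
Qed.

Lemma wsum_size m f g : (forall s, size s = m -> f s = g s) -> wsum m f = wsum m g.
Proof.
elim: m f g => [|m IHm] f g fg /=; first exact: fg.
by apply: eq_bigr => i _; apply: IHm => s sm; apply: fg; rewrite /= sm.
Qed.

(* Duhamel: u = e^{tD} u - int_0^t e^{sD} D u ds, for D the derivation. *)
Lemma tensor_semigroup_bound m A u q t : 0 <= t -> 0 <= q ->
  (forall s (x : 'cV[R]_n), 0 <= s -> dotv (flow A s x) (flow A s x) <= dotv x x) ->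
  (forall x : 'cV[R]_n, dotv (flow A t x) (flow A t x) <= q * dotv x x) ->
  (1 - Num.sqrt (q ^+ m)) * Num.sqrt (wnorm2 m u) <=
  t * Num.sqrt (wnorm2 m (tensor_der m A u)).
Proof.
move=> t0 q0 Acontr Aq.
set N := Num.sqrt (wnorm2 m u); set N' := Num.sqrt (wnorm2 m (tensor_der m A u)).
have N0 : 0 <= N := sqrtr_ge0 _.
pose G s v := tensor_pow m (expmx (s *: A)) v.
(* Pairing with u makes the problem scalar, so that the mean value theorem can stand for the time
   integral. *)
pose f s := wsum m (fun w => G s u w * u w).
pose df s := wsum m (fun w => G s (tensor_der m A u) w * u w).
have fdf s : is_derive s (1 : R) f (df s).
  apply: (@is_derive_wsum _ (fun s w => G s u w * u w)
    (fun s w => G s (tensor_der m A u) w * u w)) => w.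
  rewrite -[X in is_derive _ _ _ X]addr0 -(mulr0 (G s u w)).
  by apply: is_derive_mulf; exact: is_derive_tensor_pow.
have f0 : f 0 = N ^+ 2.
  rewrite /N sqr_sqrtr ?wnorm2_ge0//; apply: wsum_size => w wm.
  by rewrite /G scale0r expmx0 tensor_pow1.
have ft : f t <= Num.sqrt (q ^+ m) * N ^+ 2.
  apply: le_trans (ler_norm _) _; apply: le_trans (wsum_CauchySchwarz _ _ _) _.
  rewrite -/N expr2 mulrA ler_wpM2r// /N -sqrtrM ?exprn_ge0// ler_wsqrtr//.
  exact: wnorm2_tensor_pow.
have [c /andP[c0 ct]] := MVT_from0 t0 fdf.
have dfc : - df c <= N' * N.
  apply: le_trans (ler_norm _) _; rewrite normrN.
  apply: le_trans (wsum_CauchySchwarz _ _ _) _.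
  rewrite ler_wpM2r// ler_wsqrtr//.
  have E1 x : dotv (expmx (c *: A) *m x) (expmx (c *: A) *m x) <= 1 * dotv x x.
    by rewrite mul1r; exact: Acontr.
  by have := wnorm2_tensor_pow m (tensor_der m A u) ler01 E1; rewrite expr1n mul1r.
move=> fE.
have H : (1 - Num.sqrt (q ^+ m)) * N * N <= t * N' * N.
  have := ler_wpM2r t0 dfc; move: fE ft; rewrite f0 expr2; lra.
have [N1|N1] := eqVneq N 0; first by rewrite N1 mulr0 mulr_ge0// sqrtr_ge0.
by rewrite -(@ler_pM2r _ N)// lt0r N1.
Qed.

End tensors.

(** * The subelliptic estimate in each degree *)

Section subelliptic.
Context {R : realType} {n : nat} (A K : 'M[R]_n) (k0 : nat).
Hypothesis AK : A + A^T = - (K^T *m K).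
Hypothesis kalman : forall x : 'cV[R]_n,
  (forall j, (j <= k0)%N -> K *m A ^+ j *m x = 0) -> x = 0.

(** Keeps (1 - x)^m away from 1 once m x is bounded below, as (1 - x)^m <= e^{-mx} would. *)
Lemma bernoulli_inv (x : R) m : 0 <= x <= 1 -> (1 - x) ^+ m * (1 + m%:R * x) <= 1.
Proof.
move=> /andP[x0 x1]; elim: m => [|m IHm]; first by rewrite expr0 mul1r mul0r addr0.
apply: le_trans IHm; rewrite exprSr -mulrA ler_wpM2l//.
  by rewrite exprn_ge0// subr_ge0.
rewrite -subr_ge0 -nat1r.
have -> : 1 + m%:R * x - (1 - x) * (1 + (1 + m%:R) * x) =
  (1 + m%:R) * x * x by ring.
by rewrite !mulr_ge0// addr_ge0.
Qed.

Lemma tensor_subelliptic : exists2 C : R, 0 < C & forall m u, (0 < m)%N ->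
  (1 + m%:R / 2) `^ (2 / (2 * k0 + 1)%:R) * wnorm2 m u <=
  C * wnorm2 m (tensor_der m A u).
Proof.
have [c1 [t0 [c10 t00 t01 contr1]]] := kalman_contraction AK kalman.
(* With c <= 1 and t <= 1 the quantity c t^d lies in [0, 1], as Bernoulli's inequality requires. *)
pose c := Num.min c1 1.
have c0 : 0 < c by rewrite lt_min c10 ltr01.
have c1' : c <= 1 by rewrite ge_min lexx orbT.
have contr x t : 0 <= t <= t0 ->
    dotv (flow A t x) (flow A t x) <= (1 - c * t ^+ (2 * k0 + 1)) * dotv x x.
  move=> tt0; apply: le_trans (contr1 x t tt0) _.
  rewrite ler_wpM2r ?dotvv_ge0// lerB// ler_wpM2r ?exprn_ge0//.
    by case/andP: tt0.
  by rewrite ge_min lexx.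
set d := (2 * k0 + 1)%N in contr *.
have d0 : (0 < d)%N by rewrite /d addn1.
(* The factor 2/3 is the minimum of m / (1 + m / 2) over m >= 1. *)
pose e := 2 / 3 * (c * t0 ^+ d).
have e0 : 0 < e by rewrite !mulr_gt0// ?exprn_gt0// invr_gt0.
pose k := Num.sqrt ((1 + e)^-1).
have k1 : k < 1.
  rewrite /k -[ltRHS]sqrtr1 ltr_sqrt ?ltr01// invf_lt1 ?ltrDl//.
  by rewrite addr_gt0.
exists (t0 ^+ 2 / (1 - k) ^+ 2).
  by rewrite divr_gt0 ?exprn_gt0// subr_gt0.
move=> m u m0.
pose b : R := 1 + m%:R / 2.
have b1 : 1 <= b by rewrite lerDl divr_ge0.
have b0 : 0 < b := lt_le_trans ltr01 b1.
pose a := b `^ (d%:R^-1).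
have a1 : 1 <= a by rewrite -(powRr0 b) ler_powR.
have a0 : 0 < a := lt_le_trans ltr01 a1.
have aE : b `^ (2 / d%:R) = a ^+ 2.
  by rewrite mulrC powRrM powR_mulrn// ltW.
have ad : a ^+ d = b.
  by rewrite -powR_mulrn ?(ltW a0)// -powRrM mulVf ?powRr1 ?(ltW b0)// pnatr_eq0 -lt0n.
(* Since a^d = b, this gives m c t^d = (m / b) c t0^d >= e, so the contraction factor in degree m is
   at most k < 1. Squaring (1 - k) |u| <= (t0 / a) |Du| then produces the weight a^2 and the
   constant. *)
pose t := t0 / a.
have tt0 : 0 <= t <= t0.
  by rewrite divr_ge0 ?(ltW t00) ?(ltW a0)//= ler_pdivrMr// ler_peMr// ltW.
have [t_0 t_t0] := andP tt0.
pose x := c * t ^+ d.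
have x01 : 0 <= x <= 1.
  rewrite mulr_ge0 ?exprn_ge0// ?(ltW c0)//= mulr_ile1// ?(ltW c0)// ?exprn_ge0//.
  by rewrite exprn_ile1// (le_trans t_t0).
have [x0 x1] := andP x01.
have q0 : 0 <= 1 - x by rewrite subr_ge0.
have := tensor_semigroup_bound m u t_0 q0
  (fun s y s0 => flow_contraction AK y s0) (fun y => contr y t tt0).
set N := wnorm2 m u; set N' := wnorm2 m _ => H.
have mx : e <= m%:R * x.
  rewrite /x /t exprMn exprVn ad /e.
  have m1 : 1 <= (m%:R : R) by rewrite ler1n.
  rewrite [leRHS](_ : _ = m%:R / b * (c * t0 ^+ d)); last by ring.
  rewrite ler_wpM2r ?mulr_ge0 ?exprn_ge0 ?(ltW c0) ?(ltW t00)//.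
  rewrite ler_pdivlMr// /b; lra.
have qk : Num.sqrt ((1 - x) ^+ m) <= k.
  rewrite ler_wsqrtr// -[_^-1]mul1r ler_pdivlMr ?addr_gt0//.
  apply: le_trans (bernoulli_inv m x01).
  by rewrite ler_wpM2l ?exprn_ge0// lerD2l.
have H2 : (1 - k) * Num.sqrt N <= t * Num.sqrt N'.
  apply: le_trans H; rewrite ler_wpM2r ?sqrtr_ge0//; lra.
have H3 : (1 - k) ^+ 2 * N <= t ^+ 2 * N'.
  have : ((1 - k) * Num.sqrt N) ^+ 2 <= (t * Num.sqrt N') ^+ 2.
    have k1' : 0 <= 1 - k by rewrite subr_ge0 ltW.
    apply: lerXn2r; rewrite ?nnegrE//; last by rewrite mulr_ge0 ?sqrtr_ge0.
    by rewrite mulr_ge0 ?sqrtr_ge0.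
  by rewrite !exprMn !sqr_sqrtr ?wnorm2_ge0.
rewrite aE [leRHS]mulrAC ler_pdivlMr ?exprn_gt0 ?subr_gt0//.
have -> : t0 ^+ 2 * N' = a ^+ 2 * (t ^+ 2 * N').
  by rewrite /t; field; rewrite gt_eqF.
by rewrite mulrAC -mulrA ler_wpM2l// exprn_ge0// ltW.
Qed.

End subelliptic.

(** * From words to multi-indices *)

Section multi_indices.
Context {R : realType} {n : nat}.
Implicit Types (b : {ffun 'I_n -> nat}) (i j k l : 'I_n) (s : seq 'I_n).

Definition mi_succ i b : {ffun 'I_n -> nat} := [ffun j => (b j + (j == i))%N].
(** Subtraction is truncated: for [b i = 0] this is b itself. Below it occurs either under [0 < b i]
    or with a factor [b i]. *)
Definition mi_pred i b : {ffun 'I_n -> nat} := [ffun j => (b j - (j == i))%N].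
Definition mi_fact b : nat := \prod_j (b j)`!.
Definition mi_count s : {ffun 'I_n -> nat} := [ffun j => count_mem j s].

Lemma mi_count_cons i s : mi_count (i :: s) = mi_succ i (mi_count s).
Proof. by apply/ffunP => j; rewrite !ffunE /= addnC eq_sym. Qed.

Lemma mi_predK i b : (0 < b i)%N -> mi_succ i (mi_pred i b) = b.
Proof.
by move=> bi; apply/ffunP => j; rewrite !ffunE subnK//; case: eqP => // ->.
Qed.

Lemma mi_succK i b : mi_pred i (mi_succ i b) = b.
Proof. by apply/ffunP => j; rewrite !ffunE addnK. Qed.

Lemma mi_succC i k b : mi_succ i (mi_succ k b) = mi_succ k (mi_succ i b).
Proof. by apply/ffunP => j; rewrite !ffunE addnAC. Qed.

Lemma mi_succ_pred i k b : (0 < b k)%N ->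
  mi_pred k (mi_succ i b) = mi_succ i (mi_pred k b).
Proof.
move=> bk; apply/ffunP => j; rewrite !ffunE addnBAC//.
by case: (j =P k) => // ->.
Qed.

Lemma mi_pred_size i b m : (0 < b i)%N -> \sum_j b j = m.+1 ->
  \sum_j mi_pred i b j = m.
Proof.
move=> bi bm; apply: succn_inj; rewrite -bm -[in RHS](mi_predK bi) -addn1.
under [RHS]eq_bigr do rewrite ffunE.
rewrite big_split/=; congr (_ + _)%N.
by rewrite (bigD1 i)//= eqxx big1// => j /negbTE->.
Qed.

Lemma mi_fact_pred i b : (0 < b i)%N -> mi_fact b = (b i * mi_fact (mi_pred i b))%N.
Proof.
move=> bi; rewrite /mi_fact (bigD1 i)//= [in RHS](bigD1 i)//= ffunE eqxx subn1.
rewrite mulnA -[in LHS](prednK bi) factS prednK//; congr (_ * _)%N.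
by apply: eq_bigr => j /negbTE ji; rewrite ffunE ji subn0.
Qed.

(* The coefficients of P, the derivation extending B^T, in the basis of
   unnormalized Hermite polynomials. *)
Definition hermite_der (B : 'M[R]_n) (g : {ffun 'I_n -> nat} -> R) b : R :=
  \sum_l \sum_k B l k * (b k)%:R * g (mi_succ l (mi_pred k b)).

(** Leibniz rule for one more letter i, matching the recursion of [tensor_der] on words. *)
Lemma hermite_der_succ B g i b :
  hermite_der B g (mi_succ i b) =
  \sum_l B l i * g (mi_succ l b) + hermite_der B (g \o mi_succ i) b.
Proof.
rewrite /hermite_der -big_split/=; apply: eq_bigr => l _.
rewrite (bigD1 i)//= [in RHS](bigD1 i)//= !ffunE eqxx addn1 -nat1r mi_succK.
rewrite addrA; congr (_ + _).
  rewrite mulrDr mulr1 mulrDl; congr (_ + _).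
  have [->|bi] := posnP (b i); first by rewrite mulr0 !mul0r.
  by rewrite mi_succC mi_predK.
apply: eq_bigr => k /negbTE ki; rewrite ffunE ki addn0.
have [->|bk] := posnP (b k); first by rewrite mulr0 !mul0r.
by rewrite mi_succ_pred// mi_succC.
Qed.

Lemma tensor_der_count m (B : 'M[R]_n) g s : size s = m ->
  tensor_der m B^T (g \o mi_count) s = hermite_der B g (mi_count s).
Proof.
elim: m g s => [|m IHm] g [|i s] //= sm.
  rewrite /hermite_der big1// => l _; rewrite big1// => k _.
  by rewrite ffunE mulr0 mul0r.
case: sm => sm; rewrite mi_count_cons hermite_der_succ; congr (_ + _).
  by apply: eq_bigr => j _; rewrite mxE mi_count_cons.
rewrite -IHm//; congr tensor_der.
by apply/funext => r /=; rewrite mi_count_cons.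
Qed.

(** The multinomial coefficient in division-free form, by induction on the first letter: words with
    counts b beginning with i correspond to words with counts [mi_pred i b]. *)
Lemma wsum_count m b : \sum_j b j = m ->
  wsum m (fun s => (mi_count s == b)%:R : R) * (mi_fact b)%:R = m`!%:R.
Proof.
elim: m b => [|m IHm] b bm /=.
  have b0 j : b j = 0%N.
    by apply/eqP; rewrite -leqn0 -bm (bigD1 j)//= leq_addr.
  have -> : mi_count [::] == b by apply/eqP/ffunP => j; rewrite ffunE b0.
  by rewrite /mi_fact big1 ?mulr1// => j _; rewrite b0.
rewrite mulr_suml.
transitivity (\sum_i (b i)%:R * m`!%:R : R); last first.
  by rewrite -mulr_suml -natr_sum bm factS natrM.
apply: eq_bigr => i _; have [bi|bi] := posnP (b i).
  rewrite bi mul0r (_ : wsum _ _ = 0) ?mul0r//.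
  apply: wsum0 => s; rewrite mi_count_cons; case: eqP => // /ffunP/(_ i).
  by rewrite !ffunE eqxx addn1 bi.
rewrite (mi_fact_pred bi) natrM mulrCA -(IHm _ (mi_pred_size bi bm)).
congr (_ * (_ * _)); apply: eq_wsum => s; rewrite mi_count_cons.
congr (nat_of_bool _)%:R; apply/eqP/eqP => [<-|->]; last exact: mi_predK.
by rewrite mi_succK.
Qed.

Definition mi_of_ord K (c : {ffun 'I_n -> 'I_K}) : {ffun 'I_n -> nat} :=
  [ffun j => nat_of_ord (c j)].

(** Compares the two norms in degree m: squared Hermite coefficients weighted by 1 / b! sum to the
    word norm, up to the common factor m!. Entries bounded by K make the index type finite and lose
    nothing as m <= K. *)
Lemma wsum_multi_index m K (f : {ffun 'I_n -> nat} -> R) : (m <= K)%N ->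
  \sum_(c : {ffun 'I_n -> 'I_K.+1} | (\sum_j mi_of_ord c j)%N == m)
    f (mi_of_ord c) / (mi_fact (mi_of_ord c))%:R =
  wsum m (f \o mi_count) / m`!%:R.
Proof.
move=> mK.
have cntm s : size s = m -> \sum_j mi_count s j = m.
  elim: s m {mK} => [|i s IHs] m /=; first by move=> <-; rewrite big1// => j _; rewrite ffunE.
  case: m => // m [sm]; rewrite mi_count_cons; under eq_bigr do rewrite ffunE.
  rewrite big_split/= (IHs _ sm) (bigD1 i)//= eqxx big1 => [|j /negbTE->//].
  exact: addn1.
have fE s : size s = m -> f (mi_count s) =
    \sum_(c : {ffun 'I_n -> 'I_K.+1} | (\sum_j mi_of_ord c j)%N == m)
      f (mi_of_ord c) * (mi_count s == mi_of_ord c)%:R.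
  move=> sm; pose c0 : {ffun 'I_n -> 'I_K.+1} := [ffun j => inord (mi_count s j)].
  have c0E : mi_of_ord c0 = mi_count s.
    apply/ffunP => j; rewrite !ffunE inordK// ltnS (leq_trans _ mK)// -sm.
    exact: count_size.
  rewrite (bigD1 c0)/=; last by rewrite c0E cntm.
  rewrite c0E eqxx mulr1 big1 ?addr0// => c /andP[_ cc0].
  case: eqP => [E|]; last by rewrite mulr0.
  case/eqP: cc0; apply/ffunP => j; apply: val_inj => /=.
  by have := congr1 (fun b : {ffun 'I_n -> nat} => b j) E; rewrite -c0E !ffunE.
have -> : wsum m (f \o mi_count) =
    \sum_(c : {ffun 'I_n -> 'I_K.+1} | (\sum_j mi_of_ord c j)%N == m)
      f (mi_of_ord c) * wsum m (fun s => (mi_count s == mi_of_ord c)%:R).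
  rewrite (wsum_size fE) big_mkcond/=.
  (* [wsum_sum] exchanges sums indexed by ordinals, hence the enumeration. *)
  transitivity (wsum m (fun s => \sum_(i < #|{ffun 'I_n -> 'I_K.+1}|)
     (if (\sum_j mi_of_ord (enum_val i) j)%N == m then
       f (mi_of_ord (enum_val i)) * (mi_count s == mi_of_ord (enum_val i))%:R else 0))).
    apply: eq_wsum => s; rewrite big_mkcond/= (reindex (@enum_val _ predT))//=.
    exact/onW_bij/enum_val_bij.
  rewrite wsum_sum [RHS](reindex (@enum_val _ predT))/=; last exact/onW_bij/enum_val_bij.
  apply: eq_bigr => i _; case: ifP => _; first by rewrite wsumZ.
  by rewrite wsum0// => s.
rewrite mulr_suml; apply: eq_bigr => c /eqP cm.
have fn : (m`!%:R : R) != 0 by rewrite pnatr_eq0 -lt0n fact_gt0.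
have fc : ((mi_fact (mi_of_ord c))%:R : R) != 0.
  by rewrite pnatr_eq0 -lt0n prodn_gt0// => j; exact: fact_gt0.
move: fn; rewrite -(wsum_count cm) mulf_eq0 negb_or => /andP[W0 _].
by rewrite invfM [RHS]mulrA mulfK.
Qed.

End multi_indices.

(** * Measurability on column vectors *)

Section measurability.
Context {R : realType} {n : nat}.

Lemma measurable_fun_mulmx m (M : 'M[R]_(m, n)) k :
  measurable_fun [set: 'cV[R]_n] (fun x => (M *m x) k ord0).
Proof.
under eq_fun do rewrite mxE.
apply: measurable_sum => i; apply: measurable_funM => //.
exact: measurable_fun_coord.
Qed.

Lemma measurable_fun_dotv (M : 'M[R]_n) :
  measurable_fun [set: 'cV[R]_n] (fun x => dotv (M *m x) x).
Proof.
apply: measurable_sum => i; apply: measurable_funM => //.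
  exact: measurable_fun_mulmx.
exact: measurable_fun_coord.
Qed.

Lemma measurable_gauss_density (S : 'M[R]_n) :
  measurable_fun [set: 'cV[R]_n] (gauss_density S).
Proof.
apply: measurable_funM => //; apply: measurableT_comp => //.
apply: measurableT_comp => //.
by apply: measurable_funM => //; exact: measurable_fun_dotv.
Qed.

Lemma gauss_density_ge0 (S : 'M[R]_n) x : 0 <= gauss_density S x.
Proof. by rewrite mulr_ge0 ?expR_ge0// invr_ge0 mulr_ge0 ?powR_ge0 ?sqrtr_ge0. Qed.

Lemma measurable_cV_box (a b : 'cV[R]_n) :
  measurable [set x : 'cV[R]_n | forall i, a i ord0 <= x i ord0 <= b i ord0].
Proof.
rewrite (_ : mkset _ = \bigcap_(i in [set: 'I_n])
    ((fun x : 'cV[R]_n => x i ord0) @^-1` `[a i ord0, b i ord0]%classic)).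
  apply: fin_bigcap_measurable => // i _.
  rewrite -[X in measurable X]setTI.
  exact: measurable_fun_coord.
apply/seteqP; split => x /= H i; first by move=> _; rewrite /= in_itv/=; exact: H.
by have := H i I; rewrite /= in_itv.
Qed.

End measurability.

(** * Positive definiteness of the covariance, from the density *)

Section gauss_density_positive.
Context {R : realType} {n : nat} (mu : probability 'cV[R]_n R) (S : 'M[R]_n).
Hypothesis mu_density : has_density mu (gauss_density S).
Implicit Types x : 'cV[R]_n.

Let c : R := ((2 * pi) `^ (n%:R / 2) * Num.sqrt (\det S))^-1.

(** The square root of a nonpositive determinant is 0, and so is the inverse of 0; the density would
    then vanish, against total mass 1. *)
Lemma gauss_density_cst_gt0 : 0 < c.
Proof.
have c0 : 0 <= c by rewrite invr_ge0 mulr_ge0 ?powR_ge0 ?sqrtr_ge0.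
rewrite lt0r c0 andbT; apply/eqP => cE.
have := mu_density measurableT; rewrite probability_setT.
under eq_integral => x _ do rewrite /gauss_density -/c cE mul0r.
rewrite integral0 => /eqP; rewrite eqe oner_eq0//.
Qed.

Lemma gauss_density_unit : S \in unitmx.
Proof.
rewrite unitmxE unitfE; apply/eqP => S0.
by have := gauss_density_cst_gt0; rewrite /c S0 sqrtr0 mulr0 invr0 ltxx.
Qed.

Hypothesis S_sym : S^T = S.

(* If the form took a negative value at x0, the density would exceed 2 on the
   unit cube centered at t x0 for t large. *)
Lemma gauss_density_psd x : 0 <= dotv (invmx S *m x) x.
Proof.
set N := invmx S; rewrite leNgt; apply/negP => q0.
set q := dotv (N *m x) x in q0.
have c0 := gauss_density_cst_gt0.
pose a : R := \sum_i `|(N *m x) i ord0|.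
pose b : R := \sum_i \sum_j `|N i j|.
have a0 : 0 <= a by exact: sumr_ge0.
have b0 : 0 <= b by apply: sumr_ge0 => ? _; exact: sumr_ge0.
(* On the cube, a controls the cross term and b the quadratic term of the form; this t makes the
   exponent at least 2 / c, and c expR (2 / c) >= c + 2. *)
pose t : R := 1 + (2 * a + b + 4 / c) / - q.
have cV : 0 < 4 / c by rewrite divr_gt0.
have t1 : 1 <= t.
  by rewrite lerDl divr_ge0 ?oppr_ge0 ?(ltW q0)// addr_ge0 ?(ltW cV)// addr_ge0 ?mulr_ge0.
have tq : 4 / c <= - (t ^+ 2 * q + 2 * t * a + b).
  have : 2 * a + b + 4 / c <= t * - q.
    rewrite /t [leRHS]mulrDl mul1r divfK ?oppr_eq0 ?lt_eqF// lerDr oppr_ge0; exact: ltW.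
  move=> H; have := ler_wpM2l (le_trans ler01 t1) H.
  have : 4 / c <= t * (4 / c) by rewrite ler_peMl// ltW.
  have : b <= t * b by rewrite ler_peMl.
  move: (4 / c) => V; lra.
pose lo : 'cV[R]_n := \col_i (t * x i ord0 - 1 / 2).
pose hi : 'cV[R]_n := \col_i (t * x i ord0 + 1 / 2).
pose box := [set y : 'cV[R]_n | forall i, lo i ord0 <= y i ord0 <= hi i ord0].
have box1 : lebesgue_cV n box = 1%E.
  rewrite lebesgue_cV_box; last by move=> i; rewrite !mxE; lra.
  rewrite big1// => i _; rewrite !mxE; lra.
have mbox : measurable box by exact: measurable_cV_box.
have rho2 y : box y -> 2 <= gauss_density S y.
  move=> By.
  have [w yE w1] : exists2 w, y = t *: x + w & forall i, `|w i ord0| <= 1 / 2.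
    exists (y - t *: x) => [|i]; first by rewrite addrC subrK.
    by have := By i; rewrite !mxE ler_norml => /andP[]; lra.
  have w1' i : `|w i ord0| <= 1 by apply: le_trans (w1 i) _; lra.
  have aw : `|dotv (N *m x) w| <= a.
    apply: le_trans (ler_norm_sum _ _ _) _; apply: ler_sum => i _.
    by rewrite normrM ler_piMr.
  have bw : `|dotv (N *m w) w| <= b.
    apply: le_trans (ler_norm_sum _ _ _) _; apply: ler_sum => i _.
    rewrite normrM mxE; apply: le_trans (_ : _ <= `|\sum_j N i j * w j ord0|) _.
      by rewrite ler_piMr.
    apply: le_trans (ler_norm_sum _ _ _) _; apply: ler_sum => j _.
    by rewrite normrM ler_piMr.
  have Nsym : N^T = N by rewrite /N trmx_inv S_sym.
  have E : dotv (N *m y) y = t ^+ 2 * q + 2 * t * dotv (N *m x) w + dotv (N *m w) w.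
    rewrite yE mulmxDr !(dotvDl, dotvDr) -scalemxAr !(dotvZl, dotvZr) -/q.
    by rewrite (dotv_trmx N w) Nsym (dotvC w); ring.
  have H : 2 / c <= - (2^-1 * dotv (N *m y) y).
    rewrite E.
    have ta : 2 * t * dotv (N *m x) w <= 2 * t * a.
      rewrite ler_wpM2l//; first by rewrite mulr_ge0// (le_trans ler01).
      exact: le_trans (ler_norm _) aw.
    have := le_trans (ler_norm _) bw; move: tq; lra.
  rewrite /gauss_density -/c -/N.
  apply: (@le_trans _ _ (c * (1 + 2 / c))).
    by rewrite mulrDr mulr1 mulrC mulfVK ?gt_eqF// lerDr ltW.
  rewrite ler_wpM2l ?(ltW c0)//.
  apply: le_trans (expR_ge1Dx _); rewrite lerD2l//.
have := probability_le1 mu mbox; rewrite (mu_density mbox) => H.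
have : (2%:E <= 1 :> \bar R)%E.
  apply: le_trans H; rewrite -[leLHS]mule1 -box1 -integral_cst//.
  apply: ge0_le_integral => //.
  - by move=> y _; rewrite lee_fin.
  - apply/measurable_EFinP; apply: measurable_funTS.
    exact: measurable_gauss_density.
by rewrite lee_fin => ?; lra.
Qed.

(** The form of S at x is that of [invmx S] at [S *m x], hence nonnegative; if it vanishes,
    Cauchy-Schwarz for [invmx S] gives <x, x>^2 <= 0. *)
Lemma gauss_density_pd : pdmx S.
Proof.
split => // x x0; have Su := gauss_density_unit.
have Nsym : (invmx S)^T = invmx S by rewrite trmx_inv S_sym.
have Npsd : psdmx (invmx S) by split => //; exact: gauss_density_psd.
have E : dotv (S *m x) x = dotv (invmx S *m (S *m x)) (S *m x).
  by rewrite mulKmx// dotvC.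
rewrite lt0r {2}E gauss_density_psd andbT; apply/eqP => Sx.
have := psd_CauchySchwarz (S *m x) x Npsd.
rewrite mulKmx// dotvC Sx mul0r => H.
have : dotv x x ^+ 2 = 0 by apply/eqP; rewrite eq_le H sqr_ge0.
by move=> /eqP; rewrite sqrf_eq0 dotvv_eq0 (negbTE x0).
Qed.

End gauss_density_positive.

(** * Real-valued integrals: linearity and dominated convergence *)

Section real_integrals.
Context d {T : measurableType d} {R : realType} (mu : {measure set T -> \bar R}).
Implicit Types (D : set T) (f g : T -> R).

Lemma le_integrableR D f g : measurable D -> measurable_fun D f ->
  (forall x, D x -> `|f x| <= g x) -> mu.-integrable D (EFin \o g) ->
  mu.-integrable D (EFin \o f).
Proof.
move=> mD mf fg ig; apply: le_integrable ig => //; first exact/measurable_EFinP.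
by move=> x Dx /=; rewrite lee_fin (le_trans (fg x Dx))// ler_norm.
Qed.

Lemma integrableRD D f g : measurable D -> mu.-integrable D (EFin \o f) ->
  mu.-integrable D (EFin \o g) -> mu.-integrable D (EFin \o (fun x => f x + g x)).
Proof.
move=> mD fi gi; have := integrableD mD fi gi; apply: eq_integrable => //.
Qed.

Lemma integrableRZ D f a : measurable D -> mu.-integrable D (EFin \o f) ->
  mu.-integrable D (EFin \o (fun x => a * f x)).
Proof.
move=> mD fi; have := integrableZl mD a fi; apply: eq_integrable => //.
Qed.

Lemma integrableR_sum D (I : Type) (r : seq I) (P : pred I) (f : I -> T -> R) :
  measurable D ->
  (forall i, P i -> mu.-integrable D (EFin \o f i)) ->
  mu.-integrable D (EFin \o (fun x => \sum_(i <- r | P i) f i x)).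
Proof.
move=> mD fi; elim: r => [|i r IHr].
  have := @integrable0 _ _ _ mu D; apply: eq_integrable => // x _ /=.
  by rewrite big_nil.
have [Pi|Pi] := boolP (P i).
  have := integrableRD mD (fi i Pi) IHr; apply: eq_integrable => // x _ /=.
  by rewrite big_cons Pi.
by apply: eq_integrable IHr => // x _ /=; rewrite big_cons (negbTE Pi).
Qed.

Lemma Rintegral_sum D (I : Type) (r : seq I) (P : pred I) (f : I -> T -> R) :
  measurable D ->
  (forall i, P i -> mu.-integrable D (EFin \o f i)) ->
  \int[mu]_(x in D) (\sum_(i <- r | P i) f i x) =
  \sum_(i <- r | P i) \int[mu]_(x in D) f i x.
Proof.
move=> mD fi; elim: r => [|i r IHr].
  under eq_Rintegral do rewrite big_nil.
  by rewrite big_nil Rintegral_cst// mul0r.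
rewrite big_cons; under eq_Rintegral do rewrite big_cons.
have [Pi|Pi] := boolP (P i); last by rewrite IHr.
by rewrite RintegralD ?IHr//; [exact: fi|exact: integrableR_sum].
Qed.

Lemma Rdominated_convergence D (f_ : nat -> T -> R) f g : measurable D ->
  (forall k, measurable_fun D (f_ k)) -> measurable_fun D f ->
  (forall x, D x -> f_ k x @[k --> \oo] --> f x) ->
  mu.-integrable D (EFin \o g) ->
  (forall k x, D x -> `|f_ k x| <= g x) ->
  \int[mu]_(x in D) f_ k x @[k --> \oo] --> \int[mu]_(x in D) f x.
Proof.
move=> mD mf_ mf f_f ig f_g.
have [||||fi _ cvgi] := @dominated_convergence _ _ _ mu D mD
  (fun k => EFin \o f_ k) (EFin \o f) (EFin \o g) _ _ _ ig.
- by move=> k; apply/measurable_EFinP; exact: mf_.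
- exact/measurable_EFinP.
- apply: aeW => x Dx; apply/fine_cvgP; split; first exact: nearW.
  exact: f_f.
- by apply: aeW => x k Dx /=; rewrite lee_fin f_g.
rewrite /Rintegral; apply: fine_cvg; rewrite fineK//.
exact: integrable_fin_num.
Qed.

Lemma cvg_Rintegral_sets D (D_ : nat -> set T) f : measurable D ->
  (forall k, measurable (D_ k)) -> (forall k, D_ k `<=` D) ->
  (forall x, D x -> \forall k \near \oo, D_ k x) ->
  mu.-integrable D (EFin \o f) ->
  \int[mu]_(x in D_ k) f x @[k --> \oo] --> \int[mu]_(x in D) f x.
Proof.
move=> mD mD_ D_D DD_ fi.
have mf : measurable_fun D f by apply/measurable_EFinP; exact: measurable_int fi.
have -> : (fun k => \int[mu]_(x in D_ k) f x) =
    (fun k => \int[mu]_(x in D) (f \_ (D_ k)) x).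
  by apply/funext => k; rewrite -Rintegral_mkcondr setIidr.
apply: (@Rdominated_convergence _ _ _ (fun x => `|f x|)) => //.
- move=> k; apply/measurable_restrict => //; apply: measurable_funS mf => //.
- move=> x Dx; apply: cvg_near_cst; apply: filterS (DD_ x Dx) => k D_x.
  by rewrite patchE mem_set.
- exact: integrable_norm.
by move=> k x Dx; rewrite patchE; case: ifP => // _; rewrite normr0.
Qed.

End real_integrals.

(** * Fundamental theorem of calculus and mean values *)

Section FTC.
Context {R : realType}.
Implicit Types (f F : R -> R) (a b : R).

Lemma Rintegral_FTC2 F f a b : a <= b ->
  (forall x, is_derive x (1 : R) F (f x)) -> continuous f ->
  \int[lebesgue_measure]_(x in `[a, b]) f x = F b - F a.
Proof.
move=> ab Ff cf.
have cF : continuous F by move=> x; exact: is_derive_cont (Ff x).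
move: ab; rewrite le_eqVlt => /predU1P[->|ab].
  by rewrite subrr set_itv1 Rintegral_set1.
rewrite /Rintegral (continuous_FTC2 ab (F := F))//=.
- exact: continuous_subspaceT.
- split; first by move=> x _; have [] := Ff x.
    exact/cvg_at_right_filter/cF.
  exact/cvg_at_left_filter/cF.
- by move=> x _; rewrite derive1E; have [] := Ff x.
Qed.

Lemma continuous_integrable f a b : continuous f ->
  lebesgue_measure.-integrable `[a, b] (EFin \o f).
Proof.
move=> cf; apply: continuous_compact_integrable; first exact: segment_compact.
exact: continuous_subspaceT.
Qed.

Lemma Rintegral_MVT f a b : a < b -> continuous f ->
  exists2 c, a <= c <= b &
    \int[lebesgue_measure]_(x in `[a, b]) f x = f c * (b - a).
Proof.
(* Starting at a - 1 puts the closed interval [a, b] inside the open interval where the primitive is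
   differentiable. *)
move=> ab cf; pose F x := \int[lebesgue_measure]_(t in `[a - 1, x]) f t.
have F' x : x \in `]a - 1, b + 1[ -> is_derive x (1 : R) F (f x).
  rewrite in_itv/= => /andP[ax xb].
  have [dF F'E] := continuous_FTC1_closed xb (continuous_integrable (a - 1) (b + 1) cf) ax (cf x).
  by apply: (@DeriveDef _ _ _ _ _ _ _ dF); rewrite -derive1E; exact: F'E.
have abI x : a <= x <= b -> x \in `]a - 1, b + 1[.
  by rewrite in_itv/=; lra.
have dF : forall x, x \in `]a, b[ -> is_derive x (1 : R) F (f x).
  by move=> x; rewrite in_itv/= => /andP[/ltW ? /ltW ?]; apply/F'/abI/andP.
have CF : {within `[a, b], continuous F}.
  apply/continuous_in_subspaceT => x; rewrite inE/= in_itv/= => xab.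
  exact: is_derive_cont (F' _ (abI _ xab)).
have [c] := MVT_segment (ltW ab) dF CF.
rewrite in_itv/= => cab FE; exists c => //; rewrite -FE /F.
rewrite (@Rintegral_itvB _ f (BLeft (a - 1)) (BRight b) a).
- rewrite Rintegral_itv_obnd_cbnd//.
  apply: integrableS (continuous_integrable a b cf) => //.
  by apply: subset_itv; rewrite bnd_simp.
- exact: continuous_integrable.
- by rewrite bnd_simp; lra.
by rewrite bnd_simp ltW.
Qed.

Lemma cvg_Rintegral_itv0y (f : R -> R) (T : nat -> R) :
  (forall x, \forall k \near \oo, x <= T k) ->
  lebesgue_measure.-integrable `[0%R, +oo[ (EFin \o f) ->
  \int[lebesgue_measure]_(x in `[0, T k]) f x @[k --> \oo] -->
  \int[lebesgue_measure]_(x in `[0, +oo[) f x.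
Proof.
move=> Toy fi.
have := cvg_Rintegral_sets _ _ _ _ fi.
apply.
- exact: measurable_itv.
- by move=> k; exact: measurable_itv.
- by move=> k x /=; rewrite !in_itv/= andbT => /andP[].
move=> x; rewrite /= in_itv/= andbT => x0; near=> k.
by rewrite /= in_itv/= x0/=; near: k; exact: Toy.
Unshelve. all: by end_near. Qed.

End FTC.

(** * Convergence of the covariance integral and the Lyapunov equation *)

Section lyapunov.
Context {R : realType} {n : nat} (Q B : 'M[R]_n).
Hypothesis Q_psd : psdmx Q.
Implicit Types (t s : R) (i j : 'I_n).

Definition cov_flow s : 'M[R]_n := expmx (s *: B) *m Q *m expmx (s *: B^T).

Lemma cov_flow_sym s : (cov_flow s)^T = cov_flow s.
Proof.
rewrite /cov_flow !trmx_mul -!expmx_tr !linearZ/= trmxK Q_psd.1.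
by rewrite mulmxA.
Qed.

Lemma covmx_sym (I : set R) : (covmx Q B I)^T = covmx Q B I.
Proof.
apply/matrixP => i j; rewrite !mxE; apply: eq_Rintegral => s _.
by rewrite -/(cov_flow s) -[in LHS]cov_flow_sym mxE.
Qed.

Lemma cov_flow_psd s : psdmx (cov_flow s).
Proof.
split; first exact: cov_flow_sym.
move=> x; rewrite /cov_flow -!mulmxA dotv_trmx -expmx_tr linearZ/=.
exact: Q_psd.2.
Qed.

(** Tests the form at e_i + e_j and e_i - e_j; integrability of [cov_flow] thereby reduces to its
    diagonal entries, which have a sign. *)
Lemma psd_coord_le (S : 'M[R]_n) i j : psdmx S -> `|S i j| <= S i i + S j j.
Proof.
move=> Spsd.
pose e k : 'cV[R]_n := delta_mx k ord0.
have E k l : dotv (S *m e k) (e l) = S l k.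
  rewrite /dotv (bigD1 l)//= -colE !mxE !eqxx mulr1 big1 ?addr0// => m /negbTE ml.
  by rewrite !mxE ml mulr0.
have Ssym : S j i = S i j by rewrite -[in LHS]Spsd.1 mxE.
have d0 k : 0 <= S k k by rewrite -E Spsd.2.
have H1 := Spsd.2 (e i + e j); have H2 := Spsd.2 (e i - e j).
move: H1 H2; rewrite mulmxBr mulmxDr !(dotvDl, dotvDr, dotvNl, dotvNr) !E Ssym.
by have := d0 i; have := d0 j; rewrite ler_norml; lra.
Qed.

Lemma is_derive_cov_flow t i j :
  is_derive t (1 : R) (fun s => cov_flow s i j)
    ((B *m cov_flow t + cov_flow t *m B^T) i j).
Proof.
have -> : (fun s => cov_flow s i j) = (fun s => \sum_k
    (\sum_l Q l k * expmx (s *: B) i l) * expmx (s *: B^T) k j).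
  apply/funext => s; rewrite mxE; apply: eq_bigr => k _; rewrite mxE.
  by congr (_ * _); apply: eq_bigr => l _; rewrite mulrC.
have -> : (B *m cov_flow t + cov_flow t *m B^T) i j = \sum_k
    ((\sum_l Q l k * (B *m expmx (t *: B)) i l) * expmx (t *: B^T) k j +
     (\sum_l Q l k * expmx (t *: B) i l) * (B^T *m expmx (t *: B^T)) k j).
  rewrite mxE big_split/=; congr (_ + _).
    rewrite /cov_flow !mulmxA mxE; apply: eq_bigr => k _; rewrite mxE.
    by congr (_ * _); apply: eq_bigr => l _; rewrite mulrC.
  rewrite /cov_flow -mulmxA -expmx_comm mxE; apply: eq_bigr => k _; rewrite mxE.
  by congr (_ * _); apply: eq_bigr => l _; rewrite mulrC.
pose df k u := (\sum_l Q l k * (B *m expmx (u *: B)) i l) * expmx (u *: B^T) k j +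
     (\sum_l Q l k * expmx (u *: B) i l) * (B^T *m expmx (u *: B^T)) k j.
apply: (@is_derive_sumf _ _ _ df) => k.
have D1 : is_derive t (1 : R) (fun u => \sum_l Q l k * expmx (u *: B) i l)
    (\sum_l Q l k * (B *m expmx (t *: B)) i l).
  apply: (@is_derive_sumf _ _ _ (fun l u => Q l k * (B *m expmx (u *: B)) i l)) => l.
  apply: is_derive_scalef; exact: is_derive_expmx.
exact: is_derive_mulf D1 (is_derive_expmx B^T t k j).
Qed.

Lemma continuous_cov_flow i j : continuous (fun s => cov_flow s i j).
Proof. by move=> t; exact: is_derive_cont (is_derive_cov_flow t i j). Qed.

Hypothesis S_pd : pdmx (Qoo Q B).

(* A diverging integral would leave the junk value 0 on the diagonal. *)
Lemma integrable_cov_flow i j :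
  lebesgue_measure.-integrable `[0%R, +oo[ (EFin \o (fun s => cov_flow s i j)).
Proof.
have mF k l : measurable_fun (`[0, +oo[%classic : set R) (fun s => cov_flow s k l).
  by apply: measurable_funTS; apply: continuous_measurable_fun; exact: continuous_cov_flow.
have d0 k s : 0 <= cov_flow s k k.
  by have := le_trans (normr_ge0 _) (psd_coord_le k k (cov_flow_psd s)); lra.
have diag k : lebesgue_measure.-integrable `[0%R, +oo[ (EFin \o (fun s => cov_flow s k k)).
  apply/integrableP; split; first by apply/measurable_EFinP; exact: mF.
  have Skk : 0 < Qoo Q B k k.
    have e0 : delta_mx k ord0 != 0 :> 'cV[R]_n.
      by apply/eqP => /matrixP/(_ k ord0)/eqP; rewrite !mxE !eqxx oner_eq0.
    have := S_pd.2 _ e0; rewrite /dotv (bigD1 k)//= -colE !mxE !eqxx mulr1 big1 ?addr0//.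
    by move=> l /negbTE lk; rewrite !mxE lk mulr0.
  rewrite ltey; apply/eqP => E.
  have {}E : (\int[lebesgue_measure]_(s in `[0%R, +oo[) (cov_flow s k k)%:E = +oo)%E.
    by rewrite -E; apply: eq_integral => s _; rewrite gee0_abs// lee_fin.
  by move: Skk; rewrite mxE /Rintegral E ltxx.
have ig : lebesgue_measure.-integrable `[0%R, +oo[
    (EFin \o (fun s => cov_flow s i i + cov_flow s j j)) by exact: integrableRD.
apply: le_integrableR ig => //.
  exact: mF.
by move=> s _; apply: psd_coord_le; exact: cov_flow_psd.
Qed.

(** Integrates F' = B F + F B^T over [0, T k], where F is [cov_flow] and F 0 = Q. Decay of F is
    established along a sequence T k going to infinity, from the integrability of F. *)
Lemma lyapunov_equation : B *m Qoo Q B + Qoo Q B *m B^T = - Q.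
Proof.
apply/matrixP => i j.
pose G s := (B *m cov_flow s + cov_flow s *m B^T) i j.
have GE : G = fun s => \sum_l B i l * cov_flow s l j + \sum_l B j l * cov_flow s i l.
  apply/funext => s; rewrite /G !mxE; congr (_ + _).
  by apply: eq_bigr => l _; rewrite !mxE mulrC.
have cG : continuous G.
  move=> t; rewrite GE; apply: cvgD.
    apply: cvg_big => [|l _]; first exact: add_continuous.
    by apply: cvgMl_tmp; exact: continuous_cov_flow.
  apply: cvg_big => [|l _]; first exact: add_continuous.
  by apply: cvgMl_tmp; exact: continuous_cov_flow.
have I1 : lebesgue_measure.-integrable `[0%R, +oo[
    (EFin \o (fun s => \sum_l B i l * cov_flow s l j)).
  apply: integrableR_sum => // l _; apply: integrableRZ => //.
  exact: integrable_cov_flow.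
have I2 : lebesgue_measure.-integrable `[0%R, +oo[
    (EFin \o (fun s => \sum_l B j l * cov_flow s i l)).
  apply: integrableR_sum => // l _; apply: integrableRZ => //.
  exact: integrable_cov_flow.
have iG : lebesgue_measure.-integrable `[0%R, +oo[ (EFin \o G).
  by rewrite GE; exact: integrableRD.
have intG : \int[lebesgue_measure]_(s in `[0, +oo[) G s =
    (B *m Qoo Q B + Qoo Q B *m B^T) i j.
  rewrite GE RintegralD// !Rintegral_sum//; last 2 first.
  - by move=> l _; apply: integrableRZ => //; exact: integrable_cov_flow.
  - by move=> l _; apply: integrableRZ => //; exact: integrable_cov_flow.
  rewrite !mxE; congr (_ + _); apply: eq_bigr => l _.
    by rewrite RintegralZl//; [rewrite mxE|exact: integrable_cov_flow].
  by rewrite RintegralZl//; [rewrite !mxE mulrC|exact: integrable_cov_flow].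
(* By the mean value theorem, F := cov_flow _ i j takes at some T_k in [k, k+1]
   the value J (k + 1) - J k, where J converges; so F (T_k) --> 0. *)
have Tex (k : nat) : exists T : R, k%:R <= T <= k.+1%:R /\
    \int[lebesgue_measure]_(s in `[k%:R, k.+1%:R]) cov_flow s i j = cov_flow T i j.
  have kk : k%:R < k.+1%:R :> R by rewrite ltr_nat.
  have [T kT ->] := Rintegral_MVT kk (@continuous_cov_flow i j).
  by exists T; split => //; rewrite -natrB// subSnn mulr1.
have [T TP] := choice Tex.
have T0 k : 0 <= T k by have [/andP[+ _] _] := TP k; apply: le_trans.
have Toy x : \forall k \near \oo, x <= T k.
  near=> k; have [/andP[+ _] _] := TP k; apply: le_trans.
  by near: k; exact: nbhs_infty_ger.
have FT0 : cov_flow (T k) i j @[k --> \oo] --> 0.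
  have -> : (fun k => cov_flow (T k) i j) = (fun k : nat =>
      \int[lebesgue_measure]_(s in `[0, k.+1%:R]) cov_flow s i j -
      \int[lebesgue_measure]_(s in `[0, k%:R]) cov_flow s i j).
    apply/funext => k; have [_ <-] := TP k.
    rewrite (@Rintegral_itvB _ _ (BLeft 0) (BRight k.+1%:R) k%:R).
    - rewrite Rintegral_itv_obnd_cbnd//.
      apply: integrableS (continuous_integrable k%:R k.+1%:R (@continuous_cov_flow i j)) => //.
      by apply: subset_itv; rewrite bnd_simp.
    - by apply: continuous_integrable; exact: continuous_cov_flow.
    - by rewrite bnd_simp.
    by rewrite bnd_simp ler_nat.
  set J := \int[lebesgue_measure]_(s in `[0, +oo[) cov_flow s i j.
  have Jk : \int[lebesgue_measure]_(s in `[0, k%:R]) cov_flow s i j @[k --> \oo] --> J.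
    apply: cvg_Rintegral_itv0y; last exact: integrable_cov_flow.
    by move=> x; exact: nbhs_infty_ger.
  rewrite -[X in _ --> X](subrr J); apply: cvgB => //.
  by move: Jk; rewrite -cvg_shiftS.
have L1 : \int[lebesgue_measure]_(s in `[0, T k]) G s @[k --> \oo] -->
    (B *m Qoo Q B + Qoo Q B *m B^T) i j.
  rewrite -intG.
  exact: cvg_Rintegral_itv0y.
have L2 : \int[lebesgue_measure]_(s in `[0, T k]) G s @[k --> \oo] --> - Q i j.
  have -> : (fun k => \int[lebesgue_measure]_(s in `[0, T k]) G s) =
      (fun k => cov_flow (T k) i j - Q i j).
    apply/funext => k.
    rewrite (Rintegral_FTC2 (T0 k) (fun t => is_derive_cov_flow t i j) cG).
    congr (_ - _); rewrite /cov_flow !scale0r !expmx0 mul1mx.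
    by rewrite mulmx1.
  rewrite -[X in _ --> X]add0r; apply: cvgB => //; exact: cvg_cst.
rewrite [RHS]mxE; exact: cvg_unique L1 L2.
Unshelve. all: by end_near. Qed.

End lyapunov.

(** * Fubini and vanishing integrals of derivatives on R^n *)

Section lebesgue_cV_fubini.
Context {R : realType}.
Implicit Types (n : nat) (e t : R).

Lemma measurable_cons_cVR n :
  measurable_fun [set: measurableTypeR R * 'cV[R]_n] (@cons_cV R n).
Proof. exact: measurable_cons_cV. Qed.

Lemma integrable_lebesgue_cVS n (f : 'cV[R]_n.+1 -> R) :
  measurable_fun setT f ->
  (lebesgue_measure \x lebesgue_cV n)%E.-integrable setT
    (EFin \o (f \o @cons_cV R n)) ->
  (lebesgue_cV n.+1).-integrable setT (EFin \o f).
Proof.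
move=> mf fi.
have mfE : measurable_fun setT (EFin \o f) by exact/measurable_EFinP.
pose m := [the measure _ _ of (@lebesgue_measure R \x lebesgue_cV n)%E].
exact: (@integrable_pushforward _ _ _ _ _ _ (@measurable_cons_cVR n)
  m setT (EFin \o f) mfE fi measurableT).
Qed.

Lemma integral_lebesgue_cVS n (f : 'cV[R]_n.+1 -> R) :
  measurable_fun setT f ->
  (lebesgue_measure \x lebesgue_cV n)%E.-integrable setT
    (EFin \o (f \o @cons_cV R n)) ->
  (\int[lebesgue_cV n.+1]_x (f x)%:E =
   \int[lebesgue_measure \x lebesgue_cV n]_z (f (cons_cV z))%:E)%E.
Proof.
move=> mf fi.
have mfE : measurable_fun setT (EFin \o f) by exact/measurable_EFinP.
pose m := [the measure _ _ of (@lebesgue_measure R \x lebesgue_cV n)%E].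
exact: (@integral_pushforward _ _ _ _ _ _ (@measurable_cons_cVR n)
  m setT (EFin \o f) mfE fi measurableT).
Qed.

Lemma dotv_cons_cV n t (x : 'cV[R]_n) :
  dotv (cons_cV (t, x)) (cons_cV (t, x)) = t ^+ 2 + dotv x x.
Proof.
rewrite /dotv big_ord_recl /cons_cV !mxE unlift_none /= expr2; congr (_ + _).
by apply: eq_bigr => i _; rewrite !mxE liftK.
Qed.

Definition gaussian n e (x : 'cV[R]_n) : R := expR (- (e * dotv x x)).

Lemma measurable_gaussian n e : measurable_fun setT (@gaussian n e).
Proof.
apply: measurableT_comp => //; apply: measurableT_comp => //.
apply: measurable_funM => //.
have := measurable_fun_dotv (1%:M : 'M[R]_n).
by under eq_fun do rewrite mul1mx.
Qed.

Lemma gaussian_cons n e t (x : 'cV[R]_n) :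
  gaussian e (cons_cV (t, x)) = expR (- (e * t ^+ 2)) * gaussian e x.
Proof. by rewrite /gaussian dotv_cons_cV mulrDr opprD expRD. Qed.

(** A multiple of the normal density of variance 1 / (2 e). *)
Lemma integrable_gaussian1 e : 0 < e ->
  lebesgue_measure.-integrable setT (EFin \o (fun t : R => expR (- (e * t ^+ 2)))).
Proof.
move=> e0; pose s : R := Num.sqrt (2 * e)^-1.
have e2 : 0 < (2 * e)^-1 by rewrite invr_gt0 mulr_gt0.
have s0 : s != 0 by rewrite gt_eqF// sqrtr_gt0.
have s2 : s ^+ 2 = (2 * e)^-1 by rewrite sqr_sqrtr// ltW.
have pk := normal_peak_gt0 s0.
have := integrableZl measurableT (normal_peak s)^-1 (integrable_normal_pdf 0 s).
apply: eq_integrable => // t _; rewrite /normal_pdf (negbTE s0) /normal_fun /=.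
rewrite -EFinM mulKf ?gt_eqF// subr0 s2; congr (expR _)%:E.
by rewrite -mulr_natl; field; rewrite gt_eqF.
Qed.

Lemma integrable_gaussian_cons n e : 0 < e ->
  (lebesgue_cV n).-integrable setT (EFin \o @gaussian n e) ->
  (lebesgue_measure \x lebesgue_cV n)%E.-integrable setT
    (EFin \o (@gaussian n.+1 e \o @cons_cV R n)).
Proof.
move=> e0 ig; apply/integrable12ltyP.
  apply/measurable_EFinP; apply: measurableT_comp; first exact: measurable_gaussian.
  exact: measurable_cons_cVR.
set c := (\int[lebesgue_cV n]_y `|(gaussian e y)%:E|)%E.
have cfin : c \is a fin_num.
  rewrite ge0_fin_numE; last by apply: integral_ge0 => *; exact: abse_ge0.
  by move/integrableP : ig => [].
have -> : (\int[lebesgue_measure]_x \int[lebesgue_cV n]_y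
    `|(EFin \o (@gaussian n.+1 e \o @cons_cV R n)) (x, y)|)%E =
    (\int[lebesgue_measure]_x ((fine c)%:E * `|(expR (- (e * x ^+ 2)))%:E|))%E.
  apply: eq_integral => t _; rewrite fineK//.
  under eq_integral => x _ do rewrite /= gaussian_cons normrM EFinM.
  rewrite ge0_integralZl//; first by rewrite muleC.
  by apply/measurable_EFinP; apply: measurableT_comp => //; exact: measurable_gaussian.
have [mg gi] := integrableP _ _ _ (integrable_gaussian1 e0).
rewrite ge0_integralZl//; last 2 first.
- by apply: measurableT_comp.
- by rewrite lee_fin fine_ge0// integral_ge0.
by rewrite lte_mul_pinfty// ?lee_fin ?fine_ge0 ?integral_ge0.
Qed.

Lemma integrable_gaussian n e : 0 < e ->
  (lebesgue_cV n).-integrable setT (EFin \o @gaussian n e).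
Proof.
move=> e0; elim: n => [|n IHn].
  apply/integrableP; split.
    by apply/measurable_EFinP; exact: measurable_gaussian.
  rewrite /= integral_dirac//=; last first.
    by apply/measurable_EFinP; apply: measurableT_comp => //; exact: measurable_gaussian.
  by rewrite diracT mul1e ltry.
apply: integrable_lebesgue_cVS; first exact: measurable_gaussian.
exact: integrable_gaussian_cons.
Qed.

Lemma le_gaussian_integrable n e C (f : 'cV[R]_n -> R) : 0 < e ->
  measurable_fun setT f -> (forall x, `|f x| <= C * gaussian e x) ->
  (lebesgue_cV n).-integrable setT (EFin \o f).
Proof.
move=> e0 mf fC; apply: (le_integrableR (g := fun x => C * gaussian e x)) => //.
by apply: integrableRZ => //; exact: integrable_gaussian.
Qed.

Lemma Rintegral0_integral0 d (T : measurableType d) (m : {measure set T -> \bar R})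
    (f : T -> R) :
  m.-integrable setT (EFin \o f) -> \int[m]_x f x = 0 ->
  (\int[m]_x (f x)%:E = 0)%E.
Proof.
move=> fi f0; rewrite -[LHS]fineK; last exact: integrable_fin_num.
by rewrite -[fine _]/(\int[m]_x f x) f0.
Qed.

(** The Lebesgue measure splits off its first coordinate only: the induction freezes it until
    direction i comes first, and then integrates along i on the inside. *)
Lemma Rintegral_slices0 n (i : 'I_n) e C (G : 'cV[R]_n -> R) : 0 < e ->
  measurable_fun setT G -> (forall x, `|G x| <= C * gaussian e x) ->
  (forall x : 'cV[R]_n, x i ord0 = 0 ->
    \int[@lebesgue_measure R]_t G (x + t *: delta_mx i ord0) = 0) ->
  \int[lebesgue_cV n]_x G x = 0.
Proof.
move=> e0; elim: n i C G => [|n IHn] i C G mG GC G0; first by case: i G0.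
have mGc : measurable_fun [set: measurableTypeR R * 'cV[R]_n] (G \o @cons_cV R n).
  by apply: measurableT_comp => //; exact: measurable_cons_cVR.
have iG : (lebesgue_measure \x lebesgue_cV n)%E.-integrable setT
    (EFin \o (G \o @cons_cV R n)).
  have := integrableRZ C measurableT (integrable_gaussian_cons e0 (integrable_gaussian n e0)).
  by apply: le_integrableR => // z _; exact: GC.
rewrite /Rintegral integral_lebesgue_cVS//.
have mGt t : measurable_fun setT (fun x => G (cons_cV (t, x))).
  exact: (measurableT_comp mGc (pair1_measurable t)).
have mGx x : measurable_fun setT (fun t => G (cons_cV (t, x))).
  exact: (measurableT_comp mGc (pair2_measurable x)).
have GCc t x : `|G (cons_cV (t, x))| <= C * expR (- (e * t ^+ 2)) * gaussian e x.
  by rewrite -mulrA -gaussian_cons.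
case: (unliftP ord0 i) => [j|] iE.
  rewrite -(integral12_prod_meas1 iG).
  rewrite integral0_eq// => t _ /=.
  apply: Rintegral0_integral0; first exact: le_gaussian_integrable (GCc t).
  apply: (IHn j _ _ (mGt t) (GCc t)) => x xj.
  rewrite -(G0 (cons_cV (t, x))); last by rewrite iE mxE liftK.
  apply: eq_Rintegral => s _; congr G; apply/colP => k; rewrite !mxE iE.
  by case: (unliftP ord0 k) => [l|] -> /=; rewrite ?mxE ?mulr0 ?addr0.
rewrite -(integral21_prod_meas1 iG).
rewrite integral0_eq// => x _ /=.
apply: Rintegral0_integral0.
  have := integrableRZ (C * gaussian e x) measurableT (integrable_gaussian1 e0).
  apply: le_integrableR => //; first exact: mGx.
  by move=> t _; rewrite mulrAC; exact: GCc.
rewrite -(G0 (cons_cV (0, x))); last by rewrite iE mxE unlift_none.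
apply: eq_Rintegral => t _; congr G; apply/colP => k; rewrite !mxE iE.
case: (unliftP ord0 k) => [l|] -> /=; first by rewrite mulr0 addr0.
by rewrite mulr1 add0r.
Qed.

Lemma Rintegral_derive_gaussian0 e C (F f : R -> R) : 0 < e ->
  (forall t, is_derive t (1 : R) F (f t)) -> continuous f ->
  (forall t, `|F t| <= C * expR (- (e * t ^+ 2))) ->
  (forall t, `|f t| <= C * expR (- (e * t ^+ 2))) ->
  \int[lebesgue_measure]_t f t = 0.
Proof.
move=> e0 Ff cf FC fC.
have fi : lebesgue_measure.-integrable setT (EFin \o f).
  have := integrableRZ C measurableT (integrable_gaussian1 e0).
  by apply: le_integrableR => //; exact: continuous_measurable_fun.
have L1 : \int[lebesgue_measure]_(t in `[- k%:R, k%:R]) f t @[k --> \oo] -->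
    \int[lebesgue_measure]_t f t.
  have := cvg_Rintegral_sets _ _ _ _ fi; apply => //.
  move=> x _; near=> k; rewrite /= in_itv/= -ler_norml.
  by near: k; exact: nbhs_infty_ger.
(* Both ends at once, b giving the sign; k <= k^2 replaces the Gaussian bound by a geometric
   sequence. *)
have Fk (b : bool) : F ((-1) ^+ b * k%:R) @[k --> \oo] --> 0.
  apply/norm_cvg0P; apply: (@squeeze_cvgr _ _ _ _ (cst 0) (fun k => C * expR (- e) ^+ k)).
  - apply: nearW => k; rewrite normr_ge0/=; apply: le_trans (FC _) _.
    have C0 : 0 <= C.
      by have := le_trans (normr_ge0 _) (FC 0); rewrite expr0n mulr0 oppr0 expR0 mulr1.
    rewrite ler_wpM2l// -expRM_natl ler_expR mulrN lerN2 [leLHS]mulrC ler_wpM2l ?(ltW e0)//.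
    rewrite exprMn sqrr_sign mul1r -natrX ler_nat.
    by case: k => // k; rewrite expnS expn1 leq_pmulr.
  - exact: cvg_cst.
  - rewrite -(mulr0 C); apply: cvgMl_tmp; apply: cvg_expr.
    by rewrite ger0_norm ?expR_ge0// expR_lt1 oppr_lt0.
have L2 : \int[lebesgue_measure]_(t in `[- k%:R, k%:R]) f t @[k --> \oo] --> 0.
  have -> : (fun k : nat => \int[lebesgue_measure]_(t in `[- k%:R, k%:R]) f t) =
      (fun k : nat => F ((-1) ^+ false * k%:R) - F ((-1) ^+ true * k%:R)).
    apply/funext => k; rewrite (Rintegral_FTC2 _ Ff cf) ?expr0 ?expr1 ?mul1r ?mulN1r//.
    by rewrite lerNl (le_trans (_ : _ <= 0))// oppr_le0.
  by rewrite -[X in _ --> X](subrr 0); apply: cvgB; exact: Fk.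
exact: cvg_unique L1 L2.
Unshelve. all: by end_near. Qed.

Lemma is_derive_line n (F : 'cV[R]_n -> R) (x v : 'cV[R]_n) t dF :
  is_derive (x + t *: v) v F dF ->
  is_derive t (1 : R) (fun s => F (x + s *: v)) dF.
Proof.
move=> [dv vE].
have E : (fun h : R => h^-1 *: ((F \o shift (x + t *: v)) (h *: v) - F (x + t *: v))) =
  (fun h : R => h^-1 *: (((fun s => F (x + s *: v)) \o shift t) (h *: (1 : R)) -
     F (x + t *: v))).
  apply/funext => h /=; congr (_ *: (F _ - _)).
  by rewrite [h *: 1]mulr1 scalerDl addrCA.
move: dv vE; rewrite /derivable /derive E => dv vE.
by apply: DeriveDef.
Qed.

(** Along each line in direction i the integrand is the derivative of a function vanishing at both
    ends; the bound on G serves Fubini, the one on F the boundary terms. *)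
Lemma Rintegral_partial0 n (i : 'I_n) e C (F G : 'cV[R]_n -> R) : 0 < e ->
  (forall x, is_derive x (delta_mx i ord0 : 'cV[R]_n) F (G x)) ->
  measurable_fun setT G ->
  (forall x, continuous (fun t : R => G (x + t *: delta_mx i ord0))) ->
  (forall x, `|F x| <= C * gaussian e x) ->
  (forall x, `|G x| <= C * gaussian e x) ->
  \int[lebesgue_cV n]_x G x = 0.
Proof.
move=> e0 FG mG cG FC GC.
apply: (Rintegral_slices0 (i := i) e0 mG GC) => x xi.
have C0 : 0 <= C.
  have := le_trans (normr_ge0 _) (FC 0).
  by rewrite /gaussian dotv0l mulr0 oppr0 expR0 mulr1.
have gle t : gaussian e (x + t *: delta_mx i ord0) <= expR (- (e * t ^+ 2)).
  rewrite ler_expR lerN2 ler_wpM2l ?(ltW e0)//.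
  apply: le_trans (coord_sqr_le _ i); rewrite !mxE xi !eqxx mulr1 add0r//.
apply: (Rintegral_derive_gaussian0 e0 (F := fun t => F (x + t *: delta_mx i ord0)) (C := C)).
- by move=> t; apply: is_derive_line; exact: FG.
- exact: cG.
- by move=> t; apply: le_trans (FC _) _; rewrite ler_wpM2l.
- by move=> t; apply: le_trans (GC _) _; rewrite ler_wpM2l.
Qed.

End lebesgue_cV_fubini.

(** * Integrals against mu as Lebesgue integrals *)

Section density.
Context {R : realType} {n : nat} (mu : probability 'cV[R]_n R) (S : 'M[R]_n).
Hypothesis mu_density : has_density mu (gauss_density S).
Implicit Types f : 'cV[R]_n -> R.

Let rho : 'cV[R]_n -> R := gauss_density S.

Lemma density_null_dominates : mu `<< lebesgue_cV n.
Proof.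
apply/null_content_dominatesP => A mA A0.
rewrite mu_density//; apply: null_set_integral => //.
by apply/measurable_EFinP; apply: measurable_funTS; exact: measurable_gauss_density.
Qed.

(** Identifies the density with the Radon-Nikodym derivative, so that the change of variables
    formula for the latter applies. *)
Lemma density_ae_eq : ae_eq (lebesgue_cV n) setT
  (Radon_Nikodym_SigmaFinite.f mu (lebesgue_cV n)) (EFin \o rho).
Proof.
apply: integral_ae_eq => //.
- exact/Radon_Nikodym_SigmaFinite.f_integrable/density_null_dominates.
- by apply/measurable_EFinP; exact: measurable_gauss_density.
move=> A _ mA; rewrite -Radon_Nikodym_SigmaFinite.f_integral//.
  exact: mu_density.
exact: density_null_dominates.
Qed.

Lemma ge0_integral_density (f : 'cV[R]_n -> \bar R) :
  (forall x, 0 <= f x)%E -> measurable_fun setT f ->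
  (\int[mu]_x f x = \int[lebesgue_cV n]_x (f x * (rho x)%:E))%E.
Proof.
move=> f0 mf.
have dom := density_null_dominates.
rewrite -(Radon_Nikodym_SigmaFinite.change_of_variables dom f0)//.
have mrn : measurable_fun setT (Radon_Nikodym_SigmaFinite.f mu (lebesgue_cV n)).
  exact: measurable_int (Radon_Nikodym_SigmaFinite.f_integrable dom).
have mr : measurable_fun setT (EFin \o rho).
  by apply/measurable_EFinP; exact: measurable_gauss_density.
apply: ge0_ae_eq_integral => //.
- exact: emeasurable_funM.
- exact: emeasurable_funM.
- by move=> x _; rewrite mule_ge0// Radon_Nikodym_SigmaFinite.f_ge0.
- by move=> x _; rewrite mule_ge0// lee_fin gauss_density_ge0.
- by apply: filterS density_ae_eq => x /= /(_ I) -> _.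
Qed.

Lemma integrable_density f : measurable_fun setT f ->
  mu.-integrable setT (EFin \o f) <->
  (lebesgue_cV n).-integrable setT (EFin \o (fun x => f x * rho x)).
Proof.
move=> mf.
have mfr : measurable_fun setT (fun x => f x * rho x).
  by apply: measurable_funM => //; exact: measurable_gauss_density.
have E : (\int[mu]_x `|(f x)%:E| =
    \int[lebesgue_cV n]_x `|(f x * rho x)%:E|)%E.
  rewrite ge0_integral_density//; last first.
    by apply: measurableT_comp => //; exact/measurable_EFinP.
  apply: eq_integral => x _.
  by rewrite /= normrM EFinM (ger0_norm (gauss_density_ge0 S x)).
split=> /integrableP[_ fi]; apply/integrableP; split; do ?exact/measurable_EFinP.
  by move: fi; rewrite -E.
by rewrite /= E.
Qed.

Lemma Rintegral_density f : measurable_fun setT f ->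
  mu.-integrable setT (EFin \o f) ->
  \int[mu]_x f x = \int[lebesgue_cV n]_x (f x * rho x).
Proof.
move=> mf fi; congr fine.
have mfp : measurable_fun setT (EFin \o f) by exact/measurable_EFinP.
have rho0 x : (0 <= (rho x)%:E)%E by rewrite lee_fin gauss_density_ge0.
rewrite integralE [in RHS]integralE.
rewrite !ge0_integral_density//; [|exact: measurable_funeneg|exact: measurable_funepos].
congr (_ - _)%E; apply: eq_integral => x _.
  rewrite !funeposE /= -!EFin_max -EFinM maxr_pMl ?mul0r//.
  exact: gauss_density_ge0.
rewrite !funenegE /= -!EFin_max -EFinM maxr_pMl ?mul0r ?mulNr//.
exact: gauss_density_ge0.
Qed.

End density.

Lemma exprn_fact_le_expR {R : realType} (x : R) N : 0 <= x ->
  x ^+ N / N`!%:R <= expR x.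
Proof.
move=> x0; case: N => [|N].
  rewrite expr0 fact0 divr1; apply: le_trans (expR_ge1Dx x); by rewrite lerDl.
by apply: le_trans (expR_ge1Dxn N x0); rewrite ler_wpDl.
Qed.

(** * Functions of polynomial growth *)

Section polynomial_growth.
Context {R : realType} {n : nat}.
Implicit Types (f g : 'cV[R]_n -> R) (x : 'cV[R]_n) (e : R).

(** Retains from polynomials only what domination of integrals needs, in a class stable under sums
    and products. *)
Definition pgrowth f := exists2 C : R, 0 <= C & exists N : nat,
  forall x, `|f x| <= C * (1 + dotv x x) ^+ N.

Let one_le x : 1 <= 1 + dotv x x.
Proof. by rewrite lerDl dotvv_ge0. Qed.

Lemma pgrowth_le f g : (forall x, `|f x| <= `|g x|) -> pgrowth g -> pgrowth f.
Proof.
move=> fg [C C0 [N gC]]; exists C => //; exists N => x.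
exact: le_trans (fg x) (gC x).
Qed.

Lemma pgrowth_cst a : pgrowth (fun=> a).
Proof. by exists `|a| => //; exists 0%N => x; rewrite expr0 mulr1. Qed.

Lemma pgrowthD f g : pgrowth f -> pgrowth g -> pgrowth (fun x => f x + g x).
Proof.
move=> [C C0 [N fC]] [D D0 [M gD]]; exists (C + D); first exact: addr_ge0.
exists (N + M)%N => x; apply: le_trans (ler_normD _ _) _; rewrite mulrDl.
have H (a b : nat) : (1 + dotv x x) ^+ a <= (1 + dotv x x) ^+ (a + b).
  by rewrite ler_weXn2l ?leq_addr.
apply: lerD.
  by apply: le_trans (fC x) _; rewrite ler_wpM2l.
by apply: le_trans (gD x) _; rewrite ler_wpM2l// addnC.
Qed.

Lemma pgrowthM f g : pgrowth f -> pgrowth g -> pgrowth (fun x => f x * g x).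
Proof.
move=> [C C0 [N fC]] [D D0 [M gD]]; exists (C * D); first exact: mulr_ge0.
exists (N + M)%N => x; rewrite normrM exprD mulrACA.
by apply: ler_pM => //.
Qed.

Lemma pgrowthZ a f : pgrowth f -> pgrowth (fun x => a * f x).
Proof. by apply: pgrowthM; exact: pgrowth_cst. Qed.

Lemma pgrowth_sum (I : Type) (r : seq I) (P : pred I) (F : I -> 'cV[R]_n -> R) :
  (forall i, P i -> pgrowth (F i)) -> pgrowth (fun x => \sum_(i <- r | P i) F i x).
Proof.
move=> FP; elim: r => [|i r IHr].
  by under eq_fun do rewrite big_nil; exact: pgrowth_cst.
have [Pi|/negbTE Pi] := boolP (P i).
  under eq_fun do rewrite big_cons Pi.
  by apply: pgrowthD => //; exact: FP.
by under eq_fun do rewrite big_cons Pi.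
Qed.

Lemma pgrowth_prod (I : Type) (r : seq I) (F : I -> 'cV[R]_n -> R) :
  (forall i, pgrowth (F i)) -> pgrowth (fun x => \prod_(i <- r) F i x).
Proof.
move=> FP; elim: r => [|i r IHr].
  by under eq_fun do rewrite big_nil; exact: pgrowth_cst.
by under eq_fun do rewrite big_cons; exact: pgrowthM.
Qed.

Lemma pgrowth_coord i : pgrowth (fun x => x i ord0).
Proof.
exists 1 => //; exists 1%N => x; rewrite mul1r expr1.
have := coord_sqr_le x i; have := sqr_ge0 (`|x i ord0| - 1).
by rewrite sqrrB1 real_normK ?num_real//; have := dotvv_ge0 x; lra.
Qed.

Lemma pgrowth_mulmx m (M : 'M[R]_(m, n)) k : pgrowth (fun x => (M *m x) k ord0).
Proof.
under eq_fun do rewrite mxE; apply: pgrowth_sum => j _.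
by apply: pgrowthZ; exact: pgrowth_coord.
Qed.

Lemma pgrowth_horner (p : {poly R}) f : pgrowth f -> pgrowth (fun x => p.[f x]).
Proof.
move=> fP; under eq_fun do rewrite horner_coef.
apply: pgrowth_sum => i _; apply: pgrowthZ.
elim: {i}(nat_of_ord i) => [|k IHk].
  by under eq_fun do rewrite expr0; exact: pgrowth_cst.
by under eq_fun do rewrite exprS; exact: pgrowthM.
Qed.

Lemma pgrowth_prodpoly (M : 'M[R]_n) p : pgrowth (prodpoly M p).
Proof.
by apply: pgrowth_prod => j; apply: pgrowth_horner; exact: pgrowth_mulmx.
Qed.

(** Half of the Gaussian absorbs the polynomial, by u^N / N! <= expR u at u = e (1 + <x, x>). *)
Lemma pgrowth_gaussian f e : 0 < e -> pgrowth f ->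
  exists2 C : R, 0 <= C & forall x, `|f x| * gaussian (e + e) x <= C * gaussian e x.
Proof.
move=> e0 [C C0 [N fC]].
exists (C * (N`!%:R / e ^+ N * expR e)).
  by rewrite !mulr_ge0 ?expR_ge0// invr_ge0 exprn_ge0// ltW.
move=> x; set r := dotv x x.
have r0 : 0 <= r by exact: dotvv_ge0.
have H : (1 + r) ^+ N <= N`!%:R / e ^+ N * expR (e * (1 + r)).
  have er : 0 <= e * (1 + r) by rewrite mulr_ge0 ?(ltW e0)// addr_ge0.
  have F0 : 0 < N`!%:R :> R by rewrite ltr0n fact_gt0.
  have eN : 0 < e ^+ N by rewrite exprn_gt0.
  have := exprn_fact_le_expR N er; rewrite exprMn => H.
  by rewrite mulrAC ler_pdivlMr// mulrC (mulrC _ (expR _)) -ler_pdivrMr.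
have -> : gaussian (e + e) x = expR (- (e * r)) * gaussian e x.
  by rewrite /gaussian -expRD -/r mulrDl opprD.
rewrite mulrA ler_wpM2r ?expR_ge0//.
apply: le_trans (ler_wpM2r (expR_ge0 _) (fC x)) _.
rewrite -(mulrA C) ler_wpM2l//; apply: le_trans (ler_wpM2r (expR_ge0 _) H) _.
by rewrite -(mulrA _ (expR _)) -expRD mulrDr mulr1 addrK.
Qed.

Context (mu : probability 'cV[R]_n R) (S : 'M[R]_n).
Hypothesis mu_density : has_density mu (gauss_density S).
Hypothesis S_pd : pdmx S.

Lemma gauss_density_le_gaussian : exists (e C : R), [/\ 0 < e, 0 <= C &
  forall x, gauss_density S x <= C * gaussian (e + e) x].
Proof.
have Su := pd_unit S_pd.
have Nsym : (invmx S)^T = invmx S by rewrite trmx_inv S_pd.1.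
have Npd : pdmx (invmx S).
  split => // x x0.
  have Nx0 : invmx S *m x != 0.
    by apply: contra_neq x0 => Nx; rewrite -[x](mulKVmx Su) Nx mulmx0.
  have := S_pd.2 _ Nx0; rewrite mulKVmx// dotvC; exact.
have [l l0 lP] := pd_coercive Npd.
(* The exponent is at least (l / 2) <x, x>, cut into two equal halves. *)
exists (l / 4), (((2 * pi) `^ (n%:R / 2) * Num.sqrt (\det S))^-1); split.
- by rewrite divr_gt0.
- by rewrite invr_ge0 mulr_ge0 ?powR_ge0 ?sqrtr_ge0.
move=> x; rewrite ler_wpM2l ?invr_ge0 ?mulr_ge0 ?powR_ge0 ?sqrtr_ge0//.
by rewrite ler_expR lerN2; have := lP x; lra.
Qed.

Lemma pgrowth_density_le f : pgrowth f -> exists (e C : R), [/\ 0 < e, 0 <= C &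
  forall x, `|f x * gauss_density S x| <= C * gaussian e x].
Proof.
move=> fP; have [e [C [e0 C0 rC]]] := gauss_density_le_gaussian.
have [D D0 fD] := pgrowth_gaussian e0 fP.
exists e, (C * D); split => //; first exact: mulr_ge0.
move=> x; rewrite normrM (ger0_norm (gauss_density_ge0 S x)).
apply: le_trans (ler_wpM2l (normr_ge0 _) (rC x)) _.
by rewrite mulrCA -mulrA ler_wpM2l.
Qed.

Lemma pgrowth_integrable f : measurable_fun setT f -> pgrowth f ->
  mu.-integrable setT (EFin \o f).
Proof.
move=> mf fP; apply/(integrable_density mu_density mf).
have [e [C [e0 C0 H]]] := pgrowth_density_le fP.
apply: le_gaussian_integrable H => //.
by apply: measurable_funM => //; exact: measurable_gauss_density.
Qed.

Lemma L2_pgrowth_integrable (v g : 'cV[R]_n -> R) : measurable_fun setT v ->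
  mu.-integrable setT (EFin \o (fun x => v x ^+ 2)) ->
  measurable_fun setT g -> pgrowth g ->
  mu.-integrable setT (EFin \o (fun x => v x * g x)).
Proof.
move=> mv vi mg gP.
have g2 : mu.-integrable setT (EFin \o (fun x => g x * g x)).
  apply: pgrowth_integrable; [exact: measurable_funM|exact: pgrowthM].
have := integrableRD measurableT vi g2.
apply: le_integrableR => //; first exact: measurable_funM.
move=> x _; rewrite -expr2 ler_norml.
have := sqr_ge0 (v x + g x); have := sqr_ge0 (v x - g x).
by have := sqr_ge0 (v x); have := sqr_ge0 (g x); nra.
Qed.

End polynomial_growth.

(** * Smoothness by recursion on the order *)

Section smooth_functions.
Context {R : realType} {n : nat}.
Implicit Types (f g : 'cV[R]_n -> R) (x v : 'cV[R]_n) (i : 'I_n).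

Lemma differentiable_mulmx m (M : 'M[R]_(m, n)) k x :
  differentiable (fun z : 'cV[R]_n => (M *m z) k ord0) x.
Proof.
rewrite (_ : (fun z => _) = \sum_j (M k j \*: (fun z : 'cV[R]_n => z j ord0))).
  apply: differentiable_sum => j; apply: differentiableZ.
  exact: differentiable_coord.
by apply/funext => z; rewrite mxE fct_sumE.
Qed.

Lemma is_derive_mulmx m (M : 'M[R]_(m, n)) k x v :
  is_derive x v (fun z : 'cV[R]_n => (M *m z) k ord0) ((M *m v) k ord0).
Proof.
set f := fun z => _.
have L : (fun h : R => h^-1 *: ((f \o shift x) (h *: v) - f x)) @ 0^' -->
    (M *m v) k ord0.
  apply: cvg_near_cst; near=> h.
  have h0 : h != 0 by near: h; exact: nbhs_dnbhs_neq.
  rewrite /f /= mulmxDr -scalemxAr [X in _ *: (X - _)]mxE addrK mxE.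
  by rewrite [_ *: _]mulrA mulVf// mul1r.
by apply: DeriveDef; [apply/cvg_ex; eexists; exact: L|exact: cvg_lim L].
Unshelve. all: by end_near. Qed.

Lemma is_derive_diff f x v : differentiable f x -> is_derive x v f ('D_v f x).
Proof. by move=> df; apply: DeriveDef => //; exact: diff_derivable. Qed.

Lemma is_deriveDf f g x v df dg : is_derive x v f df -> is_derive x v g dg ->
  is_derive x v (fun z => f z + g z) (df + dg).
Proof. exact: is_deriveD. Qed.

Lemma is_deriveMf f g x v df dg : is_derive x v f df -> is_derive x v g dg ->
  is_derive x v (fun z => f z * g z) (df * g x + f x * dg).
Proof.
move=> fd gd; apply: is_derive_eq (is_deriveM fd gd) _.
by rewrite addrC; congr (_ + _); exact: mulrC.
Qed.

Lemma is_derive_compf (h : R -> R) dh f x v df : differentiable f x ->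
  is_derive x v f df -> is_derive (f x) (1 : R) h dh ->
  is_derive x v (fun z => h (f z)) (dh * df).
Proof.
move=> fd [_ dfE] [hd hE].
have dh' : differentiable h (f x) by exact/derivable1_diffP.
apply: DeriveDef; first exact: diff_derivable (differentiable_comp fd dh').
rewrite deriveE; last exact: differentiable_comp.
rewrite diff_comp//= diff1E//= derive1E hE -deriveE// dfE.
by rewrite [LHS]mulrC.
Qed.

Lemma derive_sum_dir f x m (a : 'I_m -> R) (w : 'I_m -> 'cV[R]_n) :
  differentiable f x ->
  'D_(\sum_k a k *: w k) f x = \sum_k a k * 'D_(w k) f x.
Proof.
move=> df; rewrite deriveE// linear_sum; apply: eq_bigr => k _.
by rewrite linearZ deriveE.
Qed.

(** Finite-order smoothness, with the innermost derivative taken first, so that products and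
    compositions go by induction on N. *)
Fixpoint smoothn N f : Prop := (forall x, differentiable f x) /\
  if N is N'.+1 then forall i, smoothn N' (partial i f) else True.

Lemma smoothn_diff N f : smoothn N f -> forall x, differentiable f x.
Proof. by case: N => [[]|N []]. Qed.

Lemma smoothnW N f : smoothn N.+1 f -> smoothn N f.
Proof.
elim: N f => [|N IHN] f [df sf]; first by split.
by split => // i; exact: IHN.
Qed.

Lemma smoothn_smooth f : (forall N, smoothn N f) -> smooth_on setT f.
Proof.
move=> sf s x _; have := sf (size s).
elim/last_ind: s f {sf} => [|s i IHs] f /=; first by case.
rewrite size_rcons /= => -[_ /(_ i) si].
have -> : partials (rcons s i) f = partials s (partial i f).
  by rewrite /partials foldr_rcons.
exact: IHs.
Qed.

Lemma partialD i f g : (forall x, differentiable f x) ->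
  (forall x, differentiable g x) ->
  partial i (fun x => f x + g x) = fun x => partial i f x + partial i g x.
Proof.
move=> df dg; apply/funext => x.
have [_ E] := is_deriveDf (is_derive_diff (delta_mx i ord0) (df x))
  (is_derive_diff (delta_mx i ord0) (dg x)).
exact: E.
Qed.

Lemma partialM i f g : (forall x, differentiable f x) ->
  (forall x, differentiable g x) ->
  partial i (fun x => f x * g x) =
  fun x => partial i f x * g x + f x * partial i g x.
Proof.
move=> df dg; apply/funext => x.
have [_ E] := is_deriveMf (is_derive_diff (delta_mx i ord0) (df x))
  (is_derive_diff (delta_mx i ord0) (dg x)).
exact: E.
Qed.

Lemma smoothnD N f g : smoothn N f -> smoothn N g -> smoothn N (fun x => f x + g x).
Proof.
elim: N f g => [|N IHN] f g sf sg; split => //;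
  do ?[by move=> x; apply: differentiableD; [exact: smoothn_diff sf x|exact: smoothn_diff sg x]].
move=> i; rewrite partialD; [|exact: smoothn_diff sf|exact: smoothn_diff sg].
by apply: IHN; [exact: sf.2|exact: sg.2].
Qed.

Lemma smoothnM N f g : smoothn N f -> smoothn N g -> smoothn N (fun x => f x * g x).
Proof.
elim: N f g => [|N IHN] f g sf sg; split => //;
  do ?[by move=> x; apply: differentiableM; [exact: smoothn_diff sf x|exact: smoothn_diff sg x]].
move=> i; rewrite partialM; [|exact: smoothn_diff sf|exact: smoothn_diff sg].
by apply: smoothnD; apply: IHN; do ?exact: smoothnW; [exact: sf.2|exact: sg.2].
Qed.

Lemma smoothn_cst N (a : R) : smoothn N (fun=> a).
Proof.
elim: N a => [|N IHN] a; split => //; do ?[by move=> x; exact: differentiable_cst].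
move=> i; rewrite (_ : partial i _ = fun=> 0) //.
by apply/funext => x; exact: derive_cst.
Qed.

Lemma smoothn_sum N (I : Type) (r : seq I) (F : I -> 'cV[R]_n -> R) :
  (forall a, smoothn N (F a)) -> smoothn N (fun x => \sum_(a <- r) F a x).
Proof.
move=> sF; elim: r => [|a r IHr].
  by under eq_fun do rewrite big_nil; exact: smoothn_cst.
by under eq_fun do rewrite big_cons; exact: smoothnD.
Qed.

Lemma smoothn_prod N (I : Type) (r : seq I) (F : I -> 'cV[R]_n -> R) :
  (forall a, smoothn N (F a)) -> smoothn N (fun x => \prod_(a <- r) F a x).
Proof.
move=> sF; elim: r => [|a r IHr].
  by under eq_fun do rewrite big_nil; exact: smoothn_cst.
by under eq_fun do rewrite big_cons; exact: smoothnM.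
Qed.

Lemma smoothn_mulmx N m (M : 'M[R]_(m, n)) k :
  smoothn N (fun x => (M *m x) k ord0).
Proof.
case: N => [|N]; split => //; do ?[by move=> x; exact: differentiable_mulmx].
move=> i; rewrite (_ : partial i _ = fun=> (M *m (delta_mx i ord0 : 'cV[R]_n)) k ord0).
  exact: smoothn_cst.
by apply/funext => x; have [_ E] := is_derive_mulmx M k x (delta_mx i ord0); exact: E.
Qed.

(** h is a whole tower of derivatives, so that the induction can step from [h m] to [h m.+1]; it
    serves polynomials, the exponential and the bump. *)
Lemma smoothn_comp N (h : nat -> R -> R) m f :
  (forall k t, is_derive t (1 : R) (h k) (h k.+1 t)) ->
  smoothn N f -> smoothn N (fun x => h m (f x)).
Proof.
move=> hd; elim: N m f => [|N IHN] m f sf; split => //.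
- move=> x; apply: differentiable_comp; first exact: smoothn_diff sf x.
  by apply/derivable1_diffP; have [] := hd m (f x).
- move=> x; apply: differentiable_comp; first exact: smoothn_diff sf x.
  by apply/derivable1_diffP; have [] := hd m (f x).
move=> i; rewrite (_ : partial i _ = fun x => h m.+1 (f x) * partial i f x).
  by apply: smoothnM; [apply: IHN; exact: smoothnW|exact: sf.2].
apply/funext => x; have dfx := smoothn_diff sf x.
have [_ E] := is_derive_compf dfx (is_derive_diff (delta_mx i ord0) dfx) (hd m (f x)).
exact: E.
Qed.

Lemma smoothn_horner N (p : {poly R}) f : smoothn N f ->
  smoothn N (fun x => p.[f x]).
Proof.
by apply: (@smoothn_comp N (fun m => horner p^`(m)) 0).
Qed.

Lemma smoothn_expR N f : smoothn N f -> smoothn N (fun x => expR (f x)).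
Proof.
by apply: (@smoothn_comp N (fun=> expR) 0).
Qed.

End smooth_functions.

(** * A smooth function vanishing on the negative half-line *)

Section bump.
Context {R : realType}.
Implicit Types (r : {poly R}) (t : R).

(** The functions r(1/t) e^{-1/t}, extended by 0, are stable under differentiation, which replaces r
    by X^2 (r - r'). *)
Definition bump r t : R := if 0 < t then r.[t^-1] * expR (- t^-1) else 0.

Definition bump_deriv r : {poly R} := 'X^2 * (r - r^`()).

Lemma horner_le_power r (u : R) : 1 <= u ->
  `|r.[u]| <= (\sum_(i < size r) `|r`_i|) * u ^+ size r.
Proof.
move=> u1; rewrite horner_coef mulr_suml; apply: le_trans (ler_norm_sum _ _ _) _.
apply: ler_sum => i _; rewrite normrM normrX ler_wpM2l// ger0_norm ?(le_trans ler01)//.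
by rewrite ler_weXn2l// ltnW.
Qed.

(** Order t^2 at 0 is what gives derivative 0 there; with N = [size r], it follows from e^u >=
    u^{N+2} / (N+2)! at u = 1/t. *)
Lemma bump_bound r : exists2 C : R, 0 <= C &
  forall t, t <= 1 -> `|bump r t| <= C * t ^+ 2.
Proof.
pose N := size r; pose A : R := \sum_(i < N) `|r`_i|.
have A0 : 0 <= A by exact: sumr_ge0.
exists (A * (N + 2)`!%:R); first by rewrite mulr_ge0.
move=> t t1; rewrite /bump; case: ltP => [t0|_]; last first.
  by rewrite normr0 mulr_ge0 ?sqr_ge0// mulr_ge0.
have u1 : 1 <= t^-1 by rewrite invf_ge1.
have u0 : 0 < t^-1 by rewrite invr_gt0.
rewrite normrM [X in _ * X]ger0_norm ?expR_ge0//.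
apply: le_trans (ler_wpM2r (expR_ge0 _) (horner_le_power r u1)) _.
rewrite -/N -/A -!mulrA ler_wpM2l// expRN ler_pdivrMr ?expR_gt0//.
have F0 : 0 < (N + 2)`!%:R :> R by rewrite ltr0n fact_gt0.
have := exprn_fact_le_expR (N + 2) (ltW u0); rewrite ler_pdivrMr// => H.
have -> : t^-1 ^+ N = t^-1 ^+ (N + 2) * t ^+ 2.
  by rewrite exprD -mulrA [t^-1 ^+ 2]exprVn mulVf ?mulr1// expf_neq0 ?gt_eqF.
by rewrite [leRHS]mulrAC ler_wpM2r ?sqr_ge0// [leRHS]mulrC.
Qed.

Lemma is_derive_bump r t : is_derive t (1 : R) (bump r) (bump (bump_deriv r) t).
Proof.
have [t0|t0|<-] := ltgtP 0 t.
- have D1 : is_derive t (1 : R) (fun s => r.[s^-1] * expR (- s^-1))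
      (bump (bump_deriv r) t).
    have tn0 : t != 0 by rewrite gt_eqF.
    have dV : is_derive t (1 : R) (fun s => s^-1) (- t ^- 2).
      apply: is_derive_eq (@is_deriveV _ id t 1 1 tn0 (is_derive_id t 1)) _.
      by rewrite [_ *: _]mulr1.
    have dVn : is_derive t (1 : R) (fun s => - s^-1) (t ^- 2).
      by rewrite -[t ^- 2]opprK; exact: is_deriveN.
    have d1 := is_derive1_comp (is_derive_poly r t^-1) dV.
    have d2 := @is_derive1_comp _ expR (fun s => - s^-1) t _ _ (is_derive_expR (- t^-1)) dVn.
    apply: is_derive_eq (is_derive_mulf d1 d2) _.
    rewrite /bump t0 /bump_deriv hornerM hornerXn hornerD hornerN.
    rewrite /= exprVn; move: (t ^- 2) (expR _) (r.[_]) => a b c; ring.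
  apply: near_eq_is_derive D1.
  near=> s; rewrite /bump ifT//; near: s; exact: lt_nbhsr.
- have -> : bump (bump_deriv r) t = 0 by rewrite /bump ltNge (ltW t0).
  apply: (@near_eq_is_derive _ _ _ (cst 0)).
  near=> s; rewrite /bump ifF//; apply/negbTE; rewrite -leNgt ltW//.
  near: s; exact: lt_nbhsl.
have -> : bump (bump_deriv r) 0 = 0 by rewrite /bump ltxx.
have [C C0 rC] := bump_bound r.
have L : (fun h : R => h^-1 *: ((bump r \o shift 0) (h *: (1 : R)) - bump r 0)) @ 0^' --> (0 : R).
  apply/cvgrPdist_le => e e0; near=> h.
  have h0 : h != 0 by near: h; exact: nbhs_dnbhs_neq.
  have h1 : `|h| <= Num.min 1 (e / (C + 1)).
    near: h; apply: dnbhs0_le.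
    by rewrite lt_min ltr01 divr_gt0// ltr_wpDl.
  have b0 : bump r 0 = 0 by rewrite /bump ltxx.
  rewrite sub0r normrN /= b0 subr0 addr0 [h *: 1]mulr1.
  rewrite [_ *: _]mulrC normrM normfV ler_pdivrMr ?normr_gt0//.
  move: h1; rewrite le_min => /andP[h1 he].
  apply: le_trans (rC _ (le_trans (ler_norm h) h1)) _.
  rewrite -real_normK ?num_real// expr2 mulrA ler_wpM2r//.
  rewrite mulrC; apply: le_trans (ler_wpM2r C0 he) _.
  by rewrite mulrAC ler_pdivrMr ?ltr_wpDl// ler_wpM2l ?(ltW e0)// lerDl.
by apply: DeriveDef; [apply/cvg_ex; exists 0; exact: L|exact: cvg_lim L].
Unshelve. all: by end_near. Qed.

Definition bump_iter (m : nat) : R -> R := bump (iter m bump_deriv 1).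

Lemma is_derive_bump_iter m t : is_derive t (1 : R) (bump_iter m) (bump_iter m.+1 t).
Proof. exact: is_derive_bump. Qed.

Lemma bump_iter_bounded m : exists2 C : R, 0 <= C &
  forall t, t <= 1 -> `|bump_iter m t| <= C.
Proof.
have [C C0 bC] := bump_bound (iter m bump_deriv 1).
exists C => // t t1; have [t0|t0] := leP 0 t.
  by apply: le_trans (bC t t1) _; rewrite ler_piMr// exprn_ile1.
by rewrite /bump_iter /bump ltNge (ltW t0)/= normr0.
Qed.

Lemma bump_iter_le0 m t : t <= 0 -> bump_iter m t = 0.
Proof. by rewrite /bump_iter /bump ltNge => ->. Qed.

Lemma bump_iter0_1 : 0 < bump_iter 0 1.
Proof. by rewrite /bump_iter /bump ltr01 hornerC mul1r expR_gt0. Qed.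

Lemma continuous_bump_iter m : continuous (bump_iter m).
Proof. by move=> t; exact: is_derive_cont (is_derive_bump_iter m t). Qed.

End bump.

(** * Calculus in the coordinates y = S^{-1/2} x *)

Section gaussian_calculus.
Context {R : realType} {n : nat} (S : 'M[R]_n).
Hypothesis S_pd : pdmx S.
Implicit Types (f g : 'cV[R]_n -> R) (x : 'cV[R]_n) (i j k l : 'I_n).
Implicit Type p : 'I_n -> {poly R}.

Let W := sqrtmx S.
Let M := invmx W.

Lemma sqrtmx_sym : W^T = W.
Proof. by have [] := sqrtmxP (pd_psd S_pd). Qed.

Lemma sqrtmx_sqr : W *m W = S.
Proof. by have [] := sqrtmxP (pd_psd S_pd). Qed.

Lemma sqrtmx_unit : W \in unitmx.
Proof. by have := pd_unit S_pd; rewrite -[X in X \in _ -> _]sqrtmx_sqr unitmx_mul => /andP[]. Qed.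

Lemma invmx_sqrtmx_sym : M^T = M.
Proof. by rewrite /M trmx_inv sqrtmx_sym. Qed.

Lemma invmx_sqrtmx_sqr : M *m M = invmx S.
Proof.
have Wu := sqrtmx_unit.
apply: (can_inj (mulKmx (pd_unit S_pd))); rewrite mulmxV ?pd_unit//.
by rewrite -sqrtmx_sqr -mulmxA (mulmxA W M) mulmxV// mul1mx mulmxV.
Qed.

(** The derivative with respect to the coordinate y_k is the derivative in direction [col k W]; the
    calculus below uses these directions. *)
Definition ycoord k x : R := (M *m x) k ord0.

Lemma differentiable_ycoord k x : differentiable (ycoord k) x.
Proof. exact: differentiable_mulmx. Qed.

Lemma is_derive_ycoord k l x :
  is_derive x (col k W) (ycoord l) (l == k)%:R.
Proof.
have := is_derive_mulmx M l x (col k W).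
by rewrite {2}colE mulKmx ?sqrtmx_unit// mxE andbT.
Qed.

Definition ysqr x : R := \sum_k ycoord k x ^+ 2.

Lemma ysqrE x : ysqr x = dotv (invmx S *m x) x.
Proof.
rewrite -invmx_sqrtmx_sqr -mulmxA dotv_trmx invmx_sqrtmx_sym.
by apply: eq_bigr => k _; rewrite expr2.
Qed.

Lemma smoothn_ysqr N : smoothn N ysqr.
Proof.
apply: smoothn_sum => k; under eq_fun do rewrite expr2.
by apply: smoothnM; exact: smoothn_mulmx.
Qed.

Lemma is_derive_ysqr k x : is_derive x (col k W) ysqr (2 * ycoord k x).
Proof.
have E : ysqr = \sum_l (fun z => ycoord l z * ycoord l z).
  by apply/funext => z; rewrite fct_sumE; apply: eq_bigr => l _; rewrite expr2.
have -> : 2 * ycoord k x =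
    \sum_l ((l == k)%:R * ycoord l x + ycoord l x * (l == k)%:R).
  rewrite (bigD1 k)//= eqxx big1; last first.
    by move=> l /negbTE ->; rewrite mul0r mulr0 addr0.
  by rewrite mul1r mulr1 addr0 mulr2n mulrDl mul1r.
rewrite E; apply: is_derive_sum => l.
by apply: is_deriveMf; exact: is_derive_ycoord.
Qed.

Lemma smoothn_gauss_density N : smoothn N (gauss_density S).
Proof.
apply: smoothnM; first exact: smoothn_cst.
apply: smoothn_expR; rewrite (_ : (fun x => _) = fun x => - 2^-1 * ysqr x).
  by apply: smoothnM; [exact: smoothn_cst|exact: smoothn_ysqr].
by apply/funext => x; rewrite ysqrE mulNr.
Qed.

Lemma is_derive_gauss_density k x :
  is_derive x (col k W) (gauss_density S) (- ycoord k x * gauss_density S x).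
Proof.
pose c : R := ((2 * pi) `^ (n%:R / 2) * Num.sqrt (\det S))^-1.
have E : gauss_density S = fun z => c * expR (- 2^-1 * ysqr z).
  by apply/funext => z; rewrite /gauss_density ysqrE mulNr.
have D1 : is_derive x (col k W) (fun z => - 2^-1 * ysqr z) (- ycoord k x).
  have -> : - ycoord k x = 0 * ysqr x + - 2^-1 * (2 * ycoord k x) by field.
  exact: is_deriveMf (is_derive_cst _ _ _) (is_derive_ysqr k x).
have df1 : differentiable (fun z => - 2^-1 * ysqr z) x.
  by apply: (@smoothn_diff _ _ 0); apply: smoothnM; [exact: smoothn_cst|exact: smoothn_ysqr].
have D2 := is_derive_compf df1 D1 (is_derive_expR _).
rewrite E (_ : _ * (c * _) = 0 * expR (- 2^-1 * ysqr x) +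
  c * (expR (- 2^-1 * ysqr x) * - ycoord k x)); last by ring.
exact: is_deriveMf (is_derive_cst _ _ _) D2.
Qed.

Lemma smoothn_prodpoly N p : smoothn N (prodpoly M p).
Proof.
by apply: smoothn_prod => j; apply: smoothn_horner; exact: smoothn_mulmx.
Qed.

Lemma colW_sum k : col k W = \sum_i W i k *: (delta_mx i ord0 : 'cV[R]_n).
Proof.
apply/colP => i; rewrite summxE (bigD1 i)//= !mxE !eqxx mulr1 big1 ?addr0//.
by move=> j /negbTE ji; rewrite !mxE eq_sym ji mulr0.
Qed.

Lemma delta_sum i : (delta_mx i ord0 : 'cV[R]_n) = \sum_k M k i *: col k W.
Proof.
apply/colP => j; rewrite summxE.
transitivity ((W *m M) j i); first by rewrite mulmxV ?sqrtmx_unit// !mxE andbT.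
by rewrite mxE; apply: eq_bigr => k _; rewrite !mxE mulrC.
Qed.

Lemma is_derive_prodpoly k p x :
  is_derive x (col k W) (prodpoly M p) (prodpoly M (dprod p k) x).
Proof.
have dfx := smoothn_diff (smoothn_prodpoly 0 p) x.
apply: DeriveDef; first exact: diff_derivable.
rewrite colW_sum derive_sum_dir//.
have E i : 'D_(delta_mx i ord0 : 'cV[R]_n) (prodpoly M p) x =
    \sum_l M l i * prodpoly M (dprod p l) x.
  exact: (prodpoly_derive M p x i).2.
under eq_bigr do rewrite E mulr_sumr.
rewrite exchange_big/= (bigD1 k)//= [X in _ + X]big1 ?addr0.
  under eq_bigr do rewrite mulrA.
  rewrite -mulr_suml (_ : \sum_i _ = (M *m W) k k).
    by rewrite mulVmx ?sqrtmx_unit// mxE eqxx mul1r.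
  by rewrite mxE; apply: eq_bigr => i _; rewrite mulrC.
move=> l /negbTE lk; under eq_bigr do rewrite mulrA.
rewrite -mulr_suml (_ : \sum_i _ = (M *m W) l k).
  by rewrite mulVmx ?sqrtmx_unit// mxE lk mul0r.
by rewrite mxE; apply: eq_bigr => i _; rewrite mulrC.
Qed.

Lemma dprodC p k l : dprod (dprod p k) l = dprod (dprod p l) k.
Proof.
apply/funext => j; rewrite /dprod.
by case: (j == k); case: (j == l).
Qed.

Lemma partial_dir f (df : 'I_n -> 'cV[R]_n -> R) i :
  (forall x, differentiable f x) ->
  (forall l x, is_derive x (col l W) f (df l x)) ->
  partial i f = fun x => \sum_l M l i * df l x.
Proof.
move=> dff fdf; apply/funext => x; rewrite /partial delta_sum derive_sum_dir//.
by apply: eq_bigr => l _; have [_ ->] := fdf l x.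
Qed.

Context (Q B : 'M[R]_n).
Let Bh := M *m B *m W.

(** The formal transpose in the coordinates y, where Q becomes M Q M and B becomes [Bh]. The
    derivatives are parameters, to be supplied in closed form. *)
Lemma ou_transpose_dir f (df : 'I_n -> 'cV[R]_n -> R)
    (ddf : 'I_n -> 'I_n -> 'cV[R]_n -> R) x :
  (forall x, differentiable f x) -> (forall l x, differentiable (df l) x) ->
  (forall l x, is_derive x (col l W) f (df l x)) ->
  (forall k l x, is_derive x (col k W) (df l) (ddf k l x)) ->
  ou_transpose Q B f x =
  2^-1 * (\sum_k \sum_l (M *m Q *m M) k l * ddf k l x) -
  \sum_k \sum_l Bh k l * ((l == k)%:R * f x + ycoord l x * df k x).
Proof.
move=> dff ddff fdf dfd; rewrite /ou_transpose; congr (_ * _ - _).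
  have E i j : partial i (partial j f) x =
      \sum_k \sum_l M k i * M l j * ddf k l x.
    rewrite (partial_dir j dff fdf).
    have sE : (fun z => \sum_l M l j * df l z) = \sum_l (M l j \*: df l).
      by apply/funext => u; rewrite fct_sumE.
    have D0 z : differentiable (fun z => \sum_l M l j * df l z) z.
      by rewrite sE; apply: differentiable_sum => l; apply: differentiableZ.
    have D1 k z : is_derive z (col k W) (fun z => \sum_l M l j * df l z)
        (\sum_l M l j * ddf k l z).
      by rewrite sE; apply: is_derive_sum => l; exact: is_deriveZ.
    rewrite (partial_dir i D0 D1).
    by apply: eq_bigr => k _; rewrite mulr_sumr; apply: eq_bigr => l _; rewrite mulrA.
  under eq_bigr do under eq_bigr do rewrite E mulr_sumr.
  under eq_bigr do rewrite exchange_big/=.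
  rewrite exchange_big/=; apply: eq_bigr => k _.
  under eq_bigr do under eq_bigr do rewrite mulr_sumr.
  under eq_bigr do rewrite exchange_big/=.
  rewrite exchange_big/=; apply: eq_bigr => l _.
  rewrite mxE mulr_suml exchange_big/=; apply: eq_bigr => j _.
  rewrite mxE !mulr_suml; apply: eq_bigr => i _.
  by rewrite (_ : M l j = M j l); [ring|rewrite -[in LHS]invmx_sqrtmx_sym mxE].
have E i j : partial i (fun y : 'cV[R]_n => y j ord0 * f y) x =
    \sum_k \sum_l M k i * W j l * ((l == k)%:R * f x + ycoord l x * df k x).
  have xE (y : 'cV[R]_n) : y j ord0 = \sum_l W j l * ycoord l y.
    have : (W *m (M *m y)) j ord0 = y j ord0 by rewrite mulKVmx ?sqrtmx_unit.
    by rewrite mxE => <-.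
  have sE : (fun y : 'cV[R]_n => y j ord0 * f y) = \sum_l (W j l \*: (fun y => ycoord l y * f y)).
    apply/funext => y; rewrite fct_sumE xE mulr_suml.
    by apply: eq_bigr => l _; rewrite -mulrA.
  have D0 z : differentiable (fun y : 'cV[R]_n => y j ord0 * f y) z.
    by apply: differentiableM => //; exact: differentiable_coord.
  have D1 k z : is_derive z (col k W) (fun y : 'cV[R]_n => y j ord0 * f y)
      (\sum_l W j l * ((l == k)%:R * f z + ycoord l z * df k z)).
    rewrite sE; apply: is_derive_sum => l; apply: is_deriveZ.
    exact: is_deriveMf (is_derive_ycoord k l z) (fdf k z).
  rewrite (partial_dir i D0 D1).
  by apply: eq_bigr => k _; rewrite mulr_sumr; apply: eq_bigr => l _; rewrite mulrA.
transitivity (\sum_i \sum_j \sum_k \sum_l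
  B i j * (M k i * W j l * ((l == k)%:R * f x + ycoord l x * df k x))).
  apply: eq_bigr => i _; apply: eq_bigr => j _; rewrite E mulr_sumr.
  by apply: eq_bigr => k _; rewrite mulr_sumr.
under eq_bigr do rewrite exchange_big/=.
rewrite exchange_big/=; apply: eq_bigr => k _.
under eq_bigr do rewrite exchange_big/=.
rewrite exchange_big/=; apply: eq_bigr => l _.
rewrite mxE mulr_suml exchange_big/=; apply: eq_bigr => j _.
rewrite mxE !mulr_suml; apply: eq_bigr => i _; ring.
Qed.

Hypothesis lyapunov : B *m S + S *m B^T = - Q.

Lemma normalized_lyapunov : Bh + Bh^T = - (M *m Q *m M).
Proof.
have Wu := sqrtmx_unit.
have E1 : M *m (B *m S) *m M = Bh.
  by rewrite -sqrtmx_sqr /Bh !mulmxA mulmxK.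
have E2 : M *m (S *m B^T) *m M = Bh^T.
  rewrite /Bh !trmx_mul sqrtmx_sym invmx_sqrtmx_sym -sqrtmx_sqr.
  by rewrite !mulmxA mulVmx// mul1mx.
by rewrite -{1}E1 -E2 -mulmxDl -mulmxDr lyapunov mulmxN mulNmx.
Qed.

(* tP (rho phi) = rho sum_kl Bh_kl (y_k - D_k) D_l phi, where D_k is the
   derivative in the direction dual to the coordinate y_k: the adjoint of P in
   L^2(rho) is the second quantization of Bh. *)
Lemma ou_transpose_gauss (phi : 'cV[R]_n -> R) (dphi : 'I_n -> 'cV[R]_n -> R)
    (ddphi : 'I_n -> 'I_n -> 'cV[R]_n -> R) x :
  (forall x, differentiable phi x) -> (forall l x, differentiable (dphi l) x) ->
  (forall l x, is_derive x (col l W) phi (dphi l x)) ->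
  (forall k l x, is_derive x (col k W) (dphi l) (ddphi k l x)) ->
  (forall k l x, ddphi k l x = ddphi l k x) ->
  ou_transpose Q B (fun z => gauss_density S z * phi z) x =
  gauss_density S x *
    \sum_k \sum_l Bh k l * (ycoord k x * dphi l x - ddphi k l x).
Proof.
move=> dp ddp pd dpd sym; set rho := gauss_density S.
have drho z : differentiable rho z := smoothn_diff (smoothn_gauss_density 0) z.
pose df l z := rho z * (dphi l z + - (ycoord l z * phi z)).
pose ddf k l z := - ycoord k z * rho z * (dphi l z + - (ycoord l z * phi z)) +
  rho z * (ddphi k l z - ((l == k)%:R * phi z + ycoord l z * dphi k z)).
have D0 z : differentiable (fun z => rho z * phi z) z.
  by apply: differentiableM => //; exact: dp.
have D1 l z : differentiable (df l) z.
  apply: differentiableM => //; apply: differentiableB => //.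
  by apply: differentiableM => //; exact: differentiable_ycoord.
have D2 l z : is_derive z (col l W) (fun z => rho z * phi z) (df l z).
  rewrite /df (_ : _ * _ = - ycoord l z * rho z * phi z + rho z * dphi l z).
    exact: is_deriveMf (is_derive_gauss_density l z) (pd l z).
  by ring.
have D3 k l z : is_derive z (col k W) (df l) (ddf k l z).
  apply: is_deriveMf; first exact: is_derive_gauss_density.
  apply: is_deriveB.
  exact: is_deriveMf (is_derive_ycoord k l z) (pd k z).
rewrite (ou_transpose_dir x D0 D1 D2 D3).
(* As M Q M = - (Bh + Bh^T), the second order part applied to a symmetric F is a sum over [Bh] alone
   and merges with the drift. *)
have Esym (F : 'I_n -> 'I_n -> R) : (forall k l, F k l = F l k) ->
    2^-1 * (\sum_k \sum_l (M *m Q *m M) k l * F k l) =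
    - \sum_k \sum_l Bh k l * F k l.
  move=> Fs; have -> : M *m Q *m M = - (Bh + Bh^T).
    by rewrite normalized_lyapunov opprK.
  have -> : \sum_k \sum_l (- (Bh + Bh^T)) k l * F k l =
      - (\sum_k \sum_l Bh k l * F k l + \sum_k \sum_l Bh l k * F k l).
    rewrite -big_split/= -sumrN; apply: eq_bigr => k _.
    rewrite -big_split/= -sumrN; apply: eq_bigr => l _.
    have -> (X : 'M[R]_n) : (- (X + X^T)) k l = - (X k l + X l k) by rewrite !mxE.
    by ring.
  have -> : \sum_k \sum_l Bh l k * F k l = \sum_k \sum_l Bh k l * F k l.
    by rewrite exchange_big; apply: eq_bigr => k _; apply: eq_bigr => l _; rewrite Fs.
  by field.
rewrite Esym; last first.
  move=> k l; rewrite /ddf (sym l k) eq_sym.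
  have -> : (k == l)%:R * phi x = (l == k)%:R * phi x by rewrite eq_sym.
  by ring.
rewrite -opprD -big_split/= -sumrN mulr_sumr; apply: eq_bigr => k _.
rewrite -big_split/= -sumrN mulr_sumr; apply: eq_bigr => l _.
by rewrite /ddf /df /rho; ring.
Qed.

End gaussian_calculus.

(** * Compact boxes *)

Section compact_support.
Context {R : realType} {n : nat}.

Lemma continuous_trmx : continuous (trmx : 'rV[R]_n -> 'cV[R]_n).
Proof.
move=> v W [P LP sPW]; exists (fun i j => P j i).
  by move=> i j; have := LP j i; rewrite mxE.
by move=> w Pw; apply: sPW => i j; rewrite mxE; exact: Pw.
Qed.

Lemma compact_cV_box (b : R) :
  compact [set x : 'cV[R]_n | forall i, - b <= x i ord0 <= b].
Proof.
have -> : [set x : 'cV[R]_n | forall i, - b <= x i ord0 <= b] =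
    trmx @` [set v : 'rV[R]_n | forall i, `[- b, b]%classic (v ord0 i)].
  apply/seteqP; split => [x /= xb|_ /= [v vb <-] i].
    by exists x^T; [move=> i; rewrite mxE in_itv/=; exact: xb|rewrite trmxK].
  by rewrite mxE; have := vb i; rewrite in_itv.
apply: continuous_compact; first exact/continuous_subspaceT/continuous_trmx.
by apply: (@rV_compact R n (fun=> `[- b, b]%classic)) => i; exact: segment_compact.
Qed.

End compact_support.

(** * Limits under the integral with polynomial bounds *)

Section tame_convergence.
Context {R : realType} {n : nat}.
Implicit Types (F G : nat -> 'cV[R]_n -> R) (f g : 'cV[R]_n -> R).

(* Pointwise convergence with uniform polynomial bounds, as needed for dominated
   convergence against v rho with v in L^2. *)
Definition tame_cvg F f :=
  [/\ forall j, measurable_fun setT (F j), measurable_fun setT f,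
      exists2 C : R, 0 <= C & exists N : nat,
        forall j x, `|F j x| <= C * (1 + dotv x x) ^+ N &
      forall x, F j x @[j --> \oo] --> f x].

Let one_le (x : 'cV[R]_n) : 1 <= 1 + dotv x x.
Proof. by rewrite lerDl dotvv_ge0. Qed.

Lemma tame_cvg_cst f : measurable_fun setT f -> pgrowth f -> tame_cvg (fun=> f) f.
Proof.
move=> mf [C C0 [N fC]]; split => // [|x]; last exact: cvg_cst.
by exists C => //; exists N => j x.
Qed.

Lemma tame_cvgD F f G g : tame_cvg F f -> tame_cvg G g ->
  tame_cvg (fun j x => F j x + G j x) (fun x => f x + g x).
Proof.
move=> [mF mf [C C0 [N FC]] Ff] [mG mg [D D0 [K GD]] Gg]; split.
- by move=> j; exact: measurable_funD.
- exact: measurable_funD.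
- exists (C + D); first exact: addr_ge0.
  exists (N + K)%N => j x; apply: le_trans (ler_normD _ _) _; rewrite mulrDl.
  have H (a b : nat) : (1 + dotv x x) ^+ a <= (1 + dotv x x) ^+ (a + b).
    by rewrite ler_weXn2l ?leq_addr.
  apply: lerD.
    by apply: le_trans (FC j x) _; rewrite ler_wpM2l.
  by apply: le_trans (GD j x) _; rewrite ler_wpM2l// addnC.
- by move=> x; apply: cvgD; [exact: Ff|exact: Gg].
Qed.

Lemma tame_cvgM F f G g : tame_cvg F f -> tame_cvg G g ->
  tame_cvg (fun j x => F j x * G j x) (fun x => f x * g x).
Proof.
move=> [mF mf [C C0 [N FC]] Ff] [mG mg [D D0 [K GD]] Gg]; split.
- by move=> j; exact: measurable_funM.
- exact: measurable_funM.
- exists (C * D); first exact: mulr_ge0.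
  exists (N + K)%N => j x; rewrite normrM exprD mulrACA.
  by apply: ler_pM.
- by move=> x; apply: cvgM; [exact: Ff|exact: Gg].
Qed.

Lemma tame_cvg_sum (I : Type) (r : seq I) (F : I -> nat -> 'cV[R]_n -> R)
    (f : I -> 'cV[R]_n -> R) : (forall i, tame_cvg (F i) (f i)) ->
  tame_cvg (fun j x => \sum_(i <- r) F i j x) (fun x => \sum_(i <- r) f i x).
Proof.
move=> Ff; elim: r => [|i r IHr].
  have := @tame_cvg_cst (fun=> 0) (measurable_cst _) (pgrowth_cst 0).
  congr tame_cvg; last by apply/funext => x; rewrite big_nil.
  by apply/funext => j; apply/funext => x; rewrite big_nil.
have := tame_cvgD (Ff i) IHr; congr tame_cvg.
  by apply/funext => j; apply/funext => x; rewrite big_cons.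
by apply/funext => x; rewrite big_cons.
Qed.

Context (mu : probability 'cV[R]_n R) (S : 'M[R]_n).
Hypothesis mu_density : has_density mu (gauss_density S).
Hypothesis S_pd : pdmx S.

(** Dominated convergence with majorant |v| G rho, G being the common polynomial bound; the left
    side is the pairing of v with test functions. *)
Lemma tame_cvg_integral F f (v : 'cV[R]_n -> R) : tame_cvg F f ->
  measurable_fun setT v ->
  mu.-integrable setT (EFin \o (fun x => v x ^+ 2)) ->
  \int[lebesgue_cV n]_x (v x * (gauss_density S x * F j x)) @[j --> \oo] -->
  \int[mu]_x (v x * f x).
Proof.
move=> [mF mf [C C0 [N FC]] Ff] mv vi.
pose G (x : 'cV[R]_n) := C * (1 + dotv x x) ^+ N.
have mG : measurable_fun setT G.
  apply: measurable_funM => //; apply: measurable_funX; apply: measurable_funD => //.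
  have := measurable_fun_dotv (1%:M : 'M[R]_n).
  by under eq_fun do rewrite mul1mx.
have G0 x : 0 <= G x by rewrite mulr_ge0// exprn_ge0// (le_trans ler01).
have GP : pgrowth G by exists C => //; exists N => x; rewrite ger0_norm.
have fG x : `|f x| <= G x.
  have Fn : `|F j x| @[j --> \oo] --> `|f x| by apply: cvg_norm; exact: Ff.
  apply: (cvgr_to_le Fn); apply: nearW => j; exact: FC.
have fP : pgrowth f by apply: pgrowth_le GP => x; rewrite [leRHS]ger0_norm.
have ivf := L2_pgrowth_integrable mu_density S_pd mv vi mf fP.
have ivG := L2_pgrowth_integrable mu_density S_pd mv vi mG GP.
have mvf : measurable_fun setT (fun x => v x * f x) by exact: measurable_funM.
have mvG : measurable_fun setT (fun x => v x * G x) by exact: measurable_funM.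
rewrite (Rintegral_density mu_density mvf ivf).
have mr := @measurable_gauss_density R n S.
have := (integrable_density mu_density mvG).1 ivG.
move/(integrable_norm (mu := lebesgue_cV n)) => iG.
apply: (Rdominated_convergence _ _ _ _ iG) => //.
- move=> j; apply: measurable_funM => //; exact: measurable_funM.
- exact: measurable_funM.
- move=> x _; rewrite -mulrA (mulrC (f x)); apply: cvgMl_tmp.
  by apply: cvgMl_tmp; exact: Ff.
move=> j x _ /=; rewrite (normrM (v x * G x)) (normrM (v x) (G x)).
rewrite normrM (normrM (gauss_density S x)) -mulrA ler_wpM2l// mulrC ler_wpM2r//.
by rewrite [leRHS]ger0_norm.
Qed.

End tame_convergence.

(** * The weak equation tested against polynomials times the density *)

Section weak_formulation.
Context {R : realType} {n : nat} (S Q B : 'M[R]_n).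
Hypothesis S_pd : pdmx S.
Hypothesis lyapunov : B *m S + S *m B^T = - Q.
Implicit Types (x : 'cV[R]_n) (k l : 'I_n) (e : R).

Let W := sqrtmx S.
Let M := invmx W.
Let Bh := M *m B *m W.
Let y := ycoord S.

(** Vanishes unless e |y|^2 < 1. As e tends to 0 it tends to [bump_iter m 1], a constant; m counts
    the derivatives taken of the bump. *)
Definition cutoff e m x : R := bump_iter m (1 + - e * ysqr S x).

Lemma smoothn_cutoff_arg e N : smoothn N (fun x => 1 + - e * ysqr S x).
Proof.
apply: smoothnD; first exact: smoothn_cst.
by apply: smoothnM; [exact: smoothn_cst|exact: smoothn_ysqr].
Qed.

Lemma smoothn_cutoff e m N : smoothn N (cutoff e m).
Proof.
apply: (@smoothn_comp _ _ _ (@bump_iter R)); last exact: smoothn_cutoff_arg.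
by move=> k t; exact: is_derive_bump_iter.
Qed.

Lemma is_derive_cutoff e m k x :
  is_derive x (col k W) (cutoff e m) (cutoff e m.+1 x * (- e * (2 * y k x))).
Proof.
have da := smoothn_diff (smoothn_cutoff_arg e 0) x.
apply: (is_derive_compf da); last exact: is_derive_bump_iter.
have -> : - e * (2 * y k x) = 0 + (0 * ysqr S x + - e * (2 * y k x)).
  by rewrite mul0r !add0r.
apply: is_deriveDf (is_derive_cst _ _ _) _.
exact: is_deriveMf (is_derive_cst _ _ _) (is_derive_ysqr S_pd k x).
Qed.

Lemma ysqr_ge0 x : 0 <= ysqr S x.
Proof. by apply: sumr_ge0 => k _; exact: sqr_ge0. Qed.

Lemma ysqr_coercive : exists2 c : R, 0 < c & forall x, c * dotv x x <= ysqr S x.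
Proof.
have Wu := sqrtmx_unit S_pd.
have [c c0 cP] := mx_dotv_bound W.
exists c^-1; first by rewrite invr_gt0.
move=> x; rewrite mulrC ler_pdivrMr// mulrC.
have := cP (M *m x); by rewrite /M mulKVmx.
Qed.

Lemma test_function_cutoff e p : 0 < e -> test_function setT
  (fun x => gauss_density S x * (cutoff e 0 x * prodpoly M p x)).
Proof.
move=> e0; have [c c0 cP] := ysqr_coercive.
(* Where the cutoff is nonzero, <x, x> < 1 / (c e); the bound |x_i| <= 1 + x_i^2 avoids a square
   root. *)
pose b : R := 1 + (c * e)^-1.
exists [set x : 'cV[R]_n | forall i, - b <= x i ord0 <= b]; split => //.
  exact: compact_cV_box.
split.
  apply: smoothn_smooth => N; apply: smoothnM; first exact: smoothn_gauss_density.
  by apply: smoothnM; [exact: smoothn_cutoff|exact: smoothn_prodpoly].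
move=> x Kx; rewrite /cutoff bump_iter_le0 ?mul0r ?mulr0//.
rewrite leNgt; apply/negP => H; apply: Kx => i.
rewrite -ler_norml.
have H1 : dotv x x < (c * e)^-1.
  have : ysqr S x < e^-1 by rewrite -[ltRHS]mul1r ltr_pdivlMr// mulrC; lra.
  rewrite invfM mulrC ltr_pdivlMr// mulrC; apply: le_lt_trans; exact: cP.
have := coord_sqr_le x i; have := sqr_ge0 (`|x i ord0| - 1).
rewrite sqrrB1 real_normK ?num_real// /b.
by move: H1; have := normr_ge0 (x i ord0); have := dotvv_ge0 x; lra.
Qed.

Lemma measurable_ysqr : measurable_fun setT (ysqr S).
Proof.
apply: measurable_sum => k; apply: measurable_funX; exact: measurable_fun_mulmx.
Qed.

Lemma measurable_prodpoly p : measurable_fun setT (prodpoly M p).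
Proof.
apply: measurable_prod => k _; apply: measurableT_comp.
  by apply: continuous_measurable_fun; exact: continuous_horner.
exact: measurable_fun_mulmx.
Qed.

Let eps (j : nat) : R := j.+1%:R^-1.

Let eps0 j : 0 < eps j. Proof. by rewrite invr_gt0. Qed.

Let cvg_eps : eps j @[j --> \oo] --> 0.
Proof. exact: cvg_harmonic. Qed.

Lemma tame_cvg_eps : @tame_cvg R n (fun j _ => - eps j) (fun=> 0).
Proof.
split => //; last first.
  by move=> x; rewrite -[X in _ --> X]oppr0; apply: cvgN; exact: cvg_eps.
exists 1 => //; exists 0%N => j x; rewrite expr0 mul1r normrN.
by rewrite ger0_norm ?invr_ge0// invf_le1// ler1n.
Qed.

Lemma tame_cvg_cutoff m : tame_cvg (fun j => cutoff (eps j) m) (fun=> bump_iter m 1).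
Proof.
have [C C0 bC] := @bump_iter_bounded R m.
split => //.
- move=> j; apply: measurableT_comp.
    by apply: continuous_measurable_fun; exact: continuous_bump_iter.
  by apply: measurable_funD => //; apply: measurable_funM => //; exact: measurable_ysqr.
- exists C => //; exists 0%N => j x; rewrite expr0 mulr1; apply: bC.
  by rewrite mulNr gerBl mulr_ge0 ?ysqr_ge0// ltW.
- move=> x; apply: continuous_cvg; first exact: continuous_bump_iter.
  rewrite -[X in _ --> X](addr0 1); apply: cvgD; first exact: cvg_cst.
  rewrite -[X in _ --> X](mul0r (ysqr S x)); apply: cvgMr_tmp.
  by rewrite -[X in _ --> X]oppr0; apply: cvgN; exact: cvg_eps.
Qed.

Context (mu : probability 'cV[R]_n R).
Hypothesis mu_density : has_density mu (gauss_density S).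

(** Every derivative falling on the cutoff brings a factor e, so in the limit only the polynomial is
    differentiated. Both sides keep the limit value of the cutoff, the nonzero constant [bt], which
    cancels. *)
Lemma weak_adjoint (v w : 'cV[R]_n -> R) p :
  measurable_fun setT v -> mu.-integrable setT (EFin \o (fun x => v x ^+ 2)) ->
  measurable_fun setT w -> mu.-integrable setT (EFin \o (fun x => w x ^+ 2)) ->
  (forall f, test_function setT f ->
    \int[lebesgue_cV n]_x (v x * ou_transpose Q B f x) =
    \int[lebesgue_cV n]_x (w x * f x)) ->
  \int[mu]_x (w x * prodpoly M p x) =
  \int[mu]_x (v x * \sum_k \sum_l Bh k l * (y k x * prodpoly M (dprod p l) x -
    prodpoly M (dprod (dprod p l) k) x)).
Proof.
move=> mv vi mw wi vw.
pose g := prodpoly M p; pose g1 l := prodpoly M (dprod p l).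
pose g2 k l := prodpoly M (dprod (dprod p l) k).
pose c := cutoff.
pose ph e x := c e 0 x * g x.
pose dph e l x := c e 1%N x * (- e * (2 * y l x)) * g x + c e 0 x * g1 l x.
pose ddph e k l x :=
  ((c e 2%N x * (- e * (2 * y k x))) * (- e * (2 * y l x)) +
   c e 1%N x * (- e * (2 * (l == k)%:R))) * g x +
  c e 1%N x * (- e * (2 * y l x)) * g1 k x +
  (c e 1%N x * (- e * (2 * y k x)) * g1 l x + c e 0 x * g2 k l x).
have dg q x : differentiable (prodpoly M q) x := smoothn_diff (smoothn_prodpoly S 0 q) x.
have dc e m x : differentiable (c e m) x := smoothn_diff (smoothn_cutoff e m 0) x.
have dy l x : differentiable (y l) x := differentiable_ycoord S l x.
have dyl e l x : differentiable (fun z => - e * (2 * y l z)) x.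
  apply: differentiableM; first exact: differentiable_cst.
  by apply: differentiableM => //; exact: differentiable_cst.
have Dy e k l x : is_derive x (col k W) (fun z => - e * (2 * y l z))
    (- e * (2 * (l == k)%:R)).
  rewrite -[X in is_derive _ _ _ X]add0r -{1}(mul0r (2 * y l x)).
  apply: is_deriveMf (is_derive_cst _ _ _) _.
  rewrite -[X in is_derive _ _ _ X]add0r -{1}(mul0r (y l x)).
  exact: is_deriveMf (is_derive_cst _ _ _) (is_derive_ycoord S_pd k l x).
have dP e x : differentiable (ph e) x := differentiableM (dc e 0 x) (dg p x).
have ddP e l x : differentiable (dph e l) x := differentiableD
  (differentiableM (differentiableM (dc e 1%N x) (dyl e l x)) (dg p x))
  (differentiableM (dc e 0 x) (dg (dprod p l) x)).
have Pd e l x : is_derive x (col l W) (ph e) (dph e l x).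
  exact: is_deriveMf (is_derive_cutoff e 0 l x) (is_derive_prodpoly S_pd l p x).
have Pdd e k l x : is_derive x (col k W) (dph e l) (ddph e k l x).
  apply: is_deriveDf.
    apply: is_deriveMf; last exact: is_derive_prodpoly.
    exact: is_deriveMf (is_derive_cutoff e 1 k x) (Dy e k l x).
  exact: is_deriveMf (is_derive_cutoff e 0 k x) (is_derive_prodpoly S_pd k _ x).
have sym e k l x : ddph e k l x = ddph e l k x.
  by rewrite /ddph /g2 dprodC (eq_sym l k); ring.
have tPE e x := ou_transpose_gauss S_pd lyapunov x (dP e) (ddP e) (Pd e) (Pdd e) (sym e).
have my l : measurable_fun setT (y l) := measurable_fun_mulmx M l.
have py l : pgrowth (y l) := pgrowth_mulmx M l.
have Ty l : tame_cvg (fun=> y l) (y l) by exact: tame_cvg_cst.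
have Tg q : tame_cvg (fun=> prodpoly M q) (prodpoly M q).
  by apply: tame_cvg_cst; [exact: measurable_prodpoly|exact: pgrowth_prodpoly].
have T2 : @tame_cvg R n (fun _ _ => 2) (fun _ => 2).
  by apply: tame_cvg_cst => //; exact: pgrowth_cst.
have Te l : tame_cvg (fun j x => - eps j * (2 * y l x)) (fun x => 0 * (2 * y l x)).
  by apply: tame_cvgM tame_cvg_eps _; exact: tame_cvgM.
have Td k l : @tame_cvg R n (fun j x => - eps j * (2 * (l == k)%:R))
    (fun x => 0 * (2 * (l == k)%:R)).
  apply: tame_cvgM tame_cvg_eps _; apply: tame_cvg_cst => //; exact: pgrowth_cst.
have Tc m := tame_cvg_cutoff m.
pose bt : R := bump_iter 0 1.
have LP : tame_cvg (fun j => ph (eps j)) (fun x => bt * g x) := tame_cvgM (Tc 0) (Tg p).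
have LD l := tame_cvgD (tame_cvgM (tame_cvgM (Tc 1%N) (Te l)) (Tg p))
  (tame_cvgM (Tc 0) (Tg (dprod p l))).
have LDD k l := tame_cvgD (tame_cvgD
  (tame_cvgM (tame_cvgD (tame_cvgM (tame_cvgM (Tc 2%N) (Te k)) (Te l))
    (tame_cvgM (Tc 1%N) (Td k l))) (Tg p))
  (tame_cvgM (tame_cvgM (Tc 1%N) (Te l)) (Tg (dprod p k))))
  (tame_cvgD (tame_cvgM (tame_cvgM (Tc 1%N) (Te k)) (Tg (dprod p l)))
    (tame_cvgM (Tc 0) (Tg (dprod (dprod p l) k)))).
pose h x := \sum_k \sum_l Bh k l * (y k x * g1 l x - g2 k l x).
have Tcst a : @tame_cvg R n (fun _ _ => a) (fun _ => a).
  by apply: tame_cvg_cst => //; exact: pgrowth_cst.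
have LT : tame_cvg
    (fun j x => \sum_k \sum_l Bh k l * (y k x * dph (eps j) l x + -1 * ddph (eps j) k l x))
    (fun x => bt * h x).
  have := tame_cvg_sum (index_enum 'I_n) (fun k => tame_cvg_sum (index_enum 'I_n)
    (fun l => tame_cvgM (Tcst (Bh k l))
      (tame_cvgD (tame_cvgM (Ty k) (LD l)) (tame_cvgM (Tcst (-1)) (LDD k l))))).
  congr tame_cvg; apply/funext => x; rewrite /h mulr_sumr; apply: eq_bigr => k _.
  by rewrite mulr_sumr; apply: eq_bigr => l _; rewrite /g1 /g2 /bt; ring.
have L1 := tame_cvg_integral mu_density S_pd LT mv vi.
have L2 := tame_cvg_integral mu_density S_pd LP mw wi.
have E : (fun j => \int[lebesgue_cV n]_x (v x * (gauss_density S x *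
      \sum_k \sum_l Bh k l * (y k x * dph (eps j) l x + -1 * ddph (eps j) k l x)))) =
    (fun j => \int[lebesgue_cV n]_x (w x * (gauss_density S x * ph (eps j) x))).
  apply/funext => j; rewrite -vw; last exact: test_function_cutoff.
  apply: eq_Rintegral => x _; congr (_ * _); rewrite tPE; congr (_ * _).
  by apply: eq_bigr => k _; apply: eq_bigr => l _; rewrite mulN1r.
rewrite E in L1.
have := cvg_unique _ L1 L2 => // H.
have mh : measurable_fun setT h.
  apply: measurable_sum => k; apply: measurable_sum => l; apply: measurable_funM => //.
  apply: measurable_funB; last exact: measurable_prodpoly.
  by apply: measurable_funM => //; exact: measurable_prodpoly.
have ph' : pgrowth h.
  apply: pgrowth_sum => k _; apply: pgrowth_sum => l _; apply: pgrowthZ.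
  apply: pgrowthD; first by apply: pgrowthM => //; exact: pgrowth_prodpoly.
  have := pgrowthZ (-1) (pgrowth_prodpoly M (dprod (dprod p l) k)).
  by under eq_fun do rewrite mulN1r.
have bt0 : bt != 0 by rewrite gt_eqF// bump_iter0_1.
have ivh := L2_pgrowth_integrable mu_density S_pd mv vi mh ph'.
have iwg := L2_pgrowth_integrable mu_density S_pd mw wi (measurable_prodpoly p)
  (pgrowth_prodpoly M p).
have swap (f q : 'cV[R]_n -> R) :
    \int[mu]_x (f x * (bt * q x)) = \int[mu]_x (bt * (f x * q x)).
  by apply: eq_Rintegral => x _; rewrite mulrCA.
apply: (mulfI bt0); rewrite -!RintegralZl//.
by move: H; rewrite !swap => ->.
Qed.

End weak_formulation.

(** * Bessel's inequality *)

Section bessel.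
Context {d} {T : measurableType d} {R : realType} (mu : probability T R).

(** Expands the integral of (f - l)^2 >= 0 for the projection l; the h i are orthogonal without
    being normalized, hence the division by [c i]. *)
Lemma bessel (I : finType) (h : I -> T -> R) (c : I -> R) f :
  mu.-integrable setT (EFin \o (fun x => f x ^+ 2)) ->
  (forall i, mu.-integrable setT (EFin \o (fun x => f x * h i x))) ->
  (forall i j, mu.-integrable setT (EFin \o (fun x => h i x * h j x))) ->
  (forall i, 0 < c i) ->
  (forall i j, \int[mu]_x (h i x * h j x) = (i == j)%:R * c i) ->
  \sum_i (\int[mu]_x (f x * h i x)) ^+ 2 / c i <= \int[mu]_x (f x ^+ 2).
Proof.
move=> f2 fh hh c0 ch; pose a i := \int[mu]_x (f x * h i x) / c i.
pose l x := \sum_i a i * h i x.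
have E1 x : f x * l x = \sum_i a i * (f x * h i x).
  by rewrite mulr_sumr; apply: eq_bigr => i _; rewrite mulrCA.
have E2 x : l x ^+ 2 = \sum_i \sum_j a i * a j * (h i x * h j x).
  rewrite expr2 mulr_suml; apply: eq_bigr => i _; rewrite mulr_sumr.
  by apply: eq_bigr => j _; rewrite mulrACA.
have i1 i : mu.-integrable setT (EFin \o (fun x => a i * (f x * h i x))).
  exact: integrableRZ.
have i2 i j : mu.-integrable setT (EFin \o (fun x => a i * a j * (h i x * h j x))).
  exact: integrableRZ.
have ifl : mu.-integrable setT (EFin \o (fun x => f x * l x)).
  by under eq_fun do rewrite E1; exact: integrableR_sum.
have i2s i : mu.-integrable setT
    (EFin \o (fun x => \sum_j a i * a j * (h i x * h j x))).
  exact: integrableR_sum.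
have il2 : mu.-integrable setT (EFin \o (fun x => l x ^+ 2)).
  by under eq_fun do rewrite E2; exact: integrableR_sum.
have I1 : \int[mu]_x (f x * l x) = \sum_i (\int[mu]_x (f x * h i x)) ^+ 2 / c i.
  under eq_Rintegral do rewrite E1.
  rewrite Rintegral_sum//; apply: eq_bigr => i _.
  by rewrite RintegralZl// mulrC expr2 mulrA.
have I2 : \int[mu]_x (l x ^+ 2) = \sum_i (\int[mu]_x (f x * h i x)) ^+ 2 / c i.
  under eq_Rintegral do rewrite E2.
  rewrite Rintegral_sum//; apply: eq_bigr => i _.
  rewrite Rintegral_sum// (bigD1 i)//= big1 ?addr0 => [|j /negbTE ji].
    rewrite RintegralZl// ch eqxx mul1r /a; field; exact: lt0r_neq0.
  by rewrite RintegralZl// ch eq_sym ji mul0r mulr0.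
have i0 : mu.-integrable setT
    (EFin \o (fun x => f x ^+ 2 + (-2 * (f x * l x) + l x ^+ 2))).
  by apply: integrableRD => //; apply: integrableRD => //; exact: integrableRZ.
have : 0 <= \int[mu]_x (f x ^+ 2 + (-2 * (f x * l x) + l x ^+ 2)).
  apply: Rintegral_ge0 => x _.
  have := sqr_ge0 (f x - l x); congr (_ <= _); ring.
rewrite RintegralD//; last first.
  by apply: integrableRD => //; exact: integrableRZ.
rewrite RintegralD//; last exact: integrableRZ.
rewrite RintegralZl// I1 I2; lra.
Qed.

End bessel.

(** * Hermite polynomials: ladder relations and orthogonality *)

Section hermite_functions.
Context {R : realType} {n : nat} (S : 'M[R]_n).
Hypothesis S_pd : pdmx S.
Implicit Types (x : 'cV[R]_n) (k l : 'I_n) (b : {ffun 'I_n -> nat}).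

Let W := sqrtmx S.
Let M := invmx W.
Let y := ycoord S.

(** Left unnormalized, so that raising and lowering indices have integer coefficients. *)
Definition hermiteu b x : R := prodpoly M (fun j => @hermite_poly R (b j)) x.

Lemma prodpolyM p q x :
  prodpoly M (fun j => p j * q j) x = prodpoly M p x * prodpoly M q x.
Proof. by rewrite -big_split; apply: eq_bigr => j _; rewrite hornerM. Qed.

(** The Leibniz rule, read off from two computations of the same directional derivative. *)
Lemma prodpoly_dprodM p q k x : prodpoly M (dprod (fun j => p j * q j) k) x =
  prodpoly M (dprod p k) x * prodpoly M q x + prodpoly M p x * prodpoly M (dprod q k) x.
Proof.
have [_ <-] := is_derive_prodpoly S_pd k (fun j => p j * q j) x.
have E : prodpoly M (fun j => p j * q j) = fun z => prodpoly M p z * prodpoly M q z.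
  by apply/funext => z; exact: prodpolyM.
rewrite E.
have [_] := is_deriveMf (is_derive_prodpoly S_pd k p x) (is_derive_prodpoly S_pd k q x).
exact.
Qed.

Lemma dprod_hermiteu b l x :
  prodpoly M (dprod (fun j => @hermite_poly R (b j)) l) x =
  (b l)%:R * hermiteu (mi_pred l b) x.
Proof.
rewrite /hermiteu /prodpoly (bigD1 l)//= [in RHS](bigD1 l)//= /dprod eqxx ffunE eqxx.
rewrite mulrA; congr (_ * _); last first.
  by apply: eq_bigr => j /negbTE jl; rewrite jl ffunE jl subn0.
case: (b l) => [|m]; first by rewrite /= -polyC1 derivC horner0 mul0r.
by rewrite deriv_hermite_poly subn1 hornerMn mulr_natl.
Qed.

Lemma dprod2_hermiteu b k l x :
  prodpoly M (dprod (dprod (fun j => @hermite_poly R (b j)) l) k) x =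
  (b l)%:R * prodpoly M (dprod (fun j => @hermite_poly R (mi_pred l b j)) k) x.
Proof.
have [_ <-] := is_derive_prodpoly S_pd k (dprod (fun j => @hermite_poly R (b j)) l) x.
have E : prodpoly M (dprod (fun j => @hermite_poly R (b j)) l) =
    fun z => (b l)%:R * hermiteu (mi_pred l b) z.
  by apply/funext => z; exact: dprod_hermiteu.
rewrite E; have [_ ->] := is_deriveMf (is_derive_cst ((b l)%:R : R) x (col k W))
  (is_derive_prodpoly S_pd k (fun j => @hermite_poly R (mi_pred l b j)) x).
by rewrite mul0r add0r.
Qed.

Lemma hermiteu_succ b k x :
  hermiteu (mi_succ k b) x =
  y k x * hermiteu b x - prodpoly M (dprod (fun j => @hermite_poly R (b j)) k) x.
Proof.
rewrite /hermiteu /prodpoly (bigD1 k)//= [in X in _ = X - _](bigD1 k)//=.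
rewrite [in X in _ = _ - X](bigD1 k)//= /dprod eqxx ffunE eqxx addn1.
rewrite hermite_polyS hornerD hornerN hornerM hornerX mulrBl mulrA.
by congr (_ * _ - _ * _); apply: eq_bigr => j /negbTE jk; rewrite ?ffunE jk ?addn0.
Qed.

Context (mu : probability 'cV[R]_n R).
Hypothesis mu_density : has_density mu (gauss_density S).

Lemma prodpoly_integrable p : mu.-integrable setT (EFin \o prodpoly M p).
Proof.
apply: (pgrowth_integrable mu_density S_pd); first exact: measurable_prodpoly.
exact: pgrowth_prodpoly.
Qed.

Lemma L2_prodpoly_integrable (v : 'cV[R]_n -> R) p : measurable_fun setT v ->
  mu.-integrable setT (EFin \o (fun x => v x ^+ 2)) ->
  mu.-integrable setT (EFin \o (fun x => v x * prodpoly M p x)).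
Proof.
move=> mv vi; apply: (L2_pgrowth_integrable mu_density S_pd mv vi).
  exact: measurable_prodpoly.
exact: pgrowth_prodpoly.
Qed.

(** The function [q l] times rho is the derivative of g rho with respect to y_l. Integrals of
    derivatives vanish in the basis directions, and [q k] is recombined from these. *)
Lemma gauss_ibp p k :
  \int[mu]_x (y k x * prodpoly M p x) = \int[mu]_x prodpoly M (dprod p k) x.
Proof.
pose rho := gauss_density S; pose g := prodpoly M p.
pose q l x := prodpoly M (dprod p l) x - y l x * g x.
have drho x : differentiable rho x := smoothn_diff (smoothn_gauss_density S_pd 0) x.
have dg r x : differentiable (prodpoly M r) x := smoothn_diff (smoothn_prodpoly S 0 r) x.
have dy l x : differentiable (y l) x := differentiable_ycoord S l x.
have dq l x : differentiable (q l) x :=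
  differentiableB (dg (dprod p l) x) (differentiableM (dy l x) (dg p x)).
have dF x : differentiable (fun z => g z * rho z) x :=
  differentiableM (dg p x) (drho x).
have FD l x : is_derive x (col l W) (fun z => g z * rho z) (q l x * rho x).
  have -> : q l x * rho x =
      prodpoly M (dprod p l) x * rho x + g x * (- y l x * rho x).
    by rewrite /q; ring.
  exact: is_deriveMf (is_derive_prodpoly S_pd l p x) (is_derive_gauss_density S_pd l x).
have mq l : measurable_fun setT (q l).
  apply: measurable_funB; first exact: measurable_prodpoly.
  apply: measurable_funM; last exact: measurable_prodpoly.
  exact: measurable_fun_mulmx.
have gP r : pgrowth (prodpoly M r) := pgrowth_prodpoly M r.
have qP l : pgrowth (q l).
  apply: pgrowthD; first exact: gP.
  have := pgrowthZ (-1) (pgrowthM (pgrowth_mulmx M l) (gP p)).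
  by under eq_fun do rewrite mulN1r.
have mrho := measurable_gauss_density S.
have iq l := pgrowth_integrable mu_density S_pd (mq l) (qP l).
have iqr l := (integrable_density mu_density (mq l)).1 (iq l).
have G0 i : \int[lebesgue_cV n]_x (\sum_l M l i * (q l x * rho x)) = 0.
  pose r x := \sum_l M l i * q l x.
  have rE x : \sum_l M l i * (q l x * rho x) = r x * rho x.
    by rewrite mulr_suml; apply: eq_bigr => l _; rewrite mulrA.
  have rP : pgrowth r by apply: pgrowth_sum => l _; exact: pgrowthZ.
  have normP f : pgrowth f -> pgrowth (fun x => `|f x|).
    by apply: pgrowth_le => x; rewrite normr_id.
  (* [Rintegral_partial0] wants one Gaussian bound for a function and its derivative, hence the sum
     of absolute values. *)
  have [e [C [e0 C0 eC]]] :=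
    pgrowth_density_le S_pd (pgrowthD (normP _ (gP p)) (normP _ rP)).
  have dG x : differentiable (fun z => \sum_l M l i * (q l z * rho z)) x.
    under eq_fun do rewrite rE.
    apply: differentiableM => //.
    have -> : r = \sum_l (M l i \*: q l) by apply/funext => z; rewrite fct_sumE.
    by apply: differentiable_sum => l; exact: differentiableZ.
  apply: (@Rintegral_partial0 _ _ i e C (fun z => g z * rho z)) => //.
  - move=> x; have := is_derive_diff (delta_mx i ord0 : 'cV[R]_n) (dF x).
    by rewrite -/(partial i _ x) (partial_dir S_pd i dF FD).
  - by apply: measurable_sum => l; apply: measurable_funM => //; exact: measurable_funM.
  - move=> x t; apply: (@continuous_comp _ _ _
      (fun t : R => x + t *: (delta_mx i ord0 : 'cV[R]_n))
      (fun z => \sum_l M l i * (q l z * rho z))).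
      by apply: cvgD; [exact: cvg_cst|apply: cvgZr_tmp; exact: cvg_id].
    exact: differentiable_continuous (dG _).
  - move=> x; apply: le_trans (eC x); rewrite !normrM ler_wpM2r//.
    by rewrite [leRHS]ger0_norm ?addr_ge0// lerDl.
  - move=> x; rewrite rE; apply: le_trans (eC x); rewrite !normrM ler_wpM2r//.
    by rewrite [leRHS]ger0_norm ?addr_ge0// lerDr.
(* The inverse change of directions, by M W = 1. *)
have qE x : q k x * rho x = \sum_i W i k * \sum_l M l i * (q l x * rho x).
  under eq_bigr do rewrite mulr_sumr.
  rewrite exchange_big/= (bigD1 k)//= [X in _ + X]big1 ?addr0.
    under eq_bigr do rewrite mulrA.
    rewrite -mulr_suml (_ : \sum_i _ = (M *m W) k k).
      by rewrite mulVmx ?sqrtmx_unit// mxE eqxx mul1r.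
    by rewrite mxE; apply: eq_bigr => i _; rewrite mulrC.
  move=> l lk; under eq_bigr do rewrite mulrA.
  rewrite -mulr_suml (_ : \sum_i _ = (M *m W) l k).
    by rewrite mulVmx ?sqrtmx_unit// mxE (negbTE lk) mul0r.
  by rewrite mxE; apply: eq_bigr => i _; rewrite mulrC.
have q0 : \int[mu]_x q k x = 0.
  rewrite (Rintegral_density mu_density (mq k) (iq k)).
  under eq_Rintegral do rewrite qE.
  have iG i : (lebesgue_cV n).-integrable setT
      (EFin \o (fun x => \sum_l M l i * (q l x * rho x))).
    by apply: integrableR_sum => // l _; exact: integrableRZ.
  rewrite Rintegral_sum// => [|i _]; last exact: integrableRZ.
  by rewrite big1// => i _; rewrite RintegralZl// G0 mulr0.
have iyg : mu.-integrable setT (EFin \o (fun x => y k x * g x)).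
  apply: (pgrowth_integrable mu_density S_pd).
    apply: measurable_funM; last exact: measurable_prodpoly.
    exact: measurable_fun_mulmx.
  exact: pgrowthM (pgrowth_mulmx M k) (gP p).
apply/eqP; rewrite eq_sym -subr_eq0 -q0 /q RintegralB//.
exact: prodpoly_integrable.
Qed.

(** Raising and lowering are adjoint: after integration by parts of the y_k term, the derivative of
    the first factor cancels against the second term of [hermiteu_succ]. *)
Lemma hermiteu_succ_dot a b k :
  \int[mu]_x (hermiteu (mi_succ k a) x * hermiteu b x) =
  (b k)%:R * \int[mu]_x (hermiteu a x * hermiteu (mi_pred k b) x).
Proof.
pose pa j := @hermite_poly R (a j); pose pb j := @hermite_poly R (b j).
have iD p q : mu.-integrable setT (EFin \o (fun x => prodpoly M p x * prodpoly M q x)).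
  have := prodpoly_integrable (fun j => p j * q j).
  by congr integrable; apply/funext => x /=; rewrite prodpolyM.
have iyD : mu.-integrable setT (EFin \o (fun x => y k x * (prodpoly M pa x * prodpoly M pb x))).
  apply: (pgrowth_integrable mu_density S_pd).
    apply: measurable_funM; first exact: measurable_fun_mulmx.
    by apply: measurable_funM; exact: measurable_prodpoly.
  apply: pgrowthM; first exact: pgrowth_mulmx.
  by apply: pgrowthM; exact: pgrowth_prodpoly.
have E x : hermiteu (mi_succ k a) x * hermiteu b x =
    y k x * (prodpoly M pa x * prodpoly M pb x) -
    prodpoly M (dprod pa k) x * prodpoly M pb x.
  by rewrite hermiteu_succ mulrBl mulrA.
under eq_Rintegral do rewrite E.
rewrite RintegralB//.
have := gauss_ibp (fun j => pa j * pb j) k.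
under eq_Rintegral do rewrite prodpolyM.
under [in X in _ = X -> _]eq_Rintegral do rewrite prodpoly_dprodM.
move=> ->; rewrite RintegralD// addrC addKr.
under eq_Rintegral do rewrite dprod_hermiteu mulrCA.
by rewrite RintegralZl//; exact: iD.
Qed.

(** Induction on the degree of a, lowering both indices; for a = 0 and b nonzero the roles are
    exchanged and the factor [a k = 0] appears. *)
Lemma hermiteu_dot a b :
  \int[mu]_x (hermiteu a x * hermiteu b x) = (a == b)%:R * (mi_fact a)%:R.
Proof.
have [m] := ubnP (\sum_j a j)%N; elim: m a b => // m IHm a b am.
have [/existsP[k ak]|] := boolP [exists k, (0 < a k)%N].
  rewrite -{1}(mi_predK ak) hermiteu_succ_dot IHm; last first.
    have aE : (\sum_j a j)%N = (\sum_j a j).-1.+1.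
      by rewrite prednK// (bigD1 k)//= ltn_addr.
    by rewrite (mi_pred_size ak aE) -ltnS -aE.
  have [b0|b0] := posnP (b k).
    by rewrite b0 mul0r; case: eqP ak => [->|_]; rewrite ?b0// mul0r.
  have -> : (mi_pred k a == mi_pred k b) = (a == b).
    apply/eqP/eqP => [ab|->//].
    by rewrite -(mi_predK ak) ab mi_predK.
  case: eqP => [->|_]; last by rewrite !mul0r mulr0.
  by rewrite !mul1r (mi_fact_pred b0) natrM.
rewrite negb_exists => /forallP a0.
have aE : a = [ffun=> 0%N].
  by apply/ffunP => j; rewrite ffunE; have := a0 j; rewrite -eqn0Ngt => /eqP.
have u0 x : hermiteu a x = 1.
  by rewrite /hermiteu /prodpoly big1// => j _; rewrite aE ffunE /= hornerC.
have f0 : mi_fact a = 1%N by rewrite /mi_fact big1// => j _; rewrite aE ffunE.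
rewrite f0 mulr1.
have [/existsP[k bk]|] := boolP [exists k, (0 < b k)%N].
  have -> : (a == b) = false by apply/eqP => ab; have := a0 k; rewrite ab bk.
  under eq_Rintegral do rewrite mulrC.
  rewrite -(mi_predK bk) hermiteu_succ_dot.
  by have := a0 k; rewrite -eqn0Ngt => /eqP ->; rewrite mul0r.
rewrite negb_exists => /forallP b0.
have <- : a = b.
  apply/ffunP => j; have := a0 j; have := b0 j.
  by rewrite -!eqn0Ngt => /eqP -> /eqP ->.
rewrite eqxx; under eq_Rintegral do rewrite u0 mulr1.
rewrite Rintegral_cst// mul1r; exact: (congr1 fine (@probability_setT _ _ _ mu)).
Qed.

Lemma hermiteu_bessel (I : finType) (e : I -> {ffun 'I_n -> nat})
    (f : 'cV[R]_n -> R) :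
  injective e -> measurable_fun setT f ->
  mu.-integrable setT (EFin \o (fun x => f x ^+ 2)) ->
  \sum_i (\int[mu]_x (f x * hermiteu (e i) x)) ^+ 2 / (mi_fact (e i))%:R
    <= \int[mu]_x (f x ^+ 2).
Proof.
move=> inje mf f2; apply: bessel => //.
- by move=> i; exact: L2_prodpoly_integrable.
- move=> i j; have := prodpoly_integrable
    (fun l => @hermite_poly R (e i l) * @hermite_poly R (e j l)).
  by congr integrable; apply/funext => x /=; rewrite prodpolyM.
- by move=> i; rewrite ltr0n; apply: prodn_gt0 => j; exact: fact_gt0.
- by move=> i j; rewrite hermiteu_dot (inj_eq inje).
Qed.

Context (Q B : 'M[R]_n).
Hypothesis lyapunov : B *m S + S *m B^T = - Q.

(** By [hermiteu_succ], each bracket in [weak_adjoint] is b_l times the Hermite polynomial lowered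
    at l and raised at k. *)
Lemma hermiteu_weak (v w : 'cV[R]_n -> R) b :
  measurable_fun setT v -> mu.-integrable setT (EFin \o (fun x => v x ^+ 2)) ->
  measurable_fun setT w -> mu.-integrable setT (EFin \o (fun x => w x ^+ 2)) ->
  (forall f, test_function setT f ->
    \int[lebesgue_cV n]_x (v x * ou_transpose Q B f x) =
    \int[lebesgue_cV n]_x (w x * f x)) ->
  \int[mu]_x (w x * hermiteu b x) =
  hermite_der (M *m B *m W) (fun a => \int[mu]_x (v x * hermiteu a x)) b.
Proof.
move=> mv vi mw wi vw.
rewrite (weak_adjoint S_pd lyapunov mu_density _ mv vi mw wi vw).
have E x : v x * (\sum_k \sum_l (M *m B *m W) k l *
    (y k x * prodpoly M (dprod (fun j => @hermite_poly R (b j)) l) x -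
     prodpoly M (dprod (dprod (fun j => @hermite_poly R (b j)) l) k) x)) =
  \sum_k \sum_l (M *m B *m W) k l * (b l)%:R *
    (v x * hermiteu (mi_succ k (mi_pred l b)) x).
  rewrite mulr_sumr; apply: eq_bigr => k _; rewrite mulr_sumr; apply: eq_bigr => l _.
  by rewrite dprod_hermiteu dprod2_hermiteu hermiteu_succ /hermiteu; ring.
under eq_Rintegral do rewrite E.
have iv a : mu.-integrable setT (EFin \o (fun x => v x * hermiteu a x)).
  exact: L2_prodpoly_integrable.
rewrite Rintegral_sum// => [|k _]; last first.
  by apply: integrableR_sum => // l _; exact: integrableRZ.
apply: eq_bigr => k _; rewrite Rintegral_sum// => [|l _]; last exact: integrableRZ.
by apply: eq_bigr => l _; rewrite RintegralZl.
Qed.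

End hermite_functions.

(** * Summation over the degrees *)

Section assembly.
Context {R : realType} {n : nat} (Q B : 'M[R]_n) (mu : probability 'cV[R]_n R).
Hypothesis Q_psd : psdmx Q.

Lemma L2normE (v : 'cV[R]_n -> R[i]) : L2 mu v ->
  [/\ mu.-integrable setT (EFin \o (fun x => complex.Re (v x) ^+ 2)),
      mu.-integrable setT (EFin \o (fun x => complex.Im (v x) ^+ 2)) &
      L2norm mu v = (Num.sqrt (\int[mu]_x (complex.Re (v x) ^+ 2) +
                               \int[mu]_x (complex.Im (v x) ^+ 2)))%:E].
Proof.
move=> [mr mi]; rewrite /L2norm unlock.
pose a x := complex.Re (v x); pose b x := complex.Im (v x).
have E x : (`|(Normc.normc (v x))%:E| `^ 2 = (a x ^+ 2 + b x ^+ 2)%:E)%E.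
  rewrite abse_EFin poweR_EFin powR_mulrn ?normr_ge0// real_normK ?num_real//.
  rewrite /a /b; case: (v x) => p q /=.
  by rewrite sqr_sqrtr// addr_ge0 ?sqr_ge0.
under eq_integral do rewrite E.
move=> /lty_poweRy fin2.
have m2 : measurable_fun setT (fun x => a x ^+ 2 + b x ^+ 2).
  by apply: measurable_funD; exact: measurable_funX.
have i2 : mu.-integrable setT (EFin \o (fun x => a x ^+ 2 + b x ^+ 2)).
  apply/integrableP; split; first exact/measurable_EFinP.
  under eq_integral do rewrite /= ger0_norm ?addr_ge0 ?sqr_ge0//.
  by apply: fin2; rewrite invr_eq0.
have ia : mu.-integrable setT (EFin \o (fun x => a x ^+ 2)).
  apply: le_integrableR i2 => //; first exact: measurable_funX.
  by move=> x _; rewrite !ger0_norm ?addr_ge0 ?sqr_ge0// lerDl sqr_ge0.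
have ib : mu.-integrable setT (EFin \o (fun x => b x ^+ 2)).
  apply: le_integrableR i2 => //; first exact: measurable_funX.
  by move=> x _; rewrite !ger0_norm ?addr_ge0 ?sqr_ge0// lerDr sqr_ge0.
split=> //; rewrite -RintegralD// -powR12_sqrt; last first.
  by apply: Rintegral_ge0 => x _; rewrite addr_ge0 ?sqr_ge0.
by rewrite -poweR_EFin /Rintegral fineK//; exact: integrable_fin_num i2.
Qed.

Hypothesis mu_density : has_density mu (gauss_density (Qoo Q B)).

Let S := Qoo Q B.
Let W := sqrtmx S.
Let M := invmx W.
Let Bh := M *m B *m W.

Lemma Qoo_pd : pdmx S.
Proof. exact: gauss_density_pd mu_density (covmx_sym _ Q_psd _). Qed.

Lemma hermite_hermiteu b x :
  hermite S b x = hermiteu S b x * (Num.sqrt (mi_fact b)%:R)^-1.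
Proof.
rewrite /hermite big_split/=; congr (_ * _).
rewrite prodfV /mi_fact natr_prod; congr (_^-1).
suff [] : 0 <= \prod_j ((b j)`!%:R : R) /\
    \prod_j Num.sqrt ((b j)`!%:R : R) = Num.sqrt (\prod_j (b j)`!%:R) by [].
apply: (big_ind2 (fun q p : R => 0 <= q /\ p = Num.sqrt q)).
- by rewrite sqrtr1.
- by move=> p q p' q' [q0 ->] [q0' ->]; rewrite mulr_ge0// sqrtrM.
- by move=> j _.
Qed.

Lemma hermite_coef (v : 'cV[R]_n -> R) b :
  measurable_fun setT v -> mu.-integrable setT (EFin \o (fun x => v x ^+ 2)) ->
  (\int[mu]_x (v x * hermite S b x)) ^+ 2 =
  (\int[mu]_x (v x * hermiteu S b x)) ^+ 2 / (mi_fact b)%:R.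
Proof.
move=> mv vi; under eq_Rintegral do rewrite hermite_hermiteu mulrA.
rewrite RintegralZr//; last exact: (L2_prodpoly_integrable Qoo_pd mu_density).
by rewrite exprMn exprVn sqr_sqrtr.
Qed.

Variable k0 : nat.
Hypothesis k0_rank : \rank (kalmanmx Q B k0) = n.

(** Conjugation by W turns powers of [Bh^T] into powers of B^T; transposed, the hypothesis says that
    the row (M x)^T annihilates each block B^j Q^{1/2}, and full rank makes it 0. *)
Lemma kalman_normalized (x : 'cV[R]_n) :
  (forall j, (j <= k0)%N -> sqrtmx Q *m M *m Bh^T ^+ j *m x = 0) -> x = 0.
Proof.
move=> H; have Spd := Qoo_pd.
have Wu := sqrtmx_unit Spd; have Ws : W^T = W := sqrtmx_sym Spd.
have Ms : M^T = M := invmx_sqrtmx_sym Spd.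
have [Ks KK] := sqrtmxP Q_psd.
have BhE : Bh^T = W *m B^T *m M by rewrite /Bh !trmx_mul Ws Ms mulmxA.
have pow j : M *m Bh^T ^+ j = B^T ^+ j *m M.
  elim: j => [|j IHj]; first by rewrite !expr0 mulmx1 mul1mx.
  rewrite exprSr -[_ * _]/(_ *m _) mulmxA IHj BhE exprSr -[_ * B^T]/(_ *m _).
  by rewrite !mulmxA mulmxKV.
have trX j : (B^T ^+ j)^T = B ^+ j.
  elim: j => [|j IHj]; first by rewrite !expr0 trmx1.
  by rewrite exprS exprSr -[in LHS]/(_ *m _) trmx_mul trmxK IHj.
have row0 : (M *m x)^T *m kalmanmx Q B k0 = 0.
  rewrite /kalmanmx mul_mxrow -[RHS]mxrow0; apply: eq_mxrow => j.
  have := congr1 trmx (H j (ltn_ord j)).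
  rewrite -(mulmxA (sqrtmx Q)) pow -!mulmxA trmx_mul Ks trmx0 trmx_mul.
  by rewrite trX mulmxA.
have free : row_free (kalmanmx Q B k0) by rewrite /row_free k0_rank.
have : M *m x = 0.
  apply: trmx_inj; rewrite trmx0; apply: (row_free_inj free).
  by rewrite row0 mul0mx.
by move=> /(congr1 (mulmx W)); rewrite mulmx0 mulKVmx.
Qed.

Let s : R := 2 / (2 * k0 + 1)%:R.

(** For real v and w, to be applied to real and imaginary parts; the truncation at degree K is
    finite and C does not depend on K. *)
Lemma sobolev_level : exists2 C : R, 0 < C & forall v w : 'cV[R]_n -> R,
  measurable_fun setT v -> mu.-integrable setT (EFin \o (fun x => v x ^+ 2)) ->
  measurable_fun setT w -> mu.-integrable setT (EFin \o (fun x => w x ^+ 2)) ->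
  (forall f, test_function setT f ->
    \int[lebesgue_cV n]_x (v x * ou_transpose Q B f x) =
    \int[lebesgue_cV n]_x (w x * f x)) ->
  forall K, \sum_(c : {ffun 'I_n -> 'I_K.+1} | (\sum_j mi_of_ord c j <= K)%N)
    (1 + (\sum_j mi_of_ord c j)%:R / 2) `^ s *
      (\int[mu]_x (v x * hermite S (mi_of_ord c) x)) ^+ 2 <=
    C * (\int[mu]_x (w x ^+ 2) + \int[mu]_x (v x ^+ 2)).
Proof.
have Spd := Qoo_pd; have lyap := lyapunov_equation Q_psd Spd.
have [Ks KK] := sqrtmxP Q_psd.
have AK : Bh^T + Bh^T^T = - ((sqrtmx Q *m M)^T *m (sqrtmx Q *m M)).
  rewrite trmxK addrC (normalized_lyapunov Spd lyap) trmx_mul Ks.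
  by rewrite (invmx_sqrtmx_sym Spd) mulmxA -(mulmxA M (sqrtmx Q)) KK.
have [C C0 sub] := tensor_subelliptic AK kalman_normalized.
(* C pays for the degrees m >= 1; in degree 0, where the weight is 1, the coefficient is paid for by
   |v|^2. *)
exists (C + 1); first exact: addr_gt0.
move=> v w mv vi mw wi vw K.
pose g b := \int[mu]_x (v x * hermiteu S b x).
pose h b := \int[mu]_x (w x * hermiteu S b x).
have hE b : h b = hermite_der Bh g b.
  exact: (hermiteu_weak Spd mu_density lyap b mv vi mw wi vw).
pose deg (c : {ffun 'I_n -> 'I_K.+1}) := (\sum_j mi_of_ord c j)%N.
pose F f (c : {ffun 'I_n -> 'I_K.+1}) : R :=
  f (mi_of_ord c) ^+ 2 / (mi_fact (mi_of_ord c))%:R.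
have F0 f c : 0 <= F f c by rewrite mulr_ge0 ?sqr_ge0 ?invr_ge0.
have level m : (m <= K)%N ->
    \sum_(c | deg c == m) (1 + (deg c)%:R / 2) `^ s * F g c <=
    \sum_(c | deg c == m) (C * F h c + F g c).
  move=> mK.
  rewrite (eq_bigr (fun c => (1 + m%:R / 2) `^ s * F g c)) => [|c /eqP->//].
  rewrite -mulr_sumr big_split/= -mulr_sumr.
  case: m mK => [|m] mK.
    rewrite mul0r addr0 powR1 mul1r lerDr.
    by rewrite mulr_ge0 ?(ltW C0)// sumr_ge0.
  rewrite -[leLHS]addr0; apply: lerD; last by rewrite sumr_ge0.
  rewrite (wsum_multi_index (fun b => g b ^+ 2) mK).
  rewrite (wsum_multi_index (fun b => h b ^+ 2) mK) !mulrA.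
  rewrite ler_wpM2r ?invr_ge0//.
  have := sub m.+1 (g \o @mi_count n) isT; rewrite -/(s).
  rewrite /wnorm2 => H; apply: le_trans H _.
  rewrite ler_pM2l// le_eqVlt; apply/orP; left; apply/eqP.
  have E u : size u = m.+1 -> tensor_der m.+1 Bh^T (g \o @mi_count n) u ^+ 2 =
      h (mi_count u) ^+ 2.
    by move=> um; rewrite (tensor_der_count _ _ um) hE.
  exact: wsum_size E.
apply: (@le_trans _ _ (\sum_(c | (deg c <= K)%N) (C * F h c + F g c))).
  rewrite (partition_big (fun c => inord (deg c) : 'I_K.+1) predT)//=.
  rewrite [leRHS](partition_big (fun c => inord (deg c) : 'I_K.+1) predT)//=.
  apply: ler_sum => m _.
  have condE c : (deg c <= K)%N && (inord (deg c) == m :> 'I_K.+1) = (deg c == m).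
    apply/andP/eqP => [[cK /eqP <-]|cm]; first by rewrite inordK.
    by split; [rewrite cm -ltnS|apply/eqP/val_inj; rewrite /= cm inord_val].
  rewrite (eq_bigl _ _ condE) [leRHS](eq_bigl _ _ condE).
  under eq_bigr do rewrite (hermite_coef _ mv vi).
  by apply: level; rewrite -ltnS.
have inj : injective (@mi_of_ord n K.+1).
  move=> c c' /ffunP cc; apply/ffunP => j; apply: val_inj.
  by have := cc j; rewrite !ffunE.
have bess (u : 'cV[R]_n -> R) : measurable_fun setT u ->
    mu.-integrable setT (EFin \o (fun x => u x ^+ 2)) ->
    \sum_c F (fun b => \int[mu]_x (u x * hermiteu S b x)) c <= \int[mu]_x (u x ^+ 2).
  by move=> mu' ui; exact: hermiteu_bessel.
apply: (@le_trans _ _ (\sum_c (C * F h c + F g c))).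
  rewrite big_mkcond/=; apply: ler_sum => c _; case: ifP => // _.
  by rewrite addr_ge0// mulr_ge0// ltW.
rewrite big_split/= -mulr_sumr mulrDl mul1r mulrDr.
have i0 (u : 'cV[R]_n -> R) : 0 <= \int[mu]_x (u x ^+ 2).
  by apply: Rintegral_ge0 => x _; exact: sqr_ge0.
have := bess v mv vi; have := bess w mw wi; rewrite -/g -/h => hw gv.
have : C * \sum_c F h c <= C * \int[mu]_x (w x ^+ 2) by rewrite ler_pM2l.
have := mulr_ge0 (ltW C0) (i0 v); have := i0 w; lra.
Qed.

End assembly.

(** * Infinite sums over multi-indices *)

Section esum_bound.
Context {R : realType} {n : nat}.

(** Every finite set of multi-indices lies in a truncation: the sum of all its degrees serves as
    K. *)
Lemma esum_multi_index_le (F : {ffun 'I_n -> nat} -> R) (c : R) :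
  (forall b, 0 <= F b) ->
  (forall K, \sum_(d : {ffun 'I_n -> 'I_K.+1} | (\sum_j mi_of_ord d j <= K)%N)
    F (mi_of_ord d) <= c) ->
  (\esum_(b in [set: {ffun 'I_n -> nat}]) (F b)%:E <= c%:E)%E.
Proof.
move=> F0 Fc; apply: ge_ereal_sup => _ [A [fA _] <-].
rewrite fsbig_finite//= sumEFin lee_fin.
pose X : seq {ffun 'I_n -> nat} := finmap.enum_fset (fset_set A); pose K := (\sum_(b <- X) \sum_j b j)%N.
apply: le_trans (Fc K).
have uX : uniq X by exact: finmap.fset_uniq.
pose P (d : {ffun 'I_n -> 'I_K.+1}) := (\sum_j mi_of_ord d j <= K)%N.
pose Y := [seq mi_of_ord d | d <- enum P].
have inj : injective (@mi_of_ord n K.+1).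
  move=> d d' /ffunP dd; apply/ffunP => j; apply: val_inj.
  by have := dd j; rewrite !ffunE.
have uY : uniq Y by rewrite map_inj_uniq// enum_uniq.
have XY b : b \in X -> b \in Y.
  move=> bX; have bK : (\sum_j b j <= K)%N.
    by rewrite /K (big_rem b)//= leq_addr.
  have bj j : (b j < K.+1)%N.
    by rewrite ltnS (leq_trans _ bK)// (bigD1 j)//= leq_addr.
  have bE : mi_of_ord [ffun j => Ordinal (bj j)] = b.
    by apply/ffunP => j; rewrite !ffunE.
  by apply/mapP; exists [ffun j => Ordinal (bj j)]; rewrite ?mem_enum ?bE// /P unfold_in /= bE.
have -> : \sum_(d | P d) F (mi_of_ord d) = \sum_(b <- Y) F b.
  by rewrite big_map big_enum.
have -> : \sum_(b <- X) F b = \sum_(b <- Y | b \in X) F b.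
  rewrite -[RHS]big_filter; apply: perm_big; apply: uniq_perm => //.
    exact: filter_uniq.
  by move=> b; rewrite mem_filter; apply/idP/andP => [bX|[]//]; split => //; exact: XY.
rewrite big_mkcond/=; apply: ler_sum => b _; by case: ifP.
Qed.

End esum_bound.

Theorem proposition2p3 (R : realType) (n : nat) (n_gt0 : (0 < n)%N)
    (Q B : 'M[R]_n) (Q_psd : psdmx Q)
    (P_hypo : hypoelliptic Q B)
    (mu : probability 'cV[R]_n R)
    (mu_inv : invariant_measure Q B mu)
    (mu_density : has_density mu (gauss_density (Qoo Q B)))
    (k0 : nat) (k0_le : (k0 <= n.-1)%N)
    (k0_rank : \rank (kalmanmx Q B k0) = n)
    (k0_min : forall k, (k < k0)%N -> \rank (kalmanmx Q B k) <> n) :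
  exists2 C : R, 0 < C &
    forall v Pv : 'cV[R]_n -> R[i],
      L2 mu v -> L2 mu Pv -> ou_weak Q B v Pv ->
      (sobolev_norm mu (Qoo Q B) (2 / (2 * k0 + 1)%:R) v
        <= C%:E * (L2norm mu Pv + L2norm mu v))%E.
Proof.
have [C C0 level] := sobolev_level Q_psd mu_density k0_rank.
exists (Num.sqrt C); first by rewrite sqrtr_gt0.
move=> v Pv Lv LPv vPv.
have [ra ia ->] := L2normE Lv; have [rb ib ->] := L2normE LPv.
have [mra mia _] := Lv; have [mrb mib _] := LPv.
set a := \int[mu]_x _; set a' := \int[mu]_x _; set b := \int[mu]_x _.
set b' := \int[mu]_x _.
have i0 (u : 'cV[R]_n -> R) : 0 <= \int[mu]_x (u x ^+ 2).
  by apply: Rintegral_ge0 => x _; exact: sqr_ge0.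
have a0 : 0 <= a + a' by rewrite addr_ge0// i0.
have b0 : 0 <= b + b' by rewrite addr_ge0// i0.
rewrite -EFinD -EFinM.
apply: (@le_trans _ _ ((C * (b + b' + (a + a')))%:E `^ 2^-1)%E).
  rewrite /sobolev_norm gt0_ler_poweR ?invr_ge0//.
  - by rewrite in_itv/= leey andbT; apply: esum_ge0 => c _;
      rewrite lee_fin mulr_ge0 ?powR_ge0// addr_ge0 ?sqr_ge0.
  - by rewrite in_itv/= leey andbT lee_fin mulr_ge0 ?(ltW C0)// addr_ge0.
  apply: esum_multi_index_le => [c|K].
    by rewrite mulr_ge0 ?powR_ge0// addr_ge0 ?sqr_ge0.
  (* P and the Hermite polynomials are real, so real and imaginary parts are estimated
     separately. *)
  under eq_bigr do rewrite mulrDr; rewrite big_split/=.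
  have := level _ _ mra ra mrb rb (fun f tf => (vPv f tf).1) K.
  have := level _ _ mia ia mib ib (fun f tf => (vPv f tf).2) K.
  rewrite -/a -/a' -/b -/b' => H1 H2.
  apply: le_trans (lerD H2 H1) _; rewrite -mulrDr ler_pM2l//; lra.
rewrite poweR_EFin lee_fin powR12_sqrt; last by rewrite mulr_ge0 ?(ltW C0)// addr_ge0.
rewrite sqrtrM ?(ltW C0)// ler_wpM2l ?sqrtr_ge0//.
(* The estimate is proved for squares, and |Pv|^2 + |v|^2 <= (|Pv| + |v|)^2. *)
rewrite -[leRHS]ger0_norm ?addr_ge0 ?sqrtr_ge0// -sqrtr_sqr ler_wsqrtr//.
rewrite sqrrD !sqr_sqrtr//.
by have := mulr_ge0 (sqrtr_ge0 (b + b')) (sqrtr_ge0 (a + a')); lra.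
Qed.
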